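(* Let $A=K[a_1,\ldots,a_n]$ be a solvable polynomial algebra with admissible system $(\mathscr{B},\prec_{gr})$, where $\prec_{gr}$ is a graded monomial ordering with respect to a positive-degree function $d(~)$ on $A$, and let $A$ be $\mathbb{N}$-filtered by $F_pA=K\text{-span}\{a^\alpha\in\mathscr{B}\mid d(a^\alpha)\le p\}$, $p\in\mathbb{N}$. Let $L_0=\oplus_{i=1}^mAe_i$ be a filtered free $A$-module with filtration $FL_0=\{F_qL_0\}_{q\in\mathbb{N}}$ such that $d_{\rm fil}(e_i)=b_i$, $1\le i\le m$, let $N=\sum_{i=1}^sA\xi_i$ be a finitely generated submodule of $L_0$, and let $M=L_0/N$ carry the filtration $FM=\{F_qM=(F_qL_0+N)/N\}_{q\in\mathbb{N}}$. Then, after $L_0$ and $N$ are possibly replaced by $L_0'$ and $N'$ as in Procedure 2 below (so that $M$ is identified with $L_0'/N'$ by a strict filtered isomorphism), $M$ has a minimal filtered free resolution of length $d\le n$, $$0\to L_d\xrightarrow{\varphi_d}\cdots\xrightarrow{\varphi_2}L_1\xrightarrow{\varphi_1}L_0\xrightarrow{\varphi_0}M\to 0,$$ which can be constructed by the following procedures. Procedure 1. Fix a graded left monomial ordering $\prec_{e\text{-}gr}$ on the $K$-basis $\{a^\alpha e_i\}$ of $L_0$ and, from the generators $\xi_1,\ldots,\xi_s$, compute by the Buchberger algorithm a left Gröbner basis $\mathcal{G}=\{g_1,\ldots,g_z\}$ of $N$ with respect to $\prec_{e\text{-}gr}$; then $\mathcal{G}$ is a standard basis of $N$ with respect to the induced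 filtration $FN=\{F_qN=N\cap F_qL_0\}_{q\in\mathbb{N}}$. Procedure 2. Run the elimination algorithm (Algorithm 2, described in the context) on $\{e_1,\ldots,e_m\}$ and $\mathcal{G}$ to compute a subset $\{e_{i_1},\ldots,e_{i_{m'}}\}\subset\{e_1,\ldots,e_m\}$ and a subset $V=\{v_1,\ldots,v_t\}\subset N\cap L_0'$, where $L_0'=\oplus_{q=1}^{m'}Ae_{i_q}$, such that, with $N'=\sum_{k=1}^tAv_k$, there is a strict filtered isomorphism $L_0'/N'\cong M$ and $\{\overline{e}_{i_1},\ldots,\overline{e}_{i_{m'}}\}$ is a minimal F-basis of $M$ with respect to $FM$. Replace $L_0$ by $L_0'$ and $N$ by $N'$ (with generating set $U=V$), and let $\varphi_0:L_0\to M$ be the canonical map. Procedure 3. From the generating set $U$ of $N$ compute a minimal standard basis $W=\{\xi_{j_1},\ldots,\xi_{j_{m_1}}\}$ of $N$ with respect to $FN$, as follows: compute a left Gröbner basis of $N$ with respect to a graded left monomial ordering, select from its set of principal symbols a minimal homogeneous generating set of the associated graded module $G(N)$, and take the corresponding elements of the Gröbner basis. Procedure 4. Compute (using the Buchberger algorithm with input $W$) a finite generating set $U_1=\{\eta_1,\ldots,\eta_{s_1}\}$ of the syzygy module $N_1=\mathrm{Syz}(W)=\{\sum_kh_k\varepsilon_k\mid\sum_kh_k\xi_{j_k}=0\}$ in the free $A$-module $L_1=\oplus_{k=1}^{m_1}A\varepsilon_k$. Procedure 5. Equip $L_1$ with the filtration of a filtered free module such that $d_{\rm fil}(\varepsilon_k)=d_{\rm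 fil}(\xi_{j_k})$, and define $\varphi_1:L_1\to L_0$ by $\varphi_1(\varepsilon_k)=\xi_{j_k}$, $1\le k\le m_1$; this gives an exact sequence of strict filtered homomorphisms $0\to N_1\to L_1\xrightarrow{\varphi_1}L_0\xrightarrow{\varphi_0}M\to0$. If $N_1\ne0$, repeat Procedures 3--5 with $N_1\subset L_1$ and generating set $U_1$ in place of $N$ and $U$, and so on.
   Context: $K$ is a field, $\mathbb{N}$ the nonnegative integers, modules are left unitary modules. Finite sets displayed as $\{v_1,\ldots,v_m\}$ are treated as indexed families. Solvable polynomial algebra: a $K$-algebra $A=K[a_1,\ldots,a_n]$ with minimal generating set $\{a_1,\ldots,a_n\}$ having $K$-basis $\mathscr{B}=\{a^\alpha=a_1^{\alpha_1}\cdots a_n^{\alpha_n}\mid\alpha\in\mathbb{N}^n\}$ (PBW basis) and a total ordering $\prec$ on $\mathscr{B}$ such that, writing $\mathbf{LM}(f)$ for the $\prec$-largest monomial occurring in $f\neq0$: (1) $\prec$ is a well-ordering; (2) $a^\alpha\prec a^\beta$ and $\mathbf{LM}(a^\gamma a^\alpha a^\eta),\mathbf{LM}(a^\gamma a^\beta a^\eta)\notin K$ imply $\mathbf{LM}(a^\gamma a^\alpha a^\eta)\prec\mathbf{LM}(a^\gamma a^\beta a^\eta)$; (3) if $a^\beta\ne a^\gamma$ and $a^\gamma=\mathbf{LM}(a^\alpha a^\beta a^\eta)$ then $a^\beta\prec a^\gamma$ (these say $\prec$ is a monomial ordering and $(\mathscr{B},\prec)$ an admissible system); and $a^\alpha a^\beta=\lambda_{\alpha,\beta}a^{\alpha+\beta}+f_{\alpha,\beta}$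 with $\lambda_{\alpha,\beta}\in K\setminus\{0\}$ and $f_{\alpha,\beta}=0$ or $\mathbf{LM}(f_{\alpha,\beta})\prec a^{\alpha+\beta}$. A positive-degree function $d(~)$ is given by positive integers $d(a_i)=m_i$: $d(a^\alpha)=\sum m_i\alpha_i$ and $d(f)$ is the maximum of $d(a^\alpha)$ over monomials occurring in $f\ne 0$. The ordering is graded w.r.t. $d$ if $a^\alpha\prec a^\beta$ implies $d(a^\alpha)\le d(a^\beta)$; then $F_pAF_qA\subseteq F_{p+q}A$. A filtered $A$-module $M$ has $K$-subspaces $F_qM$ ($q\in\mathbb{N}$) with $F_qM\subseteq F_{q+1}M$, $\cup_qF_qM=M$, $F_pAF_qM\subseteq F_{p+q}M$; put $F_{-1}M=0$. For $0\ne\xi\in M$, $d_{\rm fil}(\xi)=q$ means $\xi\in F_qM\setminus F_{q-1}M$. A submodule $N\subseteq M$ has the induced filtration $F_qN=N\cap F_qM$. A filtered free module $L=\oplus_{i=1}^sAe_i$ with $d_{\rm fil}(e_i)=b_i\in\mathbb{N}$ has $F_qL=K\text{-span}\{a^\alpha e_i\mid d(a^\alpha)+b_i\le q\}$. $G(A)=\oplus_pF_pA/F_{p-1}A$ and $G(M)=\oplus_qF_qM/F_{q-1}M$ are the associated graded algebra and module; the principal symbol of $\xi$ with $d_{\rm fil}(\xi)=q$ is $\sigma(\xi)=\xi+F_{q-1}M\in G(M)_q$. A homomorphism $\varphi:M\to M'$ is filtered if $\varphi(F_qM)\subseteq F_qM'$ for all $q$, strict filtered if $\varphi(F_qM)=\varphi(M)\cap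 F_qM'$ for all $q$; a strict filtered isomorphism is an $A$-isomorphism with $\varphi(F_qM)=F_qM'$ for all $q$. F-basis: a finite set of nonzero elements $v_1,\ldots,v_m\in M$ for which there are $n_1,\ldots,n_m\in\mathbb{N}$ with $F_qM=\sum_i\left(\sum_{p_i+n_i\le q}F_{p_i}A\right)v_i$ for all $q$ (equivalently, $G(M)=\sum_iG(A)\sigma(v_i)$). It is minimal if no proper subset is an F-basis. A (minimal) standard basis of a submodule $N\subseteq M$ is a (minimal) F-basis of $N$ for the induced filtration. Minimal filtered free resolution of $M=L_0/N$ (with $L_0$ filtered free and $FM$ the quotient filtration): an exact sequence of filtered homomorphisms $\cdots\to L_i\xrightarrow{\varphi_i}\cdots\to L_1\xrightarrow{\varphi_1}L_0\xrightarrow{\varphi_0}M\to0$ such that (1) $\varphi_0$ is the canonical epimorphism and the images $\overline{e}_i$ of the basis of $L_0$ form a minimal F-basis of $M$; (2) for $i\ge1$, $L_i$ is filtered free with finite basis $\mathscr{E}_i$, $\varphi_i$ is a strict filtered homomorphism, and $\varphi_i(\mathscr{E}_i)$ is a minimal standard basis of $\mathrm{Ker}\,\varphi_{i-1}$ for the filtration induced by $FL_{i-1}$. Left monomial ordering $\prec_e$ on $\mathscr{B}(e)=\{a^\alpha e_i\}$: a total ordering with (1) $a^\alpha e_i\prec_ea^\beta e_j$ implies $\mathbf{LM}(a^\gamma a^\alpha e_i)\prec_e\mathbf{LM}(a^\gamma a^\beta e_j)$, and (2) $a^\alpha\prec a^\beta$ implies $a^\alpha e_i\prec_ea^\beta e_i$.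 It is graded if $a^\alpha e_i\prec_e a^\beta e_j$ implies $d(a^\alpha)+b_i\le d(a^\beta)+b_j$. A finite $\mathcal{G}\subset N\setminus\{0\}$ is a left Gröbner basis of a submodule $N$ if for each $0\ne\xi\in N$ there are $g\in\mathcal{G}$ and $a^\gamma\in\mathscr{B}$ with $\mathbf{LM}(\xi)=\mathbf{LM}(a^\gamma\mathbf{LM}(g))$. Left Gröbner bases of finitely generated submodules are computed by the noncommutative Buchberger algorithm via left S-polynomials. Algorithm 2 (input: basis $E=\{e_1,\ldots,e_m\}$ with $d_{\rm fil}(e_i)=b_i$, standard basis $V$ of $N$): while there is $v_j=\sum_kf_{kj}e_k\in V$ having a coefficient $f_{ij}\in K\setminus\{0\}$ with $b_i=d_{\rm fil}(v_j)$ (take the least such index $i$), replace every other $v_\ell=\sum_k f_{k\ell}e_k\in V$ by $v_\ell-\frac{1}{f_{ij}}f_{i\ell}v_j$, discard $v_j$ and all zero elements from $V$, and discard $e_i$ from $E$. Output the final $E$ and $V$. *)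

(* Defs.v *)
From Stdlib Require Import Relation_Operators.
From HB Require Import structures.
From mathcomp Require Export all_boot all_order all_algebra.
From mathcomp Require Export mpoly.

Set Implicit Arguments.
Unset Strict Implicit.
Unset Printing Implicit Defensive.

Import GRing.Theory.
Local Open Scope ring_scope.

(* Nondeterministic algorithms are relations between states: [halts] says that
   every run from [x] is finite, [output] that some run from [x] stops at [y]. *)
Definition halts (T : Type) (step : T -> T -> Prop) (x : T) : Prop :=
  Acc (fun y z => step z y) x.

Definition output (T : Type) (step : T -> T -> Prop) (x y : T) : Prop :=
  clos_refl_trans T step x y /\ forall z, ~ step y z.

Section SolvableAlgebra.
Context {K : fieldType} {A : algType K} {n : nat}.
Variables (a : 'I_n -> A) (prec : rel 'X_{1..n}) (w : 'I_n -> nat).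

(* [prec] is the strict order; a^alpha is identified with its exponent alpha. *)

Definition mon (alpha : 'X_{1..n}) : A := \prod_(i < n) a i ^+ alpha i.

(* An element of {mpoly K[n]} serves only as a finitely supported family of
   scalars indexed by exponents; its multiplication is never used. *)
Definition lincomb (c : {mpoly K[n]}) : A :=
  \sum_(alpha <- msupp c) c@_alpha *: mon alpha.

Inductive generated_by (J : {set 'I_n}) : A -> Prop :=
| GenVar i : i \in J -> generated_by J (a i)
| GenScalar (k : K) : generated_by J k%:A
| GenAdd x y : generated_by J x -> generated_by J y -> generated_by J (x + y)
| GenMul x y : generated_by J x -> generated_by J y -> generated_by J (x * y).

Definition minimal_generating_set : Prop :=
  (forall x, generated_by setT x) /\
  forall J : {set 'I_n}, J \proper setT -> ~ forall x, generated_by J x.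

Definition PBW_basis : Prop :=
  forall f : A, exists! c : {mpoly K[n]}, f = lincomb c.

Definition occurs (f : A) (alpha : 'X_{1..n}) : Prop :=
  exists2 c, f = lincomb c & alpha \in msupp c.

(* LM(f) = a^alpha; this entails f <> 0. *)
Definition is_LM (f : A) (alpha : 'X_{1..n}) : Prop :=
  occurs f alpha /\
  forall beta, occurs f beta -> beta != alpha -> prec beta alpha.

Definition strict_total_order (T : eqType) (lt : rel T) : Prop :=
  [/\ irreflexive lt, transitive lt & forall x y, x != y -> lt x y || lt y x].

Record solvable_polynomial_algebra : Prop := SolvablePolynomialAlgebra {
  spa_generators : minimal_generating_set;
  spa_basis : PBW_basis;
  spa_total : strict_total_order prec;
  spa_well_founded : well_founded (fun alpha beta => prec alpha beta);
  spa_compatible : forall alpha beta gamma eta mu nu,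
    prec alpha beta ->
    is_LM (mon gamma * mon alpha * mon eta) mu ->
    is_LM (mon gamma * mon beta * mon eta) nu ->
    mu != 0%MM -> nu != 0%MM -> prec mu nu;
  spa_increasing : forall alpha beta gamma eta,
    beta != gamma -> is_LM (mon alpha * mon beta * mon eta) gamma ->
    prec beta gamma;
  spa_solvable : forall alpha beta, exists (l : K) (f : A),
    [/\ l != 0, mon alpha * mon beta = l *: mon (alpha + beta)%MM + f
      & f = 0 \/ exists2 mu, is_LM f mu & prec mu (alpha + beta)%MM]
}.

Definition wdeg (alpha : 'X_{1..n}) : nat := (\sum_(i < n) w i * alpha i)%N.

Definition graded_ordering : Prop :=
  forall alpha beta, prec alpha beta -> (wdeg alpha <= wdeg beta)%N.

Definition FA (p : nat) (f : A) : Prop :=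
  exists2 c, (forall alpha, alpha \in msupp c -> (wdeg alpha <= p)%N)
           & f = lincomb c.

(* A filtration of a submodule of M is given by predicates on M itself. *)

Definition span (M : lmodType A) (t : nat) (v : 'I_t -> M) (x : M) : Prop :=
  exists h : 'I_t -> A, x = \sum_i h i *: v i.

Definition kernel (M M' : lmodType A) (f : M -> M') (x : M) : Prop := f x = 0.

Definition induced (M : lmodType A) (F : nat -> M -> Prop) (N : M -> Prop)
  (q : nat) (x : M) : Prop := N x /\ F q x.

(* F_{q-1}, with the convention F_{-1} = 0. *)
Definition Fpred (M : lmodType A) (F : nat -> M -> Prop) (q : nat) (x : M) :=
  if q is p.+1 then F p x else x = 0.

(* d_fil(x) = q; this entails x <> 0. *)
Definition dfil (M : lmodType A) (F : nat -> M -> Prop) (x : M) (q : nat) :=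
  F q x /\ ~ Fpred F q x.

Definition filtered (M M' : lmodType A) (F : nat -> M -> Prop)
    (F' : nat -> M' -> Prop) (f : M -> M') : Prop :=
  forall q x, F q x -> F' q (f x).

Definition strict_filtered (M M' : lmodType A) (F : nat -> M -> Prop)
    (F' : nat -> M' -> Prop) (f : M -> M') : Prop :=
  forall q y,
    (exists2 x, F q x & y = f x) <-> (exists x, y = f x) /\ F' q y.

Definition strict_filtered_iso (M M' : lmodType A) (F : nat -> M -> Prop)
    (F' : nat -> M' -> Prop) (f : {linear M -> M'}) : Prop :=
  bijective f /\ forall q y, (exists2 x, F q x & y = f x) <-> F' q y.

(* [pi : L -> M] presents M as the quotient module L/N. *)
Definition is_quotient (L M : lmodType A) (N : L -> Prop)
    (pi : {linear L -> M}) : Prop :=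
  (forall y, exists x, y = pi x) /\ (forall x, kernel pi x <-> N x).

Definition quotient_filtration (L M : lmodType A) (F : nat -> L -> Prop)
    (pi : L -> M) (q : nat) (y : M) : Prop := exists2 x, F q x & y = pi x.

Definition F_basis_on (M : lmodType A) (F : nat -> M -> Prop) (I : finType)
    (J : {set I}) (v : I -> M) : Prop :=
  (forall i, i \in J -> v i <> 0) /\
  exists nu : I -> nat, forall q x,
    F q x <->
    exists2 h : I -> A,
      (forall i, exists2 c : nat -> A, (forall p, FA p (c p))
         & h i = \sum_(p < q.+1 | (p + nu i <= q)%N) c p)
      & x = \sum_(i in J) h i *: v i.

Definition F_basis (M : lmodType A) (F : nat -> M -> Prop) (I : finType)
    (v : I -> M) : Prop := F_basis_on F setT v.

Definition minimal_F_basis (M : lmodType A) (F : nat -> M -> Prop)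
    (I : finType) (v : I -> M) : Prop :=
  F_basis F v /\ forall J : {set I}, J \proper setT -> ~ F_basis_on F J v.

Definition standard_basis (M : lmodType A) (F : nat -> M -> Prop)
    (N : M -> Prop) (I : finType) (v : I -> M) : Prop :=
  (forall i, N (v i)) /\ F_basis (induced F N) v.

Definition minimal_standard_basis (M : lmodType A) (F : nat -> M -> Prop)
    (N : M -> Prop) (I : finType) (v : I -> M) : Prop :=
  (forall i, N (v i)) /\ minimal_F_basis (induced F N) v.

(* An element of G(M), the direct sum of the F_q/F_{q-1}, is represented by a
   finitely supported family x with x q in F_q; two families represent the same
   element when they are related by [gr_eq]. *)
Definition gr_elt (M : lmodType A) (F : nat -> M -> Prop) (x : nat -> M) :=
  (forall q, F q (x q)) /\ exists B, forall q, (B <= q)%N -> x q = 0.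

Definition gr_eq (M : lmodType A) (F : nat -> M -> Prop) (x y : nat -> M) :=
  forall q, Fpred F q (x q - y q).

Definition gr_act (M : lmodType A) (g : nat -> A) (x : nat -> M) : nat -> M :=
  fun q => \sum_(p < q.+1) g p *: x (q - p)%N.

(* The class of x in degree q, i.e. sigma(x) when q = d_fil(x). *)
Definition symbol (M : lmodType A) (q : nat) (x : M) : nat -> M :=
  fun k => if k == q then x else 0.

Definition gr_generates (M : lmodType A) (F : nat -> M -> Prop) (I : finType)
    (J : {set I}) (x : I -> nat -> M) : Prop :=
  forall y, gr_elt F y ->
  exists2 h : I -> nat -> A, (forall i, gr_elt (M := A^o) FA (h i))
    & gr_eq F y (fun q => \sum_(i in J) gr_act (h i) (x i) q).

(* The principal symbols of the v i form a minimal homogeneous generating set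
   of the associated graded module. *)
Definition minimal_symbol_generators (M : lmodType A) (F : nat -> M -> Prop)
    (I : finType) (v : I -> M) : Prop :=
  exists q : I -> nat,
    [/\ forall i, dfil F (v i) (q i),
        gr_generates F setT (fun i => symbol (q i) (v i))
      & forall J : {set I}, J \proper setT ->
        ~ gr_generates F J (fun i => symbol (q i) (v i))].

(* The free left module on e_1, ..., e_r is ['rV[A]_r]. *)

Definition ebasis (r : nat) (i : 'I_r) : 'rV[A]_r := delta_mx 0 i.

Definition FL (r : nat) (b : 'I_r -> nat) (q : nat) (x : 'rV[A]_r) : Prop :=
  exists2 c : 'I_r -> {mpoly K[n]},
    (forall i alpha, alpha \in msupp (c i) -> (wdeg alpha + b i <= q)%N)
    & x = \sum_i lincomb (c i) *: ebasis i.

(* (alpha, i) stands for a^alpha e_i. *)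
Definition monL (r : nat) (t : 'X_{1..n} * 'I_r) : 'rV[A]_r :=
  mon t.1 *: ebasis t.2.

Definition coefL (r : nat) (x : 'rV[A]_r) (t : 'X_{1..n} * 'I_r) (k : K) :=
  exists2 c, x 0 t.2 = lincomb c & c@_(t.1) = k.

Definition occursL (r : nat) (x : 'rV[A]_r) (t : 'X_{1..n} * 'I_r) : Prop :=
  occurs (x 0 t.2) t.1.

Section LeftOrdering.
Variables (r : nat) (b : 'I_r -> nat) (lt : rel ('X_{1..n} * 'I_r)).

Definition is_LML (x : 'rV[A]_r) (t : 'X_{1..n} * 'I_r) : Prop :=
  occursL x t /\ forall t', occursL x t' -> t' != t -> lt t' t.

Definition is_LC (x : 'rV[A]_r) (k : K) : Prop :=
  exists2 t, is_LML x t & coefL x t k.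

Definition left_monomial_ordering : Prop :=
  [/\ strict_total_order lt,
      forall s t gamma mu nu, lt s t ->
        is_LML (mon gamma *: monL s) mu -> is_LML (mon gamma *: monL t) nu ->
        lt mu nu
    & forall alpha beta i, prec alpha beta -> lt (alpha, i) (beta, i)].

Definition graded_left_monomial_ordering : Prop :=
  left_monomial_ordering /\
  forall s t, lt s t -> (wdeg s.1 + b s.2 <= wdeg t.1 + b t.2)%N.

Definition left_Groebner_basis (N : 'rV[A]_r -> Prop) (G : seq 'rV[A]_r) :=
  (forall g, g \in G -> N g /\ g <> 0) /\
  forall x, N x -> x <> 0 ->
  exists g gamma t u,
    [/\ g \in G, is_LML g t, is_LML x u & is_LML (mon gamma *: monL t) u].

Definition LM_le (x y : 'rV[A]_r) : Prop :=
  forall t, is_LML x t -> exists2 u, is_LML y u & t = u \/ lt t u.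

(* Left division: s = sum_k h_k G_k + rho with remainder rho. *)
Definition left_division (G : seq 'rV[A]_r) (s : 'rV[A]_r) (h : nat -> A)
    (rho : 'rV[A]_r) : Prop :=
  [/\ s = \sum_(k < size G) h k *: G`_k + rho,
      forall k, (k < size G)%N -> LM_le (h k *: G`_k) s,
      LM_le rho s
    & forall t, occursL rho t -> forall g u gamma,
        g \in G -> is_LML g u -> ~ is_LML (mon gamma *: monL u) t].

(* The left S-polynomial of f and g is u f - v g; it exists only when the two
   leading monomials involve the same e_i. *)
Definition S_multipliers (f g : 'rV[A]_r) (u v : A) : Prop :=
  exists alpha beta i k l,
    [/\ is_LML f (alpha, i) /\ is_LML g (beta, i),
        is_LC (mon (mlcm alpha beta - alpha)%MM *: f) k,
        is_LC (mon (mlcm alpha beta - beta)%MM *: g) l,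
        u = k^-1 *: mon (mlcm alpha beta - alpha)%MM
      & v = l^-1 *: mon (mlcm alpha beta - beta)%MM].

(* Buchberger's algorithm on W_1, ..., W_t. A pair (g, c) in [bb_basis] records
   g = sum_k c_k W_k; [bb_pairs] holds the index pairs still to be treated, and
   [bb_syz] the syzygies of W read off from S-polynomials reduced to 0. *)
Record bstate (t : nat) := BState {
  bb_basis : seq ('rV[A]_r * 'rV[A]_t);
  bb_pairs : seq (nat * nat);
  bb_syz : seq 'rV[A]_t
}.

Definition bstart (t : nat) (W : 'I_t -> 'rV[A]_r) : bstate t :=
  let G := [seq (W k, ebasis k) | k <- enum 'I_t & W k != 0] in
  BState G [seq (i, j) | j <- iota 0 (size G), i <- iota 0 j] [::].

Definition cofactor (t : nat) (G : seq ('rV[A]_r * 'rV[A]_t)) (i j : nat)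
    (u v : A) (h : nat -> A) : 'rV[A]_t :=
  u *: (G`_i).2 - v *: (G`_j).2 - \sum_(k < size G) h k *: (G`_k).2.

Inductive bstep (t : nat) : bstate t -> bstate t -> Prop :=
| BStepSkip G B1 i j B2 Z :
    (forall u v, ~ S_multipliers (G`_i).1 (G`_j).1 u v) ->
    bstep (BState G (B1 ++ (i, j) :: B2) Z) (BState G (B1 ++ B2) Z)
| BStepZero G B1 i j B2 Z u v h :
    S_multipliers (G`_i).1 (G`_j).1 u v ->
    left_division (unzip1 G) (u *: (G`_i).1 - v *: (G`_j).1) h 0 ->
    bstep (BState G (B1 ++ (i, j) :: B2) Z)
          (BState G (B1 ++ B2) (rcons Z (cofactor G i j u v h)))
| BStepAdd G B1 i j B2 Z u v h rho :
    S_multipliers (G`_i).1 (G`_j).1 u v ->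
    left_division (unzip1 G) (u *: (G`_i).1 - v *: (G`_j).1) h rho ->
    rho <> 0 ->
    bstep (BState G (B1 ++ (i, j) :: B2) Z)
          (BState (rcons G (rho, cofactor G i j u v h))
             (B1 ++ B2 ++ [seq (k, size G) | k <- iota 0 (size G)]) Z).

End LeftOrdering.

Definition unit_coef_at (r : nat) (b : 'I_r -> nat) (v : 'rV[A]_r)
    (i : 'I_r) (k : K) : Prop :=
  [/\ v 0 i = k%:A, k != 0 & dfil (FL b) v (b i)].

Inductive elim_step (r : nat) (b : 'I_r -> nat) :
    {set 'I_r} * seq 'rV[A]_r -> {set 'I_r} * seq 'rV[A]_r -> Prop :=
| ElimStep (E : {set 'I_r}) V1 v V2 i k :
    i \in E -> unit_coef_at b v i k ->
    (forall j l, j \in E -> (j < i)%N -> ~ unit_coef_at b v j l) ->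
    elim_step b (E, V1 ++ v :: V2)
      (E :\ i,
       [seq x <- [seq u - (k^-1 *: u 0 i) *: v | u : 'rV[A]_r <- V1 ++ V2]
       | x != 0]).

(* The inclusion of L_0', the free module on the e_i with i in E, into L_0,
   and its left inverse, which forgets the other coordinates. *)
Definition incl (r : nat) (E : {set 'I_r}) (x : 'rV[A]_#|E|) : 'rV[A]_r :=
  \sum_q x 0 q *: ebasis (enum_val q).

Fact incl_is_linear r (E : {set 'I_r}) : linear (@incl r E).
Proof.
move=> h x y; rewrite /incl scaler_sumr -big_split /=.
by apply: eq_bigr => q _; rewrite !mxE scalerDl scalerA.
Qed.

HB.instance Definition _ r (E : {set 'I_r}) :=
  GRing.isLinear.Build A 'rV[A]_#|E| 'rV[A]_r _ (@incl r E)
    (@incl_is_linear r E).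

Definition restr (r : nat) (E : {set 'I_r}) (x : 'rV[A]_r) : 'rV[A]_#|E| :=
  \row_q x 0 (enum_val q).

Definition phi0 (r : nat) (M : lmodType A) (pi : {linear 'rV[A]_r -> M})
    (E : {set 'I_r}) : {linear 'rV[A]_#|E| -> M} := pi \o @incl r E.

(* A filtered free module together with generators of a submodule. *)
Record stage := Stage {
  rk : nat;
  bdeg : 'I_rk -> nat;
  gens : seq 'rV[A]_rk
}.

Definition fam (T : Type) (s : seq T) : 'I_(size s) -> T := tnth (in_tuple s).
Arguments fam {T} s _.

Definition submod (S : stage) : 'rV[A]_(rk S) -> Prop := span (fam (gens S)).

Definition restricted_stage (r : nat) (b : 'I_r -> nat) (E : {set 'I_r})
    (V : seq 'rV[A]_r) : stage :=
  Stage (fun q : 'I_#|E| => b (enum_val q)) (map (@restr r E) V).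

Definition select_minimal (S : stage) (G : seq 'rV[A]_(rk S)) (t : nat)
    (W : 'I_t -> 'rV[A]_(rk S)) : Prop :=
  (exists2 f : 'I_t -> 'I_(size G), injective f & W =1 (fam G \o f)) /\
  minimal_symbol_generators (induced (FL (@bdeg S)) (@submod S)) W.

Definition minimal_selection (S : stage) (t : nat) (W : 'I_t -> 'rV[A]_(rk S)) :=
  exists lt G,
    [/\ graded_left_monomial_ordering (@bdeg S) lt,
        left_Groebner_basis lt (@submod S) G
      & select_minimal G W].

Definition Syz (r t : nat) (W : 'I_t -> 'rV[A]_r) (h : 'rV[A]_t) : Prop :=
  \sum_k h 0 k *: W k = 0.

Definition generates_Syz (r t : nat) (W : 'I_t -> 'rV[A]_r)
    (U : seq 'rV[A]_t) : Prop :=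
  forall h, span (fam U) h <-> Syz W h.

(* From N in L_i, given by generators, to Syz(W) in L_{i+1}; any Groebner basis
   and any generators [gens T] of Syz(W) may be used, in particular those which
   Buchberger's algorithm computes. *)
Definition resolution_step (S T : stage)
    (phi : {linear 'rV[A]_(rk T) -> 'rV[A]_(rk S)}) : Prop :=
  let W := fun k : 'I_(rk T) => phi (ebasis k) in
  [/\ minimal_selection W,
      generates_Syz W (gens T)
    & forall k, dfil (FL (@bdeg S)) (W k) (@bdeg T k)].

(* Steps taken after N_i = 0 is reached only add modules of rank 0. *)
Definition stages (S0 : stage) (T : nat -> stage) (i : nat) : stage :=
  if i is j.+1 then T j else S0.

Definition chain_maps (S0 : stage) (T : nat -> stage) : Type :=
  forall i, {linear 'rV[A]_(rk (stages S0 T i.+1)) ->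
                    'rV[A]_(rk (stages S0 T i))}.

(* E, V come from a Groebner basis of N in L_0 by elimination, and T, phi from
   the iteration of [resolution_step]. *)
Definition constructed (r : nat) (b : 'I_r -> nat) (N : 'rV[A]_r -> Prop)
    (E : {set 'I_r}) (V : seq 'rV[A]_r) (T : nat -> stage)
    (phi : chain_maps (restricted_stage b E V) T) : Prop :=
  (exists lt G,
     [/\ graded_left_monomial_ordering b lt,
         left_Groebner_basis lt N G
       & output (elim_step b) (setT, G) (E, V)]) /\
  forall i, resolution_step (phi i).

Section Resolution.
Variables (M : lmodType A) (FM : nat -> M -> Prop).
Variables (r : nat -> nat) (b : forall i, 'I_(r i) -> nat).
Variable N : 'rV[A]_(r 0%N) -> Prop.
Variable phi_0 : {linear 'rV[A]_(r 0%N) -> M}.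
(* [phi i] is phi_{i+1} : L_{i+1} -> L_i. *)
Variable phi : forall i, {linear 'rV[A]_(r i.+1) -> 'rV[A]_(r i)}.

Definition ker_at (i : nat) : 'rV[A]_(r i) -> Prop :=
  match i with
  | 0 => kernel phi_0
  | j.+1 => kernel (phi j)
  end.

Record minimal_filtered_free_resolution : Prop := MinFiltFreeResolution {
  mffr_quotient : is_quotient N phi_0;
  mffr_filtration :
    forall q y, FM q y <-> quotient_filtration (FL (@b 0)) phi_0 q y;
  mffr_F_basis : minimal_F_basis FM (fun i => phi_0 (ebasis i));
  mffr_exact : forall i x, ker_at x <-> exists y, x = phi i y;
  mffr_filtered : forall i, filtered (FL (@b i.+1)) (FL (@b i)) (phi i);
  mffr_strict : forall i, strict_filtered (FL (@b i.+1)) (FL (@b i)) (phi i);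
  mffr_standard_basis : forall i,
    minimal_standard_basis (FL (@b i)) (@ker_at i) (fun k => phi i (ebasis k))
}.

Definition has_length (d : nat) : Prop := forall i, (d < i)%N -> r i = 0%N.

End Resolution.

(* The chain S0, T 0, T 1, ... with maps phi_0, phi is a minimal filtered free
   resolution of length at most n of M = L_0/N, where S0 presents L_0 and N. *)
Definition resolves (M : lmodType A) (FM : nat -> M -> Prop) (S0 : stage)
    (phi_0 : {linear 'rV[A]_(rk S0) -> M}) (T : nat -> stage)
    (phi : chain_maps S0 T) : Prop :=
  let r i := rk (stages S0 T i) in
  @minimal_filtered_free_resolution M FM r (fun i => @bdeg (stages S0 T i))
    (@submod S0) phi_0 phi
  /\ exists2 d, (d <= n)%N & has_length r d.

Definition Buchberger_computes_Groebner (r : nat) (b : 'I_r -> nat) (t : nat)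
    (U : 'I_t -> 'rV[A]_r) : Prop :=
  (exists lt, graded_left_monomial_ordering b lt) /\
  forall lt, graded_left_monomial_ordering b lt ->
    halts (@bstep r lt t) (bstart U) /\
    forall st, output (@bstep r lt t) (bstart U) st ->
      left_Groebner_basis lt (span U) (unzip1 (bb_basis st)).

Definition Buchberger_computes_Syz (r : nat) (b : 'I_r -> nat) (t : nat)
    (W : 'I_t -> 'rV[A]_r) : Prop :=
  forall lt, graded_left_monomial_ordering b lt ->
    halts (@bstep r lt t) (bstart W) /\
    forall st, output (@bstep r lt t) (bstart W) st ->
      generates_Syz W (bb_syz st).

(* L_0'/N' is an arbitrary quotient [pi'] of the free module on the e_i, i in E,
   by the span of V. *)
Definition elimination_correct (r : nat) (b : 'I_r -> nat)
    (N : 'rV[A]_r -> Prop) (M : lmodType A) (FM : nat -> M -> Prop)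
    (pi : {linear 'rV[A]_r -> M}) (E : {set 'I_r}) (V : seq 'rV[A]_r) : Prop :=
  let S0 := restricted_stage b E V in
  [/\ forall v, v \in V -> N v /\ exists x : 'rV[A]_#|E|, v = incl x,
      forall (M' : lmodType A) (pi' : {linear 'rV[A]_#|E| -> M'}),
        is_quotient (@submod S0) pi' ->
        exists2 psi : {linear M' -> M},
          strict_filtered_iso
            (quotient_filtration (FL (@bdeg S0)) pi') FM psi
          & forall x, psi (pi' x) = pi (incl x)
    & minimal_F_basis FM (fun q : 'I_#|E| => pi (ebasis (enum_val q)))].

Definition step_correct (S : stage) : Prop :=
  [/\ Buchberger_computes_Groebner (@bdeg S) (fam (gens S)),
      forall lt G, graded_left_monomial_ordering (@bdeg S) lt ->
        left_Groebner_basis lt (@submod S) G ->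
        exists t (W : 'I_t -> 'rV[A]_(rk S)), select_minimal G W,
      forall t (W : 'I_t -> 'rV[A]_(rk S)), minimal_selection W ->
        minimal_standard_basis (FL (@bdeg S)) (@submod S) W /\
        Buchberger_computes_Syz (@bdeg S) W
    & forall T (phi : {linear 'rV[A]_(rk T) -> 'rV[A]_(rk S)}),
        resolution_step phi ->
        [/\ filtered (FL (@bdeg T)) (FL (@bdeg S)) phi,
            strict_filtered (FL (@bdeg T)) (FL (@bdeg S)) phi,
            forall x, submod x <-> exists y, x = phi y
          & forall y, submod y <-> kernel phi y]].

Definition reachable (S0 S : stage) : Prop :=
  clos_refl_trans stage
    (fun S1 S2 => exists phi, @resolution_step S1 S2 phi) S0 S.

End SolvableAlgebra.

Arguments stage {K} A.
Arguments rk {K A} s.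
Arguments bdeg {K A} s _.
Arguments gens {K A} s.
Arguments restricted_stage {K A r} b E V.
Arguments submod {K A} S _.
Arguments fam {T} s _.

(* Main.v *)
From Stdlib Require Import Relation_Operators Operators_Properties.
From Stdlib Require Import Classical ClassicalEpsilon.
From Stdlib Require Import FunctionalExtensionality PropExtensionality.
From HB Require Import structures.
Require Import Defs.
From mathcomp.multinomials Require Import ssrcomplements.
From mathcomp Require Import zify.

(** A filtration degree is a bound on supports, and for an ordering graded with
respect to it the degree of an element is the degree of its leading monomial.
Leading monomials are multiplicative ([is_LML_scale]), so division by a left
Groebner basis does not raise degrees: a Groebner basis is a standard basis
([Groebner_std]), and the map from the free module on it is strict.

Syzygies are handled by Schreyer's ordering.  A coefficient vector h on a family
G is itself an element of a free module; order its monomials by the leading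
monomials of their images, with some rule for ties.  If the leading term of h is
cancelled in the combination of G with coefficients h, another generator competes
for the same monomial ([schreyer_top]), hence the leading term of the syzygy of
an S-pair divides that of h ([top_divisible]).  So the syzygies of the S-pairs
form a Groebner basis of the module of all syzygies ([schreyer_Groebner]), and
dividing h by them leaves a vector whose leading term survives, which is
Buchberger's criterion ([buchberger_criterion]).  Both statements about
Buchberger's algorithm follow: it ends by Dickson's lemma ([bstep_halts]), and
the recorded syzygies generate, because those of the final basis are mapped onto
those of the input when cofactors are substituted ([bb_correct]).

Elimination keeps a standard basis of the relations supported on the surviving
basis vectors ([elim_inv_step]).  When it stops, no relation has a nonzero scalar
entry in the degree of its basis vector ([elim_inv_stop]), and this is exactly
what makes the surviving basis vectors a minimal F-basis
([no_unit_entry_minimal_F_basis]).  The same condition on the syzygies of a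
minimal standard basis expresses its minimality ([minimal_no_unit_entry]).

The length of the resolution is bounded in two moves.  Schreyer's construction,
with ties decided by the exponents of the variables one after the other, gives
some strict resolution with at most n free modules ([Groebner_res_length],
[res_length_le_n]).  Any minimal one is no longer than that: lift the identity to
filtered chain maps in both directions and their composite to a homotopy with the
identity; where the other resolution is 0, the homotopy relation applied to a
basis vector of the minimal one yields a syzygy with entry 1 at that vector,
which minimality forbids ([minimal_length]). *)

Set Implicit Arguments.
Unset Strict Implicit.
Unset Printing Implicit Defensive.

Import GRing.Theory.
Local Open Scope ring_scope.

Lemma fun_choice (T U : Type) (R : T -> U -> Prop) :
  (forall x, exists y, R x y) -> exists f : T -> U, forall x, R x (f x).
Proof.
move=> h; exists (fun x => sval (constructive_indefinite_description _ (h x))) => x.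
exact: svalP (constructive_indefinite_description _ (h x)).
Qed.
Arguments fun_choice {T U} R _.

(** * Dickson's lemma *)

(** Each index is chosen to minimize [f] over the indices still available. *)
Lemma nondecr_subseq (f : nat -> nat) : exists g : nat -> nat,
  (forall i j, (i < j)%N -> (g i < g j)%N) /\
  forall i j, (i <= j)%N -> (f (g i) <= f (g j))%N.
Proof.
have pick N : exists m, (N <= m)%N /\ forall k, (m <= k)%N -> (f m <= f k)%N.
  have [v hv] := ubnP (f N); elim: v N hv => // v IH N hv.
  case: (classic (exists2 k, (N <= k)%N & (f k < f N)%N)) => [[k hk1 hk2]|no].
    have [|m [h1 h2]] := IH k; first by lia.
    by exists m; split=> //; lia.
  exists N; split=> // k hk; rewrite leqNgt; apply/negP => h; apply: no; by exists k.
pose p N := epsilon (inhabits 0%N)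
  (fun m => (N <= m)%N /\ forall k, (m <= k)%N -> (f m <= f k)%N).
have hp N : (N <= p N)%N /\ forall k, (p N <= k)%N -> (f (p N) <= f k)%N.
  exact: (epsilon_spec (inhabits 0%N) _ (pick N)).
pose fix g i := if i is j.+1 then p (g j).+1 else p 0%N.
have g1 i : (g i < g i.+1)%N by have [] := hp (g i).+1.
have g2 i j : (i < j)%N -> (g i < g j)%N.
  elim: j => // j IH; rewrite ltnS leq_eqVlt => /orP [/eqP -> //|/IH h].
  exact: ltn_trans h (g1 j).
have g3 i k : (g i <= k)%N -> (f (g i) <= f k)%N.
  by case: i => [|i]; apply: (hp _).2.
exists g; split=> // i j; rewrite leq_eqVlt => /orP [/eqP -> //|/g2 h].
exact/g3/ltnW.
Qed.

Lemma nondecr_subseqs (F : nat -> nat -> nat) k : exists g : nat -> nat,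
  (forall i j, (i < j)%N -> (g i < g j)%N) /\
  forall c, (c < k)%N -> forall i j, (i <= j)%N -> (F c (g i) <= F c (g j))%N.
Proof.
elim: k => [|k [g [g1 g2]]]; first by exists id.
have [h [h1 h2]] := nondecr_subseq (fun i => F k (g i)).
exists (fun i => g (h i)); split=> [i j /h1 /g1 //|c].
rewrite ltnS leq_eqVlt => /orP [/eqP -> i j /h2 //|hc i j].
rewrite leq_eqVlt => /orP [/eqP -> //|/h1 /ltnW]; exact: g2.
Qed.

Definition mdvd n r (s t : 'X_{1..n} * 'I_r) := (s.2 == t.2) && (s.1 <= t.1)%MM.

(** The component is turned into two more nondecreasing coordinates, [i] and
    [r - i], which together force it to be constant. *)
Lemma dickson n r (t : nat -> 'X_{1..n} * 'I_r) :
  exists i j, (i < j)%N /\ mdvd (t i) (t j).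
Proof.
pose F c i := if (c < n)%N then nth 0%N (t i).1 c
  else if c == n then (t i).2 : nat else (r - (t i).2)%N.
have [g [g1 g2]] := nondecr_subseqs F n.+2.
exists (g 0%N), (g 1%N); split; first exact: g1.
have h c : (c < n.+2)%N -> (F c (g 0%N) <= F c (g 1%N))%N by move/g2; apply.
have h1 : ((t (g 0%N)).2 <= (t (g 1%N)).2)%N.
  by have := h n; rewrite /F ltnn eqxx; apply; lia.
have h2 : (r - (t (g 0%N)).2 <= r - (t (g 1%N)).2)%N.
  have := h n.+1; rewrite /F; have -> : (n.+1 < n)%N = false by lia.
  have -> : (n.+1 == n)%N = false by lia.
  by apply.
apply/andP; split.
  rewrite -val_eqE /=; have := ltn_ord (t (g 0%N)).2; have := ltn_ord (t (g 1%N)).2;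
    lia.
apply/mnm_lepP => i; have := h i; rewrite /F ltn_ord !(mnm_nth 0%N); apply.
by have := ltn_ord i; lia.
Qed.

(** Dependent choice, in the form in which well-foundedness is used. *)
Lemma not_Acc_chain (T : Type) (R : T -> T -> Prop) (x : T) : ~ Acc R x ->
  exists s : nat -> T, s 0%N = x /\ forall i, R (s i.+1) (s i).
Proof.
move=> nx; pose B := {y | ~ Acc R y}.
have step (y : B) : exists z : B, R (sval z) (sval y).
  case: y => y ny /=; apply: NNPP => no; apply: ny; constructor => z rzy.
  by apply: NNPP => nz; apply: no; exists (exist _ z nz).
pose nxt y := sval (constructive_indefinite_description _ (step y)).
have hn y : R (sval (nxt y)) (sval y) by exact: svalP
  (constructive_indefinite_description _ (step y)).
exists (fun i => sval (iter i nxt (exist _ x nx))); split=> // i; exact: hn.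
Qed.

Section Theory.
Context {K : fieldType} {A : algType K} {n : nat}.
Variables (a : 'I_n -> A) (prec : rel 'X_{1..n}) (w : 'I_n -> nat).
Hypothesis hA : solvable_polynomial_algebra a prec.
Hypothesis hw : forall i, (0 < w i)%N.
Hypothesis hgr : graded_ordering prec w.

Local Notation mon := (mon a).
Local Notation lincomb := (lincomb a).
Local Notation wdeg := (wdeg w).
Local Notation monL := (monL a).

(** * Coefficients with respect to the PBW basis *)

(** A finite set of exponents that does not depend on [c], so that linearity
    can be checked term by term. *)
Lemma lincombE c k : (msize c <= k)%N ->
  lincomb c = \sum_(m : 'X_{1..n < k}) c@_m *: mon m.
Proof.
move=> le_k; set I : subFinType _ := 'X_{1..n < k}.
rewrite /Defs.lincomb (big_mksub I) ?msupp_uniq //=; last first.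
  by move=> x /msize_mdeg_lt /leq_trans; apply.
by rewrite big_rmcond //= => j /memN_msupp_eq0 ->; rewrite scale0r.
Qed.

Lemma lincombD c d : lincomb (c + d) = lincomb c + lincomb d.
Proof.
pose k := maxn (msize (c + d)) (maxn (msize c) (msize d)).
rewrite !(@lincombE _ k) /k ?leq_max ?leqnn ?orbT // -big_split /=.
by apply: eq_bigr => m _; rewrite mcoeffD scalerDl.
Qed.

Lemma lincombZ x c : lincomb (x *: c) = x *: lincomb c.
Proof.
pose k := maxn (msize (x *: c)) (msize c).
rewrite !(@lincombE _ k) /k ?leq_max ?leqnn ?orbT // scaler_sumr.
by apply: eq_bigr => m _; rewrite mcoeffZ scalerA.
Qed.

Lemma lincombX m : lincomb 'X_[m] = mon m.
Proof. by rewrite /Defs.lincomb msuppX big_seq1 mcoeffX eqxx scale1r. Qed.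

Definition coefs (f : A) : {mpoly K[n]} :=
  epsilon (inhabits 0) (fun c => f = lincomb c).

Lemma coefsK f : lincomb (coefs f) = f.
Proof.
have [c [fc _]] := spa_basis hA f.
by rewrite -(epsilon_spec (inhabits 0) (fun c => f = lincomb c) (ex_intro _ c fc)).
Qed.

Lemma lincombK c : coefs (lincomb c) = c.
Proof.
have [d [e u]] := spa_basis hA (lincomb c).
by rewrite -[RHS](u c erefl); symmetry; apply: u; rewrite coefsK.
Qed.

Lemma coefsD f g : coefs (f + g) = coefs f + coefs g.
Proof. by rewrite -{1}[f]coefsK -{1}[g]coefsK -lincombD lincombK. Qed.

Lemma coefsZ x f : coefs (x *: f) = x *: coefs f.
Proof. by rewrite -{1}[f]coefsK -lincombZ lincombK. Qed.

Lemma coefs_mon m : coefs (mon m) = 'X_[m].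
Proof. by rewrite -lincombX lincombK. Qed.

Lemma mon0 : mon 0%MM = 1.
Proof.
by rewrite /Defs.mon big1 // => i _; rewrite mnm0E expr0.
Qed.

Lemma occursE f m : occurs a f m <-> (coefs f)@_m != 0.
Proof.
split=> [[c ->]|]; first by rewrite lincombK mcoeff_msupp.
by rewrite -mcoeff_msupp => h; exists (coefs f) => //; rewrite coefsK.
Qed.

Definition coefv r (x : 'rV[A]_r) (t : 'X_{1..n} * 'I_r) : K :=
  (coefs (x 0 t.2))@_t.1.

Lemma coefs_is_linear : linear coefs.
Proof. by move=> k x y; rewrite coefsD coefsZ. Qed.
HB.instance Definition _ := GRing.isLinear.Build K A {mpoly K[n]} _ coefs
  coefs_is_linear.

Section Co.
Variable r : nat.
Implicit Types (x y : 'rV[A]_r) (t : 'X_{1..n} * 'I_r).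

Lemma coefvD x y t : coefv (x + y) t = coefv x t + coefv y t.
Proof. by rewrite /coefv mxE raddfD mcoeffD. Qed.
Lemma coefvN x t : coefv (- x) t = - coefv x t.
Proof. by rewrite /coefv mxE raddfN mcoeffN. Qed.
Lemma coefvB x y t : coefv (x - y) t = coefv x t - coefv y t.
Proof. by rewrite coefvD coefvN. Qed.
Lemma coefv0 t : coefv (0 : 'rV_r) t = 0.
Proof. by rewrite /coefv mxE raddf0 mcoeff0. Qed.
Lemma coefvZ k f x t : coefv ((k *: f) *: x) t = k * coefv (f *: x) t.
Proof. by rewrite /coefv !mxE -scalerAl linearZ mcoeffZ. Qed.
Lemma coefv_sum (I : Type) (s : seq I) (P : pred I) (F : I -> 'rV[A]_r) t :
  coefv (\sum_(i <- s | P i) F i) t = \sum_(i <- s | P i) coefv (F i) t.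
Proof.
apply: (big_morph (fun x => coefv x t)) => [x y|]; [exact: coefvD|exact: coefv0].
Qed.

Lemma coefv_eq0 x : (forall t, coefv x t = 0) -> x = 0.
Proof.
move=> h; apply/rowP => i; rewrite mxE -[x 0 i]coefsK.
suff -> : coefs (x 0 i) = 0 by rewrite /Defs.lincomb msupp0 big_nil.
by apply/mpolyP => m; rewrite mcoeff0; exact: (h (m, i)).
Qed.

Lemma coefv_monL t u : coefv (monL t) u = (t == u)%:R.
Proof.
rewrite /coefv /Defs.monL /ebasis mxE mxE eqxx /=; case: t u => [m i] [p j] /=.
rewrite xpair_eqE andbC eq_sym; case: (i == j) => /=.
  by rewrite mulr1 coefs_mon mcoeffX.
by rewrite mulr0 raddf0 mcoeff0.
Qed.

Definition supp x : seq ('X_{1..n} * 'I_r) :=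
  [seq (m, i) | i <- enum 'I_r, m <- msupp (coefs (x 0 i))].

Lemma mem_supp x t : (t \in supp x) = (coefv x t != 0).
Proof.
case: t => m i; rewrite /coefv /= -mcoeff_msupp.
apply/allpairsPdep/idP => [[j [p [_ hp [-> ->]]]] //|h].
by exists i, m; rewrite mem_enum.
Qed.

Lemma occursLE x t : occursL a x t <-> coefv x t != 0.
Proof. exact: occursE. Qed.

Lemma coefLE x t k : coefL a x t k <-> coefv x t = k.
Proof.
split=> [[c e <-]|<-]; first by rewrite /coefv e lincombK.
by exists (coefs (x 0 t.2)) => //; rewrite coefsK.
Qed.

End Co.

(** * Leading monomials *)

Lemma prec_irr m : prec m m = false.
Proof. by have [h _ _] := spa_total hA; exact: h. Qed.
Lemma prec_trans : transitive prec.
Proof. by have [_ h _] := spa_total hA. Qed.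
Lemma prec_total x y : x != y -> prec x y || prec y x.
Proof. by have [_ _ h] := spa_total hA; exact: h. Qed.

Definition precle x y := (x == y) || prec x y.

Lemma is_LM_mon f m :
  is_LM a prec f m <-> (coefs f)@_m != 0 /\ forall p, (coefs f)@_p != 0 -> precle p m.
Proof.
split=> [[/occursE h1 h2]|[h1 h2]]; split=> //.
- by move=> p /occursE hp; rewrite /precle; case: eqVneq => //= /(h2 _ hp).
- exact/occursE.
- by move=> p /occursE /h2 /predU1P [->|//]; rewrite eqxx.
Qed.

Lemma is_LM_1mon m : is_LM a prec (mon m) m.
Proof.
apply/is_LM_mon; rewrite coefs_mon mcoeffX eqxx oner_neq0; split=> // p.
rewrite mcoeffX /precle; case: (eqVneq m p) => [_ //|_]; by rewrite eqxx.
Qed.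

Lemma prec0 m : m != 0%MM -> prec 0%MM m.
Proof.
move=> nz; apply: (spa_increasing hA (alpha := m) (eta := 0%MM));
  first by rewrite eq_sym.
rewrite mon0 !mulr1; exact: is_LM_1mon.
Qed.

Definition mon_mul_coef (m p : 'X_{1..n}) : K := (coefs (mon m * mon p))@_(m + p)%MM.

Lemma mon_mul_lead m p : mon_mul_coef m p != 0 /\
  forall s, (coefs (mon m * mon p))@_s != 0 -> precle s (m + p)%MM.
Proof.
have [l [f [l0 e hf]]] := spa_solvable hA m p.
have e2 s : (coefs (mon m * mon p))@_s = l * (m + p == s)%MM%:R + (coefs f)@_s.
  by rewrite e coefsD coefsZ coefs_mon mcoeffD mcoeffZ mcoeffX.
have hf2 s : (coefs f)@_s != 0 -> prec s (m + p)%MM.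
  case: hf => [->|[mu /is_LM_mon [_ h] hmu]]; first by rewrite raddf0 mcoeff0 eqxx.
  by move=> /h /predU1P [->|/prec_trans]; last apply.
split=> [|s].
  rewrite /mon_mul_coef e2 eqxx mulr1; have [->|/hf2] :=
    eqVneq ((coefs f)@_(m + p)%MM) 0.
    by rewrite addr0.
  by rewrite prec_irr.
rewrite e2 /precle; case: (eqVneq (m + p)%MM s) => [_ //|_].
by rewrite mulr0 add0r => /hf2 ->; rewrite orbT.
Qed.

Lemma is_LM_mul2 m p : is_LM a prec (mon m * mon p) (m + p)%MM.
Proof. by apply/is_LM_mon; exact: mon_mul_lead. Qed.

(** For eta = 0 the two products are products of two monomials, whose leading
    exponents are known; the compatibility axiom says nothing when one of these
    is 0, but 0 is the least exponent. *)
Lemma prec_add2l g m p : prec m p -> prec (g + m)%MM (g + p)%MM.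
Proof.
move=> h.
have h1 : is_LM a prec (mon g * mon m * mon 0%MM) (g + m)%MM.
  by rewrite mon0 mulr1; exact: is_LM_mul2.
have h2 : is_LM a prec (mon g * mon p * mon 0%MM) (g + p)%MM.
  by rewrite mon0 mulr1; exact: is_LM_mul2.
have p0 : p != 0%MM.
  apply: contraTneq h => ->; apply/negP => h.
  have [e|/prec0 h'] := eqVneq m 0%MM; first by rewrite e prec_irr in h.
  by have := prec_trans h' h; rewrite prec_irr.
have gp0 : (g + p)%MM != 0%MM by rewrite mnmD_eq0 (negPf p0) andbF.
have [e|gm0] := eqVneq (g + m)%MM 0%MM; first by rewrite e; exact: prec0.
exact: (spa_compatible hA h h1 h2).
Qed.

Lemma prec_add2r g m p : prec m p -> prec (m + g)%MM (p + g)%MM.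
Proof. by rewrite ![(_ + g)%MM]addmC; exact: prec_add2l. Qed.

Lemma wdegD m p : wdeg (m + p)%MM = (wdeg m + wdeg p)%N.
Proof.
by rewrite /Defs.wdeg -big_split; apply: eq_bigr => i _; rewrite mnmDE mulnDr.
Qed.

Lemma precle_wdeg m p : precle m p -> (wdeg m <= wdeg p)%N.
Proof. by case/predU1P=> [->|/hgr]. Qed.

Lemma wdeg_eq0 m : wdeg m = 0%N -> m = 0%MM.
Proof.
move=> h; apply/mnmP => i; rewrite mnm0E; apply/eqP.
move: h => /eqP; rewrite /Defs.wdeg sum_nat_eq0 => /forallP /(_ i) /=.
by rewrite muln_eq0 eqn0Ngt hw.
Qed.

Lemma coefs_mul f g s : (coefs (f * g))@_s =
  \sum_(m <- msupp (coefs f)) \sum_(p <- msupp (coefs g))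
    (coefs f)@_m * (coefs g)@_p * (coefs (mon m * mon p))@_s.
Proof.
rewrite -{1}[f]coefsK -{1}[g]coefsK /Defs.lincomb mulr_suml !raddf_sum /=.
apply: eq_bigr => m _; rewrite mulr_sumr !raddf_sum /=; apply: eq_bigr => p _.
by rewrite -scalerAl -scalerAr scalerA coefsZ mcoeffZ.
Qed.

Lemma sum_nz (I : eqType) (s : seq I) (F : I -> K) :
  \sum_(i <- s) F i != 0 -> exists2 i, i \in s & F i != 0.
Proof.
move=> h; apply/hasP; apply: contraNT h => /hasPn h.
by rewrite big_seq big1 // => i /h; rewrite negbK => /eqP.
Qed.

Lemma sum_one (I : eqType) (s : seq I) (F : I -> K) i0 : uniq s ->
  (i0 \notin s -> F i0 = 0) -> (forall i, i \in s -> i != i0 -> F i = 0) ->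
  \sum_(i <- s) F i = F i0.
Proof.
move=> us h0 h; case: (boolP (i0 \in s)) => [hi|hi].
  rewrite (bigD1_seq i0) //= big_seq_cond big1 ?addr0 // => i /andP [? ?].
  exact: h.
rewrite h0 // big_seq big1 // => i si; apply: h => //.
by apply: contraNneq hi => <-.
Qed.

Lemma coefs_mul_supp f g s : (coefs (f * g))@_s != 0 ->
  exists m p, [/\ (coefs f)@_m != 0, (coefs g)@_p != 0 & precle s (m + p)%MM].
Proof.
rewrite coefs_mul => /sum_nz [m hm] /sum_nz [p hp]; rewrite !mulf_eq0 !negb_or.
case/andP=> _ h; exists m, p; rewrite -!mcoeff_msupp; split=> //.
exact: (mon_mul_lead m p).2.
Qed.

Lemma prec_refl m : precle m m. Proof. by rewrite /precle eqxx. Qed.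
Lemma precW m p : prec m p -> precle m p. Proof. by move=> h; rewrite /precle h orbT.
  Qed.
Lemma prec_trans_le m p q : precle m p -> prec p q -> prec m q.
Proof. by case/predU1P=> [->//|]; exact: prec_trans. Qed.
Lemma precle_add m p m' p' : precle m m' -> precle p p' ->
  precle (m + p)%MM (m' + p')%MM.
Proof.
case/predU1P=> [->|h1] /predU1P [->|h2]; rewrite /precle ?eqxx //.
- by rewrite prec_add2l ?orbT.
- by rewrite prec_add2r ?orbT.
- by rewrite (prec_trans (prec_add2l _ h2) (prec_add2r _ h1)) orbT.
Qed.
Lemma precle_add_lt m p m' p' : precle m m' -> prec p p' ->
  prec (m + p)%MM (m' + p')%MM.
Proof.
case/predU1P=> [->|h1] h2; first exact: prec_add2l.
by apply: (prec_trans (prec_add2l _ h2) (prec_add2r _ h1)).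
Qed.
Lemma prec_lt_add m p m' p' : prec m m' -> precle p p' ->
  prec (m + p)%MM (m' + p')%MM.
Proof. by rewrite ![(m + _)%MM]addmC ![(m' + _)%MM]addmC => h1 h2;
  exact: precle_add_lt. Qed.

(** Every other product of a monomial of [f] with one of [g] stays strictly
    below [m + p], so a single term contributes. *)
Lemma coefs_mul_lead f g m p :
    (forall s, (coefs f)@_s != 0 -> precle s m) ->
    (forall s, (coefs g)@_s != 0 -> precle s p) ->
  (coefs (f * g))@_(m + p)%MM = (coefs f)@_m * (coefs g)@_p * mon_mul_coef m p.
Proof.
move=> hf hg.
have key m' p' : m' \in msupp (coefs f) -> p' \in msupp (coefs g) ->
    (m' != m) || (p' != p) -> (coefs (mon m' * mon p'))@_(m + p)%MM = 0.
  rewrite !mcoeff_msupp => hm hp ne; apply/eqP;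
    apply: contraTT ne => /(mon_mul_lead m' p').2.
  have := hf _ hm; have := hg _ hp; rewrite negb_or !negbK.
  case/predU1P=> [->|lp] /predU1P [->|lm]; rewrite ?eqxx //.
  + by move/prec_trans_le/(_ (prec_lt_add lm (prec_refl _))); rewrite prec_irr.
  + by move/prec_trans_le/(_ (precle_add_lt (prec_refl _) lp)); rewrite prec_irr.
  + by move/prec_trans_le/(_ (prec_lt_add lm (precW lp))); rewrite prec_irr.
rewrite coefs_mul (@sum_one _ _ _ m) ?msupp_uniq //.
- rewrite big_seq (@eq_bigr _ _ _ _ _ _ _ (fun p' =>
    (p' == p)%:R * ((coefs f)@_m * (coefs g)@_p' * (coefs (mon m * mon p'))@_(m +
      p)%MM))).
    rewrite -big_seq (@sum_one _ _ _ p) ?msupp_uniq //.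
    + by rewrite eqxx mul1r.
    + by move=> /memN_msupp_eq0 ->; rewrite mulr0 mul0r mulr0.
    + by move=> i _ /negPf ->; rewrite mul0r.
  move=> p' hp'; case: eqVneq => [->|ne]; first by rewrite mul1r.
  rewrite mul0r; have [->|hm] := eqVneq ((coefs f)@_m) 0; first by rewrite !mul0r.
  by rewrite key ?mulr0 // ?ne ?orbT // mcoeff_msupp.
- by move=> /memN_msupp_eq0 ->; apply: big1 => p' _; rewrite !mul0r.
- move=> m' hm' ne; rewrite big_seq big1 // => p' hp'.
  by rewrite key ?mulr0 ?ne.
Qed.

Lemma max_seq (T : eqType) (lt : rel T) (s : seq T) :
    strict_total_order lt -> s != [::] ->
  exists2 x, x \in s & forall y, y \in s -> (y == x) || lt y x.
Proof.
case=> [_ tr tot]; elim: s => // x [|y s] IH _.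
  by exists x; rewrite ?inE // => y; rewrite inE => ->.
have [z zs hz] := IH isT; have [e|ne] := eqVneq x z.
  exists z; first by rewrite in_cons zs orbT.
  by move=> u; rewrite in_cons => /orP [/eqP ->|/hz //]; rewrite e eqxx.
case/orP: (tot _ _ ne) => [l|l].
  exists z; first by rewrite in_cons zs orbT.
  by move=> u; rewrite in_cons => /orP [/eqP ->|/hz //]; rewrite l orbT.
exists x; first by rewrite in_cons eqxx.
move=> u; rewrite in_cons => /orP [-> //|/hz /orP [/eqP ->|h]];
  first by rewrite l orbT.
by rewrite (tr _ _ _ h l) orbT.
Qed.

Lemma is_LM_ex f : f != 0 -> exists m, is_LM a prec f m.
Proof.
move=> f0; have nz : msupp (coefs f) != [::].
  apply: contraNneq f0 => /msuppnil0 e; by rewrite -[f]coefsK e /Defs.lincomb msupp0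
    big_nil.
have [m hm h] := max_seq (spa_total hA) nz.
exists m; apply/is_LM_mon; rewrite -mcoeff_msupp; split=> // p.
by rewrite -mcoeff_msupp => /h.
Qed.

(** The leading monomial of the product of a^g with a monomial of the free
    module. *)
Definition mshift r (g : 'X_{1..n}) (t : 'X_{1..n} * 'I_r) := ((g + t.1)%MM, t.2).

Lemma mshift0 r (t : 'X_{1..n} * 'I_r) : mshift 0%MM t = t.
Proof. by case: t => m i; rewrite /mshift add0m. Qed.

Lemma mshiftA r g h (t : 'X_{1..n} * 'I_r) : mshift g (mshift h t) = mshift (g +
  h)%MM t.
Proof. by rewrite /mshift addmA. Qed.


Definition leL r (lt : rel ('X_{1..n} * 'I_r)) s t := (s == t) || lt s t.
(** Unlike having a given leading monomial, being bounded by a monomial is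
    stable under sums and makes sense for 0. *)
Definition LM_bound r (lt : rel ('X_{1..n} * 'I_r)) (x : 'rV[A]_r) t :=
  forall s, coefv x s != 0 -> leL lt s t.

Lemma is_LMLE r (lt : rel ('X_{1..n} * 'I_r)) x t :
  is_LML a lt x t <-> coefv x t != 0 /\ LM_bound lt x t.
Proof.
split=> [[/occursLE h1 h2]|[h1 h2]]; split=> //.
- by move=> p /occursLE hp; rewrite /leL; case: eqVneq => //= /(h2 _ hp).
- exact/occursLE.
- by move=> p /occursLE /h2 /predU1P [->|//]; rewrite eqxx.
Qed.


Lemma coefv_neq0 r (x : 'rV[A]_r) t : coefv x t != 0 -> x != 0.
Proof. by apply: contraNneq => ->; rewrite coefv0. Qed.

Lemma coefv_scale_mon r g (t : 'X_{1..n} * 'I_r) s :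
  coefv (mon g *: monL t) s = (coefs (mon g * mon t.1))@_s.1 * (s.2 == t.2)%:R.
Proof.
rewrite /coefv !mxE eqxx /=; case: (s.2 == t.2) => /=; first by rewrite !mulr1.
by rewrite !mulr0 raddf0 mcoeff0.
Qed.

Section Ordering.
Variables (r : nat) (lt : rel ('X_{1..n} * 'I_r)).
Implicit Types (x y : 'rV[A]_r) (s t u : 'X_{1..n} * 'I_r).

Lemma LM_boundD x y t : LM_bound lt x t -> LM_bound lt y t -> LM_bound lt (x + y) t.
Proof.
move=> hx hy s; rewrite coefvD; have [->|/hx //] := eqVneq (coefv x s) 0.
by rewrite add0r; exact: hy.
Qed.

Lemma LM_boundN x t : LM_bound lt x t -> LM_bound lt (- x) t.
Proof. by move=> hx s; rewrite coefvN oppr_eq0; exact: hx. Qed.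

Lemma LM_bound0 t : LM_bound lt 0 t.
Proof. by move=> s; rewrite coefv0 eqxx. Qed.

Lemma LM_bound_sum (I : Type) (l : seq I) (P : pred I) (F : I -> 'rV[A]_r) t :
  (forall i, P i -> LM_bound lt (F i) t) -> LM_bound lt (\sum_(i <- l | P i) F i) t.
Proof.
move=> h; apply: (big_ind (fun x => LM_bound lt x t)) => //; first exact: LM_bound0.
by move=> x y; exact: LM_boundD.
Qed.

Section LMO.
Hypothesis hlt : left_monomial_ordering a prec lt.

Lemma lmo_sto : strict_total_order lt. Proof. by case: hlt. Qed.
Lemma lmo_irr t : lt t t = false. Proof. by have [h _ _] := lmo_sto; exact: h. Qed.
Lemma lmo_trans : transitive lt. Proof. by have [_ h _] := lmo_sto. Qed.
Lemma lmo_total s t : s != t -> lt s t || lt t s.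
Proof. by have [_ _ h] := lmo_sto; exact: h. Qed.
Lemma lmo_prec m p i : prec m p -> lt (m, i) (p, i).
Proof. by case: hlt => _ _; apply. Qed.
Lemma lmo_le_prec m p i : precle m p -> leL lt (m, i) (p, i).
Proof. by rewrite /leL; case/predU1P=> [->|/lmo_prec ->]; rewrite ?eqxx ?orbT. Qed.
Lemma leL_trans : transitive (leL lt).
Proof.
move=> y x z /predU1P [->//|h1] /predU1P [<-|h2]; rewrite /leL ?h1 ?orbT //.
by rewrite (lmo_trans h1 h2) orbT.
Qed.
Lemma leL_lt_trans s t u : leL lt s t -> lt t u -> lt s u.
Proof. by case/predU1P=> [->//|]; exact: lmo_trans. Qed.
Lemma leL_anti s t : leL lt s t -> leL lt t s -> s = t.
Proof.
case/predU1P=> [//|h] /predU1P [//|/(lmo_trans h)]; by rewrite lmo_irr.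
Qed.

Lemma is_LML_mon g t : is_LML a lt (mon g *: monL t) (mshift g t).
Proof.
have [h1 h2] := mon_mul_lead g t.1; apply/is_LMLE; split.
  by rewrite coefv_scale_mon /= eqxx mulr1.
move=> [m i]; rewrite coefv_scale_mon mulf_eq0 negb_or /= => /andP [/h2 h hi].
have -> : i = t.2 by apply/eqP; apply: contraNT hi => /negPf ->.
exact: lmo_le_prec.
Qed.

Lemma lead_uniq x t u : is_LML a lt x t -> is_LML a lt x u -> t = u.
Proof.
by move=> /is_LMLE [h1 h2] /is_LMLE [h3 h4]; apply: leL_anti; [exact: h4|exact: h2].
Qed.

Lemma is_LML_monE g t u : is_LML a lt (mon g *: monL t) u <-> u = mshift g t.
Proof.
split=> [h|->]; last exact: is_LML_mon.
exact: (lead_uniq h (is_LML_mon g t)).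
Qed.

Lemma lmo_mshift g s t : lt s t -> lt (mshift g s) (mshift g t).
Proof. by case: (hlt) => _ h _ l; exact: (h _ _ _ _ _ l (is_LML_mon g s) (is_LML_mon
  g t)). Qed.

Lemma leL_mshift g s t : leL lt s t -> leL lt (mshift g s) (mshift g t).
Proof. by rewrite /leL; case/predU1P=> [->|/lmo_mshift ->]; rewrite ?eqxx ?orbT. Qed.

Lemma leL_mshift2 g h t : precle g h -> leL lt (mshift g t) (mshift h t).
Proof. by move=> /(precle_add)/(_ (prec_refl t.1)) /(@lmo_le_prec _ _ t.2). Qed.

Lemma leL_mul g t : leL lt t (mshift g t).
Proof.
rewrite -{1}[t]mshift0; apply: leL_mshift2; rewrite /precle eq_sym.
by case: eqVneq => //= /prec0.
Qed.

Lemma lead_ex x : x != 0 -> exists t, is_LML a lt x t.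
Proof.
move=> x0; have nz : supp x != [::].
  apply: contraNneq x0 => e; apply/eqP/coefv_eq0 => t; apply/eqP.
  by rewrite -[_ == _]negbK -mem_supp e.
have [t ht h] := max_seq lmo_sto nz.
exists t; apply/is_LMLE; rewrite -mem_supp; split=> // s.
by rewrite -mem_supp => /h.
Qed.

Lemma LM_bound_trans x t u : LM_bound lt x t -> leL lt t u -> LM_bound lt x u.
Proof. by move=> h l s /h /leL_trans; apply. Qed.

Lemma LM_bound_lead x t u : is_LML a lt x t -> leL lt t u -> LM_bound lt x u.
Proof. by case/is_LMLE=> _; exact: LM_bound_trans. Qed.

Lemma LM_bound_scale f m x t : (forall q, (coefs f)@_q != 0 -> precle q m) ->
  LM_bound lt x t -> LM_bound lt (f *: x) (mshift m t).
Proof.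
move=> hf hx [p i]; rewrite /coefv mxE /= => /coefs_mul_supp [q [v [/hf hq hv hp]]].
apply: leL_trans (leL_mshift _ (hx (v, i) hv)).
apply: leL_trans (leL_mshift2 _ hq).
exact: (@lmo_le_prec _ _ i hp).
Qed.

Lemma coefv_scale_lead f m x t : (forall q, (coefs f)@_q != 0 -> precle q m) ->
    LM_bound lt x t ->
  coefv (f *: x) (mshift m t) = (coefs f)@_m * coefv x t * mon_mul_coef m t.1.
Proof.
move=> hf; case: t => v i hx; rewrite /coefv mxE coefs_mul_lead //= => p hp.
have := hx (p, i) hp; rewrite /leL xpair_eqE eqxx andbT /precle.
case: eqVneq => //= ne; case/orP: (prec_total ne) => // /(@lmo_prec _ _ i) h.
by move=> /(lmo_trans h); rewrite lmo_irr.
Qed.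

(** Leading terms cannot cancel in a product, because the scalar by which
    a^m a^p deviates from a^(m + p) is nonzero; in particular the free modules
    have no torsion. *)
Lemma is_LML_scale f m x t : is_LM a prec f m -> is_LML a lt x t ->
  is_LML a lt (f *: x) (mshift m t).
Proof.
move=> /is_LM_mon [f0 hf] /is_LMLE [x0 hx]; apply/is_LMLE; split;
  last exact: LM_bound_scale.
by rewrite coefv_scale_lead // !mulf_neq0 // (mon_mul_lead _ _).1.
Qed.

Lemma LM_leP x y : LM_le a lt x y <-> (forall u, is_LML a lt y u -> LM_bound lt x u)
  /\ (y = 0 -> x = 0).
Proof.
split=> [h|[h0 h1] t hx].
  split=> [u hu|y0].
    have [->|/lead_ex [t ht]] := eqVneq x 0; first exact: LM_bound0.
    apply: (LM_bound_lead ht); have [v hv h'] := h t ht.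
    by rewrite /leL (lead_uniq hu hv); case: h' => ->; rewrite ?eqxx ?orbT.
  apply/eqP; apply/negP => /negP /lead_ex [t /h [u]].
  by rewrite y0 => /is_LMLE []; rewrite coefv0 eqxx.
have y0 : y != 0.
  apply/eqP => /h1 x0; case/is_LMLE: hx; by rewrite x0 coefv0 eqxx.
have [u hu] := lead_ex y0; exists u => //.
have := h0 _ hu t; rewrite /leL; case/is_LMLE: hx => -> _ /(_ isT) /predU1P [|];
  by auto.
Qed.

Lemma LM_bound_strict x t u : LM_bound lt x t -> coefv x t = 0 -> is_LML a lt x u ->
  lt u t.
Proof.
move=> h e /is_LMLE [h1 _]; have /predU1P [e2|//] := h u h1.
by rewrite e2 e eqxx in h1.
Qed.

End LMO.
End Ordering.

Lemma mdvdP r (s t : 'X_{1..n} * 'I_r) : reflect (exists g, t = mshift g s) (mdvd s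
  t).
Proof.
apply: (iffP andP) => [[/eqP e l]|[g ->]].
  by exists (t.1 - s.1)%MM; rewrite /mshift submK // e -surjective_pairing.
by rewrite /= eqxx lem_addl.
Qed.

(** By Dickson's lemma an infinite descent would contain a monomial that divides
    a later, hence smaller one; but multiples are never smaller. *)
Lemma lmo_wf r (lt : rel ('X_{1..n} * 'I_r)) : left_monomial_ordering a prec lt ->
  well_founded (fun s t => lt s t).
Proof.
move=> hlt t; apply: NNPP => nA; have [s [_ hs]] := not_Acc_chain nA.
have dec i j : (i < j)%N -> lt (s j) (s i).
  elim: j => // j IH; rewrite ltnS leq_eqVlt => /orP [/eqP -> //|/IH].
  exact: (lmo_trans hlt (hs j)).
have [i [j [lij /mdvdP [g e]]]] := dickson s.
have h := leL_mul hlt g (s i); rewrite -e in h.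
by have := leL_lt_trans hlt h (dec _ _ lij); rewrite (lmo_irr hlt).
Qed.

(** Each new monomial lies outside the monomial module generated by the
    earlier ones, so that module grows strictly. *)
Lemma Acc_rcons_mdvd r (s : seq ('X_{1..n} * 'I_r)) :
  Acc (fun s2 s1 => exists2 t, s2 = rcons s1 t & ~~ has (fun u => mdvd u t) s1) s.
Proof.
apply: NNPP => nA; have [c [_ hc]] := not_Acc_chain nA.
have [t ht] : exists t : nat -> 'X_{1..n} * 'I_r, forall i,
    c i.+1 = rcons (c i) (t i) /\ ~~ has (fun u => mdvd u (t i)) (c i).
  apply: (fun_choice (fun i t => c i.+1 = rcons (c i) t /\
    ~~ has (fun u => mdvd u t) (c i))) => i.
  by have [t e h] := hc i; exists t.
have mem i j : (i < j)%N -> t i \in c j.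
  elim: j => // j IH; rewrite (ht j).1 mem_rcons in_cons ltnS leq_eqVlt.
  by case/orP => [/eqP ->|/IH ->]; rewrite ?eqxx ?orbT.
have [i [j [lij d]]] := dickson t; have [_ /hasPn /(_ _ (mem _ _ lij))] := ht j.
by rewrite d.
Qed.

(** * Division *)

(** Families of coefficients are row vectors, that is, elements of another free
    module: a relation between the [G k] is then an element of that module, and
    the whole theory applies to it. *)
Definition comb r z (G : 'I_z -> 'rV[A]_r) (h : 'rV[A]_z) : 'rV[A]_r :=
  \sum_k h 0 k *: G k.

Lemma comb_is_linear r z (G : 'I_z -> 'rV[A]_r) : linear (comb G).
Proof.
move=> c x y; rewrite /comb scaler_sumr -big_split; apply: eq_bigr => k _.
by rewrite !mxE scalerDl scalerA.
Qed.
HB.instance Definition _ r z (G : 'I_z -> 'rV[A]_r) :=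
  GRing.isLinear.Build A 'rV[A]_z 'rV[A]_r _ (comb G) (comb_is_linear G).

Lemma ebasisE r (i j : 'I_r) : (ebasis i : 'rV[A]_r) 0 j = (j == i)%:R.
Proof. by rewrite /ebasis mxE eqxx. Qed.

Lemma comb_ebasis r z (G : 'I_z -> 'rV[A]_r) k : comb G (ebasis k) = G k.
Proof.
rewrite /comb (bigD1 k) //= big1 ?addr0 ?ebasisE ?eqxx ?scale1r // => i /negPf ne.
by rewrite ebasisE ne scale0r.
Qed.

Lemma combB r z (G : 'I_z -> 'rV[A]_r) x y : comb G (x - y) = comb G x - comb G y.
Proof. exact: linearB. Qed.

Lemma combZ r z (G : 'I_z -> 'rV[A]_r) f x : comb G (f *: x) = f *: comb G x.
Proof. exact: linearZ. Qed.

Lemma comb_sum r z (G : 'I_z -> 'rV[A]_r) (I : finType) (h : I -> A) x :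
  comb G (\sum_i h i *: x i) = \sum_i h i *: comb G (x i).
Proof. by rewrite (raddf_sum (comb G)); apply: eq_bigr => i _; rewrite /= combZ. Qed.

Lemma row_ebasis r (x : 'rV[A]_r) : x = \sum_i x 0 i *: ebasis i.
Proof. exact: row_sum_delta. Qed.

Lemma comb_comp p q r (F : 'I_q -> 'rV[A]_r) (G : 'I_p -> 'rV[A]_q) h :
  comb F (comb G h) = comb (fun k => comb F (G k)) h.
Proof. exact: comb_sum. Qed.

Lemma linear_comb r z (f : {linear 'rV[A]_z -> 'rV[A]_r}) x :
  f x = comb (fun k => f (ebasis k)) x.
Proof.
by rewrite {1}[x]row_ebasis linear_sum; apply: eq_bigr => k _; rewrite linearZ.
Qed.

Definition is_submod (M : lmodType A) (N : M -> Prop) :=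
  N 0 /\ forall f x y, N x -> N y -> N (f *: x + y).

Section Submod.
Variables (M : lmodType A) (N : M -> Prop).
Hypothesis hN : is_submod N.
Lemma submod0 : N 0. Proof. by case: hN. Qed.
Lemma submodD x y : N x -> N y -> N (x + y).
Proof. by case: hN => _ h /(h 1 x) h1 /h1; rewrite scale1r. Qed.
Lemma submodZ f x : N x -> N (f *: x).
Proof. by case: hN => h0 h /(h f x) /(_ h0); rewrite addr0. Qed.
Lemma submodN x : N x -> N (- x).
Proof. by move/(submodZ (-1)); rewrite scaleN1r. Qed.
Lemma submodB x y : N x -> N y -> N (x - y).
Proof. by move=> hx /submodN; exact: submodD. Qed.
Lemma submod_sum (I : Type) (s : seq I) (P : pred I) (F : I -> M) :
  (forall i, P i -> N (F i)) -> N (\sum_(i <- s | P i) F i).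
Proof.
move=> h; apply: (big_ind N) => //; [exact: submod0|exact: submodD].
Qed.
End Submod.

Lemma submod_comb r z (N : 'rV[A]_r -> Prop) (G : 'I_z -> 'rV[A]_r) h :
  is_submod N -> (forall k, N (G k)) -> N (comb G h).
Proof. by move=> hN hG; apply: submod_sum => // k _; exact: submodZ. Qed.

Lemma kernel_submod (M M' : lmodType A) (f : {linear M -> M'}) : is_submod (kernel f).
Proof.
split=> [|c x y]; rewrite /kernel ?linear0 // linearP => -> ->.
by rewrite scaler0 addr0.
Qed.

Lemma Syz_submod r z (G : 'I_z -> 'rV[A]_r) : is_submod (Syz G).
Proof. exact: (kernel_submod (comb G)). Qed.

Lemma span_comb r z (G : 'I_z -> 'rV[A]_r) x : span G x <-> exists h, x = comb G h.
Proof.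
split=> [[h ->]|[h ->]]; last by exists (h 0).
by exists (\row_k h k); apply: eq_bigr => k _; rewrite mxE.
Qed.

Lemma span_submod r z (G : 'I_z -> 'rV[A]_r) : is_submod (span G).
Proof.
split=> [|f x y]; first by apply/span_comb; exists 0; rewrite linear0.
move=> /span_comb [h ->] /span_comb [k ->]; apply/span_comb.
by exists (f *: h + k); rewrite linearP.
Qed.

Lemma span_gen r z (G : 'I_z -> 'rV[A]_r) k : span G (G k).
Proof. by apply/span_comb; exists (ebasis k); rewrite comb_ebasis. Qed.

Section Division.
Variables (r : nat) (lt : rel ('X_{1..n} * 'I_r)).
Hypothesis hlt : left_monomial_ordering a prec lt.
Variables (z : nat) (G : 'I_z -> 'rV[A]_r) (T : 'I_z -> 'X_{1..n} * 'I_r).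
Hypothesis hT : forall k, is_LML a lt (G k) (T k).

(** Induction on the bound: the coefficient at the bound is removed by a
    multiple of a generator when some leading monomial divides the bound, and is
    moved to the remainder otherwise. *)
Lemma division_LM_bound t x : LM_bound lt x t -> exists h rho,
  [/\ x = comb G h + rho, forall k, LM_bound lt (h 0 k *: G k) t, LM_bound lt rho t
    & forall u, coefv rho u != 0 -> forall k, ~~ mdvd (T k) u].
Proof.
elim/(well_founded_ind (lmo_wf hlt)): t x => t IH x hx.
(* The induction hypothesis, in the form needed once the coefficient at [t]
   has been removed. *)
have {}IH y : LM_bound lt y t -> coefv y t = 0 -> exists h rho,
  [/\ y = comb G h + rho, forall k, LM_bound lt (h 0 k *: G k) t, LM_bound lt rho t
    & forall u, coefv rho u != 0 -> forall k, ~~ mdvd (T k) u].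
  move=> hy ey; have [->|/(lead_ex hlt) [u hu]] := eqVneq y 0.
    exists 0, 0; split=> [|k||u]; rewrite ?linear0 ?addr0 ?mxE ?scale0r ?coefv0 ?eqxx
      //;
      exact: LM_bound0.
  have lut := LM_bound_strict hy ey hu; have le : leL lt u t by rewrite /leL lut orbT.
  have [h [rho [e h1 h2 h3]]] := IH u lut y (LM_bound_lead hlt hu (predU1l _ (erefl
    u))).
  by exists h, rho; split=> // [k|]; apply: (LM_bound_trans hlt _ le).
case: (classic (exists k, mdvd (T k) t)) => [[k /mdvdP [g et]]|no].
  have hg : is_LML a lt (mon g *: G k) t.
    by rewrite et; apply: is_LML_scale => //; exact: is_LM_1mon.
  pose c := coefv x t / coefv (mon g *: G k) t.
  have [g0 hgb] : _ /\ _ := (is_LMLE _ _ _).1 hg.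
  have hgc : LM_bound lt ((c *: mon g) *: G k) t.
    move=> s; rewrite coefvZ mulf_eq0 negb_or => /andP [_]; exact: hgb.
  have [||h [rho [e h1 h2 h3]]] := IH (x - (c *: mon g) *: G k).
  - by apply: LM_boundD => //; apply: LM_boundN.
  - by rewrite coefvB coefvZ /c divfK ?subrr.
  exists (h + (c *: mon g) *: ebasis k), rho; split=> //.
    rewrite linearD linearZ /= comb_ebasis addrAC -e; by rewrite subrK.
  move=> j; rewrite !mxE eqxx /=; case: eqVneq => [->|_]; last by rewrite mulr0 addr0.
  by rewrite mulr1 scalerDl; apply: LM_boundD.
pose y := ((coefv x t) *: 1) *: monL t.
have ey u : coefv y u = coefv x t * (t == u)%:R by rewrite coefvZ scale1r coefv_monL.
have yb : LM_bound lt y t.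
  move=> u; rewrite ey mulf_eq0 negb_or => /andP [_].
  by case: (eqVneq t u) => [->|_]; rewrite /leL ?eqxx.
have [||h [rho [e h1 h2 h3]]] := IH (x - y).
- by apply: LM_boundD => //; apply: LM_boundN.
- by rewrite coefvB ey eqxx mulr1 subrr.
exists h, (rho + y); split=> //.
- by rewrite addrA -e subrK.
- exact: LM_boundD.
move=> u; rewrite coefvD ey; case: (eqVneq t u) => [<- _ k|_];
  last by rewrite mulr0 addr0; exact: h3.
by apply/negP => hk; apply: no; exists k.
Qed.

Lemma division x : exists h rho,
  [/\ x = comb G h + rho, forall k, LM_le a lt (h 0 k *: G k) x, LM_le a lt rho x
    & forall u, coefv rho u != 0 -> forall k, ~~ mdvd (T k) u].
Proof.
have LM0 y : LM_le a lt 0 y by move=> t /is_LMLE []; rewrite coefv0 eqxx.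
have [->|/(lead_ex hlt) [t ht]] := eqVneq x 0.
  exists 0, 0; split=> [|k||u]; rewrite ?linear0 ?addr0 ?mxE ?scale0r ?coefv0 ?eqxx
    //.
have [h [rho [e h1 h2 h3]]] := division_LM_bound ((is_LMLE _ _ _).1 ht).2.
have x0 : x <> 0 by move=> x0; move: ht; rewrite x0 => /is_LMLE [];
  rewrite coefv0 eqxx.
exists h, rho; split=> // [k|]; apply/(LM_leP hlt); split=> // u hu;
  by rewrite -(lead_uniq hlt ht hu).
Qed.

End Division.

Definition Groebner_family r (lt : rel ('X_{1..n} * 'I_r)) (N : 'rV[A]_r -> Prop)
    z (G : 'I_z -> 'rV[A]_r) (T : 'I_z -> 'X_{1..n} * 'I_r) :=
  [/\ forall k, N (G k), forall k, is_LML a lt (G k) (T k)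
    & forall x u, N x -> is_LML a lt x u -> exists k, mdvd (T k) u].

Lemma Groebner_rep r (lt : rel ('X_{1..n} * 'I_r)) N z (G : 'I_z -> 'rV[A]_r) T x :
    left_monomial_ordering a prec lt -> is_submod N -> Groebner_family lt N G T -> N
      x ->
  exists h, x = comb G h /\ forall k, LM_le a lt (h 0 k *: G k) x.
Proof.
move=> hlt hN [gN gT gG] Nx; have [h [rho [e h1 _ h3]]] := division hlt gT x.
suff r0 : rho = 0 by exists h; rewrite e r0 addr0; split=> // k; have := h1 k;
  rewrite {1}e r0 addr0.
apply/eqP; apply/negP => /negP /(lead_ex hlt) [u hu].
have Nr : N rho by rewrite -[rho](addKr (comb G h)) -e addrC; apply: submodB => //;
  exact: submod_comb.
have [k] := gG _ _ Nr hu; apply/negP/h3; by case/is_LMLE: hu.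
Qed.

(** * Filtrations in terms of supports *)

Lemma FLE r (b : 'I_r -> nat) q x :
  FL a w b q x <-> forall u, coefv x u != 0 -> (wdeg u.1 + b u.2 <= q)%N.
Proof.
split=> [[c hc ->] u|h].
  move=> hu; apply: hc; rewrite mcoeff_msupp; move: hu; rewrite /coefv summxE.
  rewrite (bigD1 u.2) //= big1 => [|i ne]; rewrite mxE ebasisE.
    by rewrite eqxx mulr1 addr0 lincombK.
  by rewrite eq_sym (negPf ne) mulr0.
exists (fun i => coefs (x 0 i)) => [i m|]; first by rewrite mcoeff_msupp =>
  /(h (m, i)).
by rewrite {1}[x]row_ebasis; apply: eq_bigr => i _; rewrite coefsK.
Qed.

Lemma FAE p f : FA a w p f <-> forall m, (coefs f)@_m != 0 -> (wdeg m <= p)%N.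
Proof.
split=> [[c hc ->] m|h]; first by rewrite lincombK -mcoeff_msupp; exact: hc.
by exists (coefs f); rewrite ?coefsK // => m; rewrite mcoeff_msupp; exact: h.
Qed.

(** * The Schreyer ordering *)

(** In the definition of a left monomial ordering, the product of a^g with a
    monomial enters through its leading monomial; that is its shift as soon as
    the ordering refines the one of the algebra. *)
Lemma lmo_intro r (lt : rel ('X_{1..n} * 'I_r)) :
    strict_total_order lt ->
    (forall g s t, lt s t -> lt (mshift g s) (mshift g t)) ->
    (forall m p i, prec m p -> lt (m, i) (p, i)) ->
  left_monomial_ordering a prec lt.
Proof.
move=> sto hc hp; split=> //; have [irr tr _] := sto.
suff e s g mu : is_LML a lt (mon g *: monL s) mu -> mu = mshift g s.
  by move=> s t g mu nu l /e -> /e ->; exact: hc.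
move=> /is_LMLE [h1 h2]; have /h2 h3 : coefv (mon g *: monL s) (mshift g s) != 0.
  by rewrite coefv_scale_mon eqxx mulr1 (mon_mul_lead _ _).1.
move: h1; case: mu h2 h3 => m i h2 h3; rewrite coefv_scale_mon mulf_eq0 negb_or /=.
case/andP=> /(mon_mul_lead _ _).2 hm hi.
have ei : i = s.2 by apply/eqP; apply: contraNT hi => /negPf ->.
rewrite ei in h3 *; case/predU1P: hm => [-> //|/(hp _ _ s.2) l].
case/predU1P: h3 => [<- //|l']; by have := tr _ _ _ l l'; rewrite irr.
Qed.

Lemma is_LM_comp r (lt : rel ('X_{1..n} * 'I_r)) (h : 'rV[A]_r) t :
    left_monomial_ordering a prec lt -> is_LML a lt h t ->
  is_LM a prec (h 0 t.2) t.1.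
Proof.
move=> hlt /is_LMLE [h1 h2]; apply/is_LM_mon; split=> // p hp.
have := h2 (p, t.2) hp; rewrite /precle; case: eqVneq => //= ne.
case/orP: (prec_total ne) => // l; rewrite [t]surjective_pairing.
move=> /(leL_anti hlt) h3; suff e : p = t.1 by rewrite e eqxx in ne.
by apply: (congr1 fst (h3 _)); rewrite /leL (lmo_prec hlt) ?orbT.
Qed.

Lemma row_neq0 r (h : 'rV[A]_r) k : h 0 k = 0 -> forall m, coefv h (m, k) = 0.
Proof. by move=> e m; rewrite /coefv e raddf0 mcoeff0. Qed.

Section Schreyer.
Variables (r : nat) (lt : rel ('X_{1..n} * 'I_r)).
Hypothesis hlt : left_monomial_ordering a prec lt.
Variables (z : nat) (G : 'I_z -> 'rV[A]_r) (T : 'I_z -> 'X_{1..n} * 'I_r).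
Hypothesis hT : forall k, is_LML a lt (G k) (T k).
Variable tie : rel 'I_z.
Hypothesis htie : strict_total_order tie.

(** The leading monomial of a^alpha G_k, for the monomial a^alpha e_k of the
    module of coefficient vectors. *)
Definition schreyer_mon (s : 'X_{1..n} * 'I_z) := mshift s.1 (T s.2).

(** Schreyer's ordering compares what the monomials are mapped to; which order
    [tie] on the generators breaks the ties is left open, because one choice is
    needed for Buchberger's algorithm and another for bounding the length of
    resolutions. *)
Definition schreyer_lt : rel ('X_{1..n} * 'I_z) :=
  fun s t => lt (schreyer_mon s) (schreyer_mon t) ||
    (schreyer_mon s == schreyer_mon t) && tie s.2 t.2.

Lemma schreyer_mon_shift g s : schreyer_mon (mshift g s) = mshift g (schreyer_mon s).
Proof. by rewrite /schreyer_mon mshiftA. Qed.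

Lemma schreyer_lt_lmo : left_monomial_ordering a prec schreyer_lt.
Proof.
have [tirr ttr ttot] := htie; apply: lmo_intro.
- split.
  + by move=> s; rewrite /schreyer_lt (lmo_irr hlt) tirr andbF.
  + move=> t s u; rewrite /schreyer_lt => /orP [l1|/andP [/eqP e1 t1]] /orP [l2|/andP
      [/eqP e2 t2]].
    * by rewrite (lmo_trans hlt l1 l2).
    * by rewrite -e2 l1.
    * by rewrite e1 l2.
    * by rewrite e1 e2 eqxx (ttr _ _ _ t1 t2) orbT.
  + move=> s t ne; rewrite /schreyer_lt [schreyer_mon t == _]eq_sym;
      case: (eqVneq (schreyer_mon s) (schreyer_mon t)) => [e|ne2] /=.
      have ne2 : s.2 != t.2.
        apply: contraNneq ne => e2; rewrite [s]surjective_pairing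
          [t]surjective_pairing e2.
        have := congr1 fst e; rewrite /schreyer_mon /= e2 => /eqP;
          rewrite eqm_add2r => /eqP ->.
        by rewrite eqxx.
      by have /orP [->|->] := ttot _ _ ne2; rewrite ?orbT.
    by have /orP [->|->] := lmo_total hlt ne2; rewrite ?orbT.
- move=> g s t; rewrite /schreyer_lt !schreyer_mon_shift =>
    /orP [/(lmo_mshift hlt) -> //|/andP [/eqP -> ->]].
  by rewrite eqxx orbT.
move=> m p k h; rewrite /schreyer_lt /schreyer_mon /= /mshift; apply/orP; left.
by apply: (lmo_prec hlt); exact: prec_add2r.
Qed.

Lemma leL_schreyer_mon s t : leL schreyer_lt s t -> leL lt (schreyer_mon s)
  (schreyer_mon t).
Proof.
rewrite /leL /schreyer_lt; case/predU1P=> [->|/orP [->|/andP [-> _]]] //;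
  by rewrite ?eqxx ?orbT.
Qed.

Lemma comb_LM_bound h d : (forall s, coefv h s != 0 -> leL lt (schreyer_mon s) d) ->
  LM_bound lt (comb G h) d.
Proof.
move=> hh; apply: LM_bound_sum => k _; have [->|/is_LM_ex [m hm]] := eqVneq (h 0 k) 0.
  by rewrite scale0r; exact: LM_bound0.
apply: (LM_bound_lead hlt (is_LML_scale hlt hm (hT k))); apply: (hh (m, k)).
by case/is_LM_mon: hm.
Qed.

Lemma schreyer_LM_bound h t : is_LML a schreyer_lt h t -> LM_bound lt (comb G h)
  (schreyer_mon t).
Proof. by case/is_LMLE=> _ hb; apply: comb_LM_bound => s /hb;
  exact: leL_schreyer_mon. Qed.

(** The coefficient of [comb G h] at the monomial of the leading term of [h]
    receives a contribution from that term; for it to vanish some other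
    generator must contribute as well, and it then loses the tie. *)
Lemma schreyer_top h t : is_LML a schreyer_lt h t ->
    coefv (comb G h) (schreyer_mon t) = 0 ->
  exists l m, tie l t.2 /\ mshift m (T l) = schreyer_mon t.
Proof.
move=> ht; have [_ hb] := (is_LMLE _ _ _).1 ht.
have hlm := is_LM_comp schreyer_lt_lmo ht.
have [nz _] := (is_LMLE _ _ _).1 (is_LML_scale hlt hlm (hT t.2)).
rewrite /comb coefv_sum (bigD1 t.2) //= => /eqP; rewrite addr_eq0 => /eqP e.
rewrite {}e oppr_eq0 big_mkcond /= in nz.
have [l _] := sum_nz nz; case: ifP; last by rewrite eqxx.
move=> ne hl; have h0 : h 0 l != 0 by apply: contraNneq hl => ->;
  rewrite scale0r coefv0.
have [m hm] := is_LM_ex h0; have := hb (m, l); rewrite /coefv /=.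
have hml := (is_LM_mon _ _).1 hm; move=> /(_ hml.1) le.
have [_ /(_ _ hl) h1] := (is_LMLE _ _ _).1 (is_LML_scale hlt hm (hT l)).
have e : schreyer_mon (m, l) = schreyer_mon t by apply: (leL_anti hlt) => //;
  exact: leL_schreyer_mon.
exists l, m; split=> //; case/predU1P: le => [e2|]; first by rewrite -e2 eqxx in ne.
by rewrite /schreyer_lt e eqxx (lmo_irr hlt).
Qed.

(** As leading terms do not cancel in products, a standard expression of an
    element below [d] only involves terms that are mapped below [d]. *)
Lemma supp_small (h : 'rV[A]_z) (S : 'rV[A]_r) d :
    (forall k, LM_le a lt (h 0 k *: G k) S) -> LM_bound lt S d -> coefv S d = 0 ->
  forall s, coefv h s != 0 -> lt (schreyer_mon s) d.
Proof.
move=> hh hS eS [m k] hs; have h0 : h 0 k != 0.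
  by apply: contraNneq hs => /row_neq0 ->.
have [p hp] := is_LM_ex h0; have lead := is_LML_scale hlt hp (hT k).
have /= le := (is_LM_mon _ _).1 hp; have [u hu lu] := hh k _ lead.
apply: (leL_lt_trans hlt (leL_mshift2 hlt (T k) (le.2 _ hs))).
have := LM_bound_strict hS eS hu; case: lu => [-> //|]; exact: (lmo_trans hlt).
Qed.

(** The leading term of the syzygy of an S-pair sits at the generator which
    wins the tie, with the cofactor of the lcm as its monomial. *)
Lemma spair_lead k l u v h mk ml : tie l k -> mshift mk (T k) = mshift ml (T l) ->
    is_LM a prec u mk -> (forall q, (coefs v)@_q != 0 -> precle q ml) ->
    (forall s, coefv h s != 0 -> lt (schreyer_mon s) (mshift mk (T k))) ->
  is_LML a schreyer_lt (u *: ebasis k - v *: ebasis l - h) (mk, k).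
Proof.
move=> tlk ek /is_LM_mon [u0 hu] hv hh.
have [tirr _ _] := htie.
have cob f i s : coefv (f *: ebasis i : 'rV_z) s = (coefs f)@_s.1 * (s.2 == i)%:R.
  rewrite /coefv mxE ebasisE; case: (s.2 == i); first by rewrite !mulr1.
  by rewrite !mulr0 raddf0 mcoeff0.
have nkl : (k == l) = false by apply: contraTF tlk => /eqP ->; rewrite tirr.
apply/is_LMLE; split.
  rewrite !coefvB !cob /= eqxx mulr1 nkl mulr0 subr0.
  have [->|/hh] := eqVneq (coefv h (mk, k)) 0; first by rewrite subr0.
  by rewrite /schreyer_mon /= (lmo_irr hlt).
apply: LM_boundD; last first.
  by apply: LM_boundN => s /hh h1; rewrite /leL /schreyer_lt {2}/schreyer_mon /= h1
    orbT.
apply: LM_boundD => [[m i]|]; rewrite ?cob.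
  rewrite mulf_eq0 negb_or /= => /andP [/hu hm]; case: (eqVneq i k) => [-> _|_];
    last by rewrite eqxx.
  exact: (lmo_le_prec schreyer_lt_lmo).
apply: LM_boundN => -[m i]; rewrite cob mulf_eq0 negb_or /= => /andP [/hv hm].
case: (eqVneq i l) => [-> _|_]; last by rewrite eqxx.
rewrite /leL /schreyer_lt /= tlk andbT /schreyer_mon /=.
have := leL_mshift2 hlt (T l) hm; rewrite -ek /leL => /predU1P [->|->];
  by rewrite ?eqxx ?orbT.
Qed.

(** If every S-pair has a syzygy led as above, no element irreducible modulo
    these syzygies can have a cancelling leading term. *)
Section Criterion.
Variables (y : nat) (Z : 'I_y -> 'rV[A]_z) (TZ : 'I_y -> 'X_{1..n} * 'I_z).
Hypothesis hTZ : forall j, is_LML a schreyer_lt (Z j) (TZ j).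
Hypothesis hZ : forall j, Syz G (Z j).
Hypothesis crit : forall k l, tie l k -> (T l).2 = (T k).2 ->
  exists j, mdvd (TZ j) ((mlcm (T k).1 (T l).1 - (T k).1)%MM, k).

(** The two terms that compete at the top have a common image, so the lcm of the
    leading monomials of their generators divides it. *)
Lemma top_divisible h t : is_LML a schreyer_lt h t ->
    coefv (comb G h) (schreyer_mon t) = 0 ->
  exists j, mdvd (TZ j) t.
Proof.
move=> ht e; have [l [m [tl em]]] := schreyer_top ht e.
have [j /andP [/eqP j1 j2]] := crit tl (congr1 snd em).
exists j; apply/andP; split; first by rewrite j1.
apply: (lepm_trans j2) => /=; apply/mnm_lepP => i; rewrite mnmBE mnmE.
by have /mnmP/(_ i) := congr1 fst em; rewrite /= !mnmDE; lia.
Qed.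

(** The value of a syzygy is 0, so its leading term is always cancelled. *)
Lemma schreyer_Groebner : Groebner_family schreyer_lt (Syz G) Z TZ.
Proof.
split=> // h t hs ht; apply: (top_divisible ht).
by move: hs; rewrite /Syz -/(comb G h) => ->; rewrite coefv0.
Qed.

Lemma syz_gen h : Syz G h -> exists q, h = comb Z q.
Proof.
move=> hs; have [q [e _]] := Groebner_rep schreyer_lt_lmo (Syz_submod G)
  schreyer_Groebner hs.
by exists q.
Qed.

(** Dividing the coefficient vector by the syzygies does not change its value
    and leaves one whose leading term cannot be cancelled; the leading monomial
    of the value is the image of that term. *)
Lemma buchberger_criterion : Groebner_family lt (span G) G T.
Proof.
split=> //; first by move=> k; exact: span_gen.
move=> x u /span_comb [h ->] hu; have [q [h' [e _ _ irr]]] :=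
  division schreyer_lt_lmo hTZ h.
have ex : comb G h = comb G h'.
  rewrite e linearD /= comb_comp [X in X + _]big1 ?add0r // => j _.
  by have := hZ j; rewrite /Syz -/(comb G (Z j)) => ->; rewrite scaler0.
rewrite ex in hu; have h0 : h' != 0.
  by apply: contraPneq hu => ->; rewrite linear0 => /is_LMLE []; rewrite coefv0 eqxx.
have [t ht] := lead_ex schreyer_lt_lmo h0.
have nz : coefv (comb G h') (schreyer_mon t) != 0.
  apply/negP => /eqP /(top_divisible ht) [j]; apply/negP/irr.
  by case/is_LMLE: ht.
have lt' : is_LML a lt (comb G h') (schreyer_mon t) by apply/is_LMLE; split=> //;
  exact: schreyer_LM_bound.
exists t.2; rewrite (lead_uniq hlt hu lt'); apply/mdvdP; by exists t.1.
Qed.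

End Criterion.
End Schreyer.

Section Filtration.
Variables (r : nat) (b : 'I_r -> nat).
Implicit Types (x y : 'rV[A]_r).
Local Notation FL := (FL a w).

Definition degL (t : 'X_{1..n} * 'I_r) := (wdeg t.1 + b t.2)%N.

Lemma FL_mono p q x : (p <= q)%N -> FL b p x -> FL b q x.
Proof. by move=> l /FLE h; apply/FLE => u /h /leq_trans; apply. Qed.
Lemma FL0 q : FL b q 0.
Proof. by apply/FLE => u; rewrite coefv0 eqxx. Qed.
Lemma FLD q x y : FL b q x -> FL b q y -> FL b q (x + y).
Proof.
move=> /FLE hx /FLE hy; apply/FLE => u; rewrite coefvD.
have [->|/hx //] := eqVneq (coefv x u) 0; by rewrite add0r; exact: hy.
Qed.
Lemma FLN q x : FL b q x -> FL b q (- x).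
Proof. by move=> /FLE h; apply/FLE => u; rewrite coefvN oppr_eq0; exact: h. Qed.
Lemma FLB q x y : FL b q x -> FL b q y -> FL b q (x - y).
Proof. by move=> hx /FLN; exact: FLD. Qed.
Lemma FL_sum q (I : Type) (s : seq I) (P : pred I) (F : I -> 'rV[A]_r) :
  (forall i, P i -> FL b q (F i)) -> FL b q (\sum_(i <- s | P i) F i).
Proof.
move=> h; apply: (big_ind (fun x => FL b q x)) => //; [exact: FL0|exact: FLD].
Qed.
Lemma FL_exh x : exists q, FL b q x.
Proof.
exists (\max_(u <- supp x) degL u)%N; apply/FLE => u; rewrite -mem_supp => hu.
by rewrite (big_rem u) //= leq_maxl.
Qed.
Lemma FL_scale p q f x : FA a w p f -> FL b q x -> FL b (p + q)%N (f *: x).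
Proof.
move=> /FAE hf /FLE hx; apply/FLE => -[m i]; rewrite /coefv mxE /=.
move=> /coefs_mul_supp [k [l [hk hl /precle_wdeg]]]; rewrite wdegD.
have := hf _ hk; have /= := hx (l, i) hl; lia.
Qed.
Lemma FA_const k : FA a w 0 (k%:A : A).
Proof.
apply/FAE => m; rewrite coefsZ -mon0 coefs_mon mcoeffZ mcoeffX mulf_eq0 negb_or =>
  /andP [_].
case: (eqVneq 0%MM m) => [<- _|]; last by rewrite eqxx.
by rewrite /Defs.wdeg big1 // => i _; rewrite mnm0E muln0.
Qed.
Lemma FL_scalec q (k : K) x : FL b q x -> FL b q (k%:A *: x).
Proof. exact: (FL_scale (FA_const k)). Qed.
Lemma FL_ebasis k : FL b (b k) (ebasis k).
Proof.
apply/FLE => -[m i]; rewrite /coefv ebasisE /=; case: (eqVneq i k) => [->|_].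
  by rewrite -mon0 coefs_mon mcoeffX; case: (eqVneq 0%MM m) => [<-|]; rewrite ?eqxx //
    /Defs.wdeg big1 // => j _; rewrite mnm0E muln0.
by rewrite raddf0 mcoeff0 eqxx.
Qed.

(** Only the exponent 0 has degree 0, because the weights are positive. *)
Lemma FL_unit i x : FL b (b i) x -> x 0 i = (coefv x (0%MM, i))%:A.
Proof.
move=> /FLE h; rewrite -{1}[x 0 i]coefsK; have ->
  : coefs (x 0 i) = coefv x (0%MM, i) *: 'X_[0%MM].
  apply/mpolyP => m; rewrite mcoeffZ mcoeffX; case: (eqVneq 0%MM m) => [<-|ne].
    by rewrite mulr1.
  rewrite mulr0; apply/eqP; apply: contraNT ne => /(h (m, i)) /= hm.
  by rewrite eq_sym; apply/eqP/wdeg_eq0; lia.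
by rewrite lincombZ lincombX mon0.
Qed.

Lemma FL_low i q x : FL b q x -> (q < b i)%N -> x 0 i = 0.
Proof.
move=> /FLE h l; rewrite -[x 0 i]coefsK; suff -> : coefs (x 0 i) = 0.
  by rewrite /Defs.lincomb msupp0 big_nil.
apply/mpolyP => m; rewrite mcoeff0; apply/eqP; apply/negP => /negP /(h (m, i)) /=;
  lia.
Qed.

Lemma FL_coef q x i : FL b q x -> x 0 i != 0 ->
  (b i <= q)%N /\ FA a w (q - b i)%N (x 0 i).
Proof.
move=> h nz; have l : (b i <= q)%N.
  by rewrite leqNgt; apply: contraNN nz => /(FL_low h) ->.
split=> //; apply/FAE => m; move/FLE: h => /(_ (m, i)) h /h /=; lia.
Qed.

Lemma dfilE x q : dfil (FL b) x q <->
  [/\ x != 0, FL b q x & forall p, FL b p x -> (q <= p)%N].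
Proof.
split=> [[h1 h2]|[h1 h2 h3]]; split=> //.
- by apply/eqP => e; apply: h2; rewrite e; case: (q) => // p; exact: FL0.
- move=> p hp; rewrite leqNgt; apply/negP => l; apply: h2.
  by case: q l h1 => // q l _; apply: FL_mono hp.
- case: q h2 h3 => [|q] h2 h3 /=; first exact/eqP.
  by move=> /h3; rewrite ltnn.
Qed.

Section Graded.
Variable lt : rel ('X_{1..n} * 'I_r).
Hypothesis hlt : graded_left_monomial_ordering a prec w b lt.

Lemma glmo_le s t : leL lt s t -> (degL s <= degL t)%N.
Proof. by case: hlt => _ h /predU1P [->//|/h]. Qed.
Lemma FL_LM_bound q x t : LM_bound lt x t -> (degL t <= q)%N -> FL b q x.
Proof. by move=> h l; apply/FLE => u /h /glmo_le h1; exact: leq_trans l. Qed.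
Lemma FL_lead q x t : is_LML a lt x t -> FL b q x -> (degL t <= q)%N.
Proof. by case/is_LMLE=> nz _ /FLE; apply. Qed.
Lemma dfil_lead x t : is_LML a lt x t -> dfil (FL b) x (degL t).
Proof.
move=> ht; have [h1 h2] := (is_LMLE _ _ _).1 ht; apply/dfilE; split.
- exact: coefv_neq0 h1.
- exact: FL_LM_bound h2 _.
- by move=> p; exact: FL_lead.
Qed.

(** Degrees add up in products, since leading monomials do. *)
Lemma FL_divisor q f x : f != 0 -> x != 0 -> FL b q (f *: x) ->
  exists2 d, dfil (FL b) x d & forall m, (coefs f)@_m != 0 -> (wdeg m + d <= q)%N.
Proof.
move=> /is_LM_ex [m hm] /(lead_ex hlt.1) [t ht] h; exists (degL t);
  first exact: dfil_lead.
move=> p /((is_LM_mon _ _).1 hm).2 /precle_wdeg l.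
have := FL_lead (is_LML_scale hlt.1 hm ht) h; rewrite /degL /= wdegD; lia.
Qed.

End Graded.

Definition std_order : rel ('X_{1..n} * 'I_r) := fun s t =>
  (degL s < degL t)%N ||
  (degL s == degL t) && (prec s.1 t.1 || (s.1 == t.1) && (s.2 < t.2)%N).

Lemma std_order_graded : graded_left_monomial_ordering a prec w b std_order.
Proof.
have degD g s : degL (mshift g s) = (wdeg g + degL s)%N by rewrite /degL /= wdegD
  addnA.
split; last first.
  by move=> s t; rewrite -!/(degL _) => /orP [/ltnW //|/andP [/eqP e _]];
    rewrite /degL in e *; rewrite e.
apply: lmo_intro.
- split.
  + by move=> s; rewrite /std_order !ltnn prec_irr /= !andbF.
  + move=> t s u; rewrite /std_order => /orP [l1|/andP [/eqP e1 h1]] /orP [l2|/andP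
      [/eqP e2 h2]].
    * by rewrite (ltn_trans l1 l2).
    * by rewrite -e2 l1.
    * by rewrite e1 l2.
    * rewrite e1 e2 eqxx ltnn /=.
      case/orP: h1 => [p1|/andP [/eqP p1 q1]];
        case/orP: h2 => [p2|/andP [/eqP p2 q2]].
      - by rewrite (prec_trans p1 p2).
      - by rewrite -p2 p1.
      - by rewrite p1 p2.
      - by rewrite p1 p2 eqxx (ltn_trans q1 q2) orbT.
  + move=> s t ne; rewrite /std_order [degL t == _]eq_sym [t.1 == _]eq_sym.
    case: (ltngtP (degL s) (degL t)) => //= _.
    case: (eqVneq s.1 t.1) => [e|ne1] /=.
      have ne2 : s.2 != t.2.
        by apply: contraNneq ne => e2; rewrite [s]surjective_pairing
          [t]surjective_pairing e e2.
      by rewrite e prec_irr /= -neq_ltn.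
    by rewrite !orbF; exact: prec_total.
- move=> g s t; rewrite /std_order !degD /= ltn_add2l eqn_add2l eqm_add2l.
  case/orP=> [-> //|/andP [-> /orP [/(prec_add2l g) -> |->]]]; by rewrite ?orbT.
move=> m p i h; rewrite /std_order /degL /= h andbT ltn_add2r eqn_add2r.
by rewrite orbC -leq_eqVlt; exact: hgr.
Qed.

End Filtration.

(** * Standard bases *)

Section Standard.
Variables (r : nat) (b : 'I_r -> nat) (N : 'rV[A]_r -> Prop).
Hypothesis hN : is_submod N.
Local Notation FL := (FL a w).

Lemma FL_coef_scale z (c : 'I_z -> nat) q h i x :
  FL c q h -> FL b (c i) x -> FL b q (h 0 i *: x).
Proof.
move=> hh hx; have [->|nz] := eqVneq (h 0 i) 0; first by rewrite scale0r; exact: FL0.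
by have [l hf] := FL_coef hh nz; rewrite -(subnK l); exact: FL_scale.
Qed.

Lemma FL_comb z (c : 'I_z -> nat) (v : 'I_z -> 'rV[A]_r) q h :
  (forall k, FL b (c k) (v k)) -> FL c q h -> FL b q (comb v h).
Proof. by move=> hv hh; apply: FL_sum => k _; exact: FL_coef_scale (hv k). Qed.

(** A standard basis with a bound [c] on the degrees of its elements.  The bound
    makes the coefficient vectors into elements of a filtered free module with
    degrees [c], and the condition says that [comb v] is strict onto [N]. *)
Definition std_family z (c : 'I_z -> nat) (v : 'I_z -> 'rV[A]_r) :=
  [/\ forall k, N (v k), forall k, FL b (c k) (v k)
    & forall q x, N x -> FL b q x -> exists h, FL c q h /\ x = comb v h].

(** A Groebner basis for a graded ordering is a standard basis: division does
    not raise leading monomials, hence not degrees. *)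
Lemma Groebner_std lt z (G : 'I_z -> 'rV[A]_r) T :
    graded_left_monomial_ordering a prec w b lt -> Groebner_family lt N G T ->
  std_family (fun k => degL b (T k)) G.
Proof.
move=> hlt gb; have [gN gT _] := gb; split=> // [k|q x Nx hx].
  by have /dfilE [] := dfil_lead hlt (gT k).
have [h [e hh]] := Groebner_rep hlt.1 hN gb Nx; exists h; split=> //.
apply/FLE => -[m k] hm; have h0 : h 0 k != 0 by apply: contraNneq hm => /row_neq0 ->.
have [p hp] := is_LM_ex h0; have [u hu lu] := hh k _ (is_LML_scale hlt.1 hp (gT k)).
have := FL_lead hu hx; have /glmo_le := hlt => /(_ (mshift p (T k)) u).
have : leL lt (mshift p (T k)) u by rewrite /leL; case: lu => ->; rewrite ?eqxx ?orbT.
move=> -> // /(_ isT); have /precle_wdeg := ((is_LM_mon _ _).1 hp).2 _ hm.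
by rewrite /degL /= wdegD; lia.
Qed.

End Standard.

Definition mask z (J : {set 'I_z}) (h : 'rV[A]_z) : 'rV[A]_z :=
  \row_k (if k \in J then h 0 k else 0).

Lemma FL_mask z (c : 'I_z -> nat) (J : {set 'I_z}) q h :
  FL a w c q h -> FL a w c q (mask J h).
Proof.
move=> /FLE hh; apply/FLE => -[m k]; rewrite /coefv mxE /=; case: ifP => _ //.
  exact: (hh (m, k)).
by rewrite raddf0 mcoeff0 eqxx.
Qed.

Lemma comb_mask r z (J : {set 'I_z}) (v : 'I_z -> 'rV[A]_r) h :
  comb v (mask J h) = \sum_(i in J) h 0 i *: v i.
Proof.
rewrite /comb [RHS]big_mkcond; apply: eq_bigr => k _; rewrite mxE.
by case: ifP => // _; rewrite scale0r.
Qed.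

Lemma mask_setT z (h : 'rV[A]_z) : mask setT h = h.
Proof. by apply/rowP => k; rewrite mxE in_setT. Qed.

Lemma trunc_sumP nu q (f : A) :
  (exists2 c : nat -> A, (forall p, FA a w p (c p))
     & f = \sum_(p < q.+1 | (p + nu <= q)%N) c p) <->
  (forall m, (coefs f)@_m != 0 -> (wdeg m + nu <= q)%N).
Proof.
split=> [[c hc ->] m|h].
  rewrite raddf_sum /= raddf_sum /= big_mkcond => /sum_nz [p _].
  by case: ifP => [l /((FAE _ _).1 (hc p)) ?|]; [lia|rewrite eqxx].
have [l|l] := leqP nu q; last first.
  exists (fun=> 0) => [p|]; first by apply/FAE => m; rewrite raddf0 mcoeff0 eqxx.
  rewrite big1 // -[f]coefsK; suff -> : coefs f = 0 by rewrite /Defs.lincomb msupp0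
    big_nil.
  by apply/mpolyP => m; rewrite mcoeff0; apply/eqP; apply/negP => /negP /h; lia.
exists (fun p => if p == (q - nu)%N then f else 0) => [p|].
  apply/FAE => m; case: (p =P (q - nu)%N) => [->|_];
    last by rewrite raddf0 mcoeff0 eqxx.
  by move=> /h; lia.
have hq : (q - nu < q.+1)%N by lia.
rewrite (bigD1 (Ordinal hq)) /= ?subnK // eqxx big1 ?addr0 // => p /andP [_].
by rewrite -val_eqE /= => /negPf ->.
Qed.

(** The truncated sums in the definition of an F-basis describe the coefficient
    vectors of degree at most [q] in the filtered free module with degrees
    [nu]. *)
Lemma F_basis_onE (M : lmodType A) (F : nat -> M -> Prop) z (J : {set 'I_z})
    (v : 'I_z -> M) :
  F_basis_on a w F J v <->
  (forall i, i \in J -> v i <> 0) /\ exists nu : 'I_z -> nat, forall q x,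
    F q x <-> exists h : 'rV[A]_z, FL a w nu q h /\ x = \sum_(i in J) h 0 i *: v i.
Proof.
split=> -[v0 [nu hF]]; split=> //; exists nu => q x; split.
- move=> /hF [h hh ->]; exists (\row_i h i); split.
    by apply/FLE => -[m i]; rewrite /coefv mxE /= => hm;
      apply: ((trunc_sumP _ _ _).1 (hh i)).
  by apply: eq_bigr => i _; rewrite mxE.
- move=> [h [/FLE hh ->]]; apply/hF; exists (h 0) => // i; apply/trunc_sumP => m.
  exact: (hh (m, i)).
- move=> /hF [h [/FLE hh ->]]; exists (h 0) => // i; apply/trunc_sumP => m.
  exact: (hh (m, i)).
- move=> [h hh ->]; apply/hF; exists (\row_i h i); split.
    by apply/FLE => -[m i]; rewrite /coefv mxE /= => hm;
      apply: ((trunc_sumP _ _ _).1 (hh i)).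
  by apply: eq_bigr => i _; rewrite mxE.
Qed.

Section Induced.
Variables (r : nat) (b : 'I_r -> nat) (N : 'rV[A]_r -> Prop).
Hypothesis hN : is_submod N.
Local Notation FL := (FL a w).
Local Notation FN := (induced (FL b) N).

Lemma dfil_induced x q : N x -> (dfil FN x q <-> dfil (FL b) x q).
Proof. by move=> Nx; rewrite /dfil /induced; case: q => [|q] /=; tauto. Qed.

Section Family.
Variables (z : nat) (c : 'I_z -> nat) (v : 'I_z -> 'rV[A]_r).
Hypothesis hv : forall i, N (v i).

Definition gen_on (J : {set 'I_z}) := forall q x, N x -> FL b q x ->
  exists h, FL c q h /\ x = comb v (mask J h).

Lemma std_gen_on : std_family b N c v -> gen_on setT.
Proof. by case=> _ _ h q x Nx /(h q x Nx) [k [? ->]]; exists k; rewrite mask_setT.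
  Qed.

Lemma gen_on_F_basis (J : {set 'I_z}) : (forall i, i \in J -> v i <> 0) ->
  (forall i, FL b (c i) (v i)) -> gen_on J -> F_basis_on a w FN J v.
Proof.
move=> v0 hc g; apply/F_basis_onE; split=> //; exists c => q x; split.
  by case=> Nx /(g _ _ Nx) [h [? ->]]; exists h; rewrite -comb_mask.
move=> [h [hh ->]]; rewrite -comb_mask; split; first exact: submod_comb.
by apply: FL_comb (FL_mask _ hh).
Qed.

(** The degrees in an F-basis may be chosen larger than necessary, but never
    smaller than those of its elements. *)
Lemma F_basis_gen_on (J : {set 'I_z}) : (forall i, dfil (FL b) (v i) (c i)) ->
  F_basis_on a w FN J v -> gen_on J.
Proof.
move=> hd /F_basis_onE [_ [nu hnu]] q x Nx hx.
have [h [/FLE hh e]] := (hnu q x).1 (conj Nx hx).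
exists (mask J h); split; last first.
  by rewrite e -comb_mask; congr comb; apply/rowP => i; rewrite !mxE; case: ifP.
apply/FLE => -[m i]; rewrite /coefv mxE /=; case: ifP;
  last by rewrite raddf0 mcoeff0 eqxx.
move=> iJ /(hh (m, i)) /=; suff : (c i <= nu i)%N by lia.
have [_ _] := (dfilE _ _ _).1 (hd i); apply.
have : FN (nu i) (v i); last by case.
apply/hnu; exists (ebasis i); split; first exact: FL_ebasis.
rewrite (bigD1 i) //= ebasisE eqxx scale1r big1 ?addr0 // => j /andP [_ /negPf ne].
by rewrite ebasisE ne scale0r.
Qed.

Lemma gr_act_symbol (g : nat -> A) q d (x : 'rV[A]_r) :
  gr_act g (symbol d x) q = if (d <= q)%N then g (q - d)%N *: x else 0.
Proof.
rewrite /gr_act /symbol; case: leqP => l.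
  have hq : (q - d < q.+1)%N by lia.
  rewrite (bigD1 (Ordinal hq)) //= subKn // eqxx big1 ?addr0 // => p.
  rewrite -val_eqE /= => ne; case: eqP => [e|_]; last by rewrite scaler0.
  by case/eqP: ne; have := ltn_ord p; lia.
by apply: big1 => p _; case: eqP => [e|_]; [lia|rewrite scaler0].
Qed.

(** The coefficient of the [i]-th symbol in degree [p] is read off from an
    expression of the component of degree [p + c i]. *)
Lemma gen_on_gr (J : {set 'I_z}) : (forall i, dfil (FL b) (v i) (c i)) ->
  gen_on J -> gr_generates a w FN J (fun i => symbol (c i) (v i)).
Proof.
move=> hd g y [hy [B hB]].
have [h hh] : exists h : nat -> 'rV[A]_z, forall q,
    [/\ FL c q (h q), y q = comb v (mask J (h q)) & y q = 0 -> h q = 0].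
  apply: (fun_choice (fun q h => [/\ FL c q h, y q = comb v (mask J h) & y q = 0 -> h
    = 0])).
  move=> q; have [e|ne] := eqVneq (y q) 0.
    exists 0; split=> //; first exact: FL0.
    rewrite e comb_mask big1 // => i _; by rewrite mxE scale0r.
  have [Ny Fy] := hy q; have [h [h1 h2]] := g q _ Ny Fy.
  by exists h; split=> // e; rewrite e eqxx in ne.
exists (fun i p => h (p + c i)%N 0 i) => [i|q].
  split=> [p|].
    have [h1 _ _] := hh (p + c i)%N; apply/FAE => m hm.
    by move/FLE: h1 => /(_ (m, i) hm) /=; lia.
  exists B => q l; have [_ _ ->] := hh (q + c i)%N; first by rewrite mxE.
  by apply: hB; lia.
rewrite (_ : y q - _ = 0); first by case: (q) => [|p] //=; split;
  [exact: submod0|exact: FL0].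
have [h1 e _] := hh q; rewrite e comb_mask -sumrB big1 // => i _.
rewrite gr_act_symbol; case: leqP => l; first by rewrite subnK ?subrr.
by rewrite (FL_low h1 l) scale0r subrr.
Qed.

(** Lifting an expression of the symbol of [x] and subtracting it from [x]
    lowers the degree. *)
Lemma gr_gen_on (J : {set 'I_z}) : (forall i, dfil (FL b) (v i) (c i)) ->
  gr_generates a w FN J (fun i => symbol (c i) (v i)) -> gen_on J.
Proof.
move=> hd g; elim/ltn_ind => q IH x Nx hx.
have [|h hh e] := g (fun p => if p == q then x else 0).
  split=> [p|]; last by exists q.+1 => p l; rewrite gtn_eqF.
  by case: eqP => [->|_]; split=> //; [exact: submod0|exact: FL0].
pose k : 'rV[A]_z := \row_i (if (c i <= q)%N then h i (q - c i)%N else 0).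
have hk : FL c q k.
  apply/FLE => -[m i]; rewrite /coefv mxE /=; case: leqP => l;
    last by rewrite raddf0 mcoeff0 eqxx.
  by have [/(_ (q - c i)%N) /FAE h1 _] := hh i => /h1; lia.
have {e} := e q; rewrite eqxx (eq_bigr (fun i => k 0 i *: v i)); last first.
  by move=> i _; rewrite gr_act_symbol mxE; case: ifP => // _; rewrite scale0r.
rewrite -comb_mask => e; have [-> |[l [hl el]]] : x = comb v (mask J k) \/
    exists l, FL c q l /\ x - comb v (mask J k) = comb v (mask J l).
- case: (q) e IH hk => [|p] /= e IH hk.
    by left; apply/eqP; rewrite -subr_eq0 e.
  right; case: e => Ne Fe; have [l [hl el]] := IH p (ltnSn p) _ Ne Fe.
  by exists l; split=> //; apply: FL_mono hl.
- by exists k.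
exists (k + l); split; first exact: FLD.
have -> : mask J (k + l) = mask J k + mask J l.
  by apply/rowP => i; rewrite !mxE; case: ifP; rewrite ?addr0.
by rewrite linearD /= -el addrC subrK.
Qed.

End Family.

Lemma minimal_symbols_std t (W : 'I_t -> 'rV[A]_r) :
    minimal_symbol_generators a w FN W -> (forall i, N (W i)) ->
  exists q, [/\ forall i, dfil (FL b) (W i) (q i), std_family b N q W
    & forall J : {set 'I_t}, J \proper setT -> ~ gen_on q W J].
Proof.
move=> [q [hd hg hm]] hW; have hd' i : dfil (FL b) (W i) (q i) by apply/dfil_induced.
exists q; split=> //; last by move=> J /hm no /(gen_on_gr hd').
split=> // [k|p x Nx hx]; first by case/dfilE: (hd' k).
have [h [h1 h2]] := gr_gen_on hd' hg Nx hx; exists h; split=> //.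
by rewrite mask_setT in h2.
Qed.

(** Generating the associated graded module and being an F-basis are the same
    condition on any subfamily, so minimality is the same as well. *)
Lemma minimal_symbols_basis t (W : 'I_t -> 'rV[A]_r) :
    minimal_symbol_generators a w FN W -> (forall i, N (W i)) ->
  minimal_standard_basis a w (FL b) N W.
Proof.
move=> hW NW; have [q [hd hs hm]] := minimal_symbols_std hW NW.
have hq i : FL b (q i) (W i) by case/dfilE: (hd i).
split=> //; split; last first.
  by move=> J /hm no /(F_basis_gen_on hd).
apply: (@gen_on_F_basis _ q) => // [i _|]; last exact: std_gen_on.
by case/dfilE: (hd i) => /eqP.
Qed.

(** In degree [c i] the [i]-th entry is a scalar.  For a graded module over the
    associated graded algebra this condition says that the relations lie in the
    product of the irrelevant ideal with the free module. *)
Definition no_unit_entry p (c : 'I_p -> nat) (S : 'rV[A]_p -> Prop) :=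
  forall x i, S x -> FL c (c i) x -> x 0 i = 0.

(** A syzygy with a nonzero scalar entry in the degree of a generator expresses
    that generator through the others without raising degrees. *)
Lemma minimal_no_unit_entry t (W : 'I_t -> 'rV[A]_r) q : std_family b N q W ->
    (forall J : {set 'I_t}, J \proper setT -> ~ gen_on q W J) ->
  no_unit_entry q (Syz W).
Proof.
move=> [NW hW hs] hm y i Sy hy; apply/eqP; apply/negP => /negP nz.
set k := coefv y (0%MM, i); have yi := FL_unit hy; have k0 : k != 0.
  by apply: contraNneq nz => e; rewrite yi -/k e scale0r.
apply: (hm (setT :\ i)).
  by rewrite properT; apply/eqP => /setP /(_ i); rewrite !inE eqxx.
move=> p x Nx /(hs p x Nx) [h [hh ->]].
exists (h - h 0 i *: (k^-1%:A *: y)); split.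
  by apply: FLB => //; apply: FL_coef_scale hh _; exact: FL_scalec.
rewrite (_ : mask _ _ = h - h 0 i *: (k^-1%:A *: y)).
  have ey : comb W y = 0 by exact: Sy.
  by rewrite linearB /= !scalerA linearZ /= ey scaler0 subr0.
apply/rowP => j; rewrite [LHS]mxE !inE andbT; case: eqVneq => //= ->.
by rewrite !mxE yi -/k -scalerAl mul1r scalerA mulVf // scale1r mulr1 subrr.
Qed.

End Induced.

(** * Length of minimal resolutions *)

(** [N] has a strict filtered free resolution by at most [k] modules. *)
Fixpoint res_length_le k : forall r, ('I_r -> nat) -> ('rV[A]_r -> Prop) -> Prop :=
  if k is k'.+1 then fun r b N => exists z (c : 'I_z -> nat) (G : 'I_z -> 'rV[A]_r),
    std_family b N c G /\ res_length_le k' c (Syz G)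
  else fun r b N => forall x, N x -> x = 0.

Lemma comb_sub2 p q (F G H : 'I_p -> 'rV[A]_q) x :
  comb (fun k => F k - G k - H k) x = comb F x - comb G x - comb H x.
Proof. by rewrite /comb -!sumrB; apply: eq_bigr => k _; rewrite !scalerBr. Qed.

Lemma comb_basis p (x : 'rV[A]_p) : comb (fun k => ebasis k) x = x.
Proof. by rewrite {2}[x]row_ebasis. Qed.

Lemma eq_comb p q (F G : 'I_p -> 'rV[A]_q) x : F =1 G -> comb F x = comb G x.
Proof. by move=> e; apply: eq_bigr => k _; rewrite e. Qed.

(** Filtered free modules are projective with respect to strict maps. *)
Lemma std_lift r (b : 'I_r -> nat) N z (c : 'I_z -> nat) (G : 'I_z -> 'rV[A]_r)
    p (d : 'I_p -> nat) (F : 'I_p -> 'rV[A]_r) :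
    std_family b N c G -> (forall k, N (F k)) -> (forall k, FL a w b (d k) (F k)) ->
  exists H : 'I_p -> 'rV[A]_z, (forall k, FL a w c (d k) (H k)) /\
    forall k, F k = comb G (H k).
Proof.
move=> [_ _ hG] NF dF.
have [H hH] := fun_choice (fun k h => FL a w c (d k) h /\ F k = comb G h)
  (fun k => hG _ _ (NF k) (dF k)).
by exists H; split=> k; case: (hH k).
Qed.

(** The comparison argument.  [F] and [G] are one component of filtered chain
    maps between the minimal resolution and another one, and [t] is the part
    s d of a homotopy from the identity to their composite.  When the other
    resolution ends, the minimal one must end too: otherwise the homotopy
    relation would produce a syzygy with entry 1 at a generator. *)
Lemma minimal_length (rr : nat -> nat) (bb : forall i, 'I_(rr i) -> nat)
    (KK : forall i, 'rV[A]_(rr i) -> Prop)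
    (W : forall i, 'I_(rr i.+1) -> 'rV[A]_(rr i)) :
    (forall i, is_submod (@KK i)) ->
    (forall i, std_family (@bb i) (@KK i) (@bb i.+1) (@W i)) ->
    (forall i x, KK i.+1 x <-> Syz (@W i) x) ->
    (forall i, no_unit_entry (@bb i) (@KK i)) ->
  forall k i q (c : 'I_q -> nat) (KQ : 'rV[A]_q -> Prop)
    (F : 'I_(rr i) -> 'rV[A]_q) (G : 'I_q -> 'rV[A]_(rr i))
    (t : 'I_(rr i) -> 'rV[A]_(rr i)),
    (forall j, FL a w c (bb i j) (F j)) ->
    (forall j, FL a w (@bb i) (c j) (G j)) ->
    (forall j, FL a w (@bb i) (bb i j) (t j)) ->
    (forall x, KK i x -> KQ (comb F x)) ->
    (forall y, KQ y -> KK i (comb G y)) ->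
    (forall x, KK i x -> comb t x = 0) ->
    (forall j, KK i (comb G (F j) - ebasis j - t j)) ->
    res_length_le k c KQ ->
  rr (i + k).+1 = 0%N.
Proof.
move=> sub hstd hK hnu; elim=> [|k IH] i q c KQ F G t dF dG dt H1 H2 H3 H4 pd.
  rewrite addn0; case e : (rr i.+1) => [//|p]; exfalso.
  have j : 'I_(rr i.+1) by rewrite e; exact: ord0.
  have dH j' : FL a w (@bb i) (bb i j') (comb G (F j') - ebasis j' - t j').
    by apply: FLB => //; apply: FLB; [exact: FL_comb dG (dF j')|exact: FL_ebasis].
  have [s [ds hs]] := std_lift (hstd i) H4 dH.
  have [NW dW _] := hstd i.
  (* The homotopy relation at a generator one step beyond the end of the other
     resolution, where the composite of the chain maps is 0. *)
  pose y := ebasis j + comb s (W i j).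
  have Ky : KK i.+1 y.
    apply/hK; rewrite /Syz -/(comb (W i) y) /y linearD /= comb_ebasis comb_comp.
    rewrite -(eq_comb _ hs) comb_sub2 comb_basis H3 // -comb_comp.
    rewrite (pd (comb F (W i j)) (H1 _ (NW j))) linear0 subr0 sub0r subrr //.
  have dy : FL a w (@bb i.+1) (bb i.+1 j) y.
    by apply: FLD; [exact: FL_ebasis|exact: FL_comb ds (dW j)].
  have := hnu i.+1 y j Ky dy; rewrite /y mxE ebasisE eqxx /comb summxE big1.
    by move/eqP; rewrite addr0 oner_eq0.
  move=> l _; rewrite mxE; have [-> |nl] := eqVneq (W i j 0 l) 0;
    first by rewrite mul0r.
  have [->|ns] := eqVneq (s l 0 j) 0; first by rewrite mulr0.
  have [l1 _] := FL_coef (dW j) nl; have [l2 _] := FL_coef (ds l) ns.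
  (* A nonzero contribution to the entry of s d e_j at j would force equal
     degrees, and then d e_j would have a unit entry. *)
  have el : bb i.+1 j = bb i l by apply/eqP; rewrite eqn_leq l1 l2.
  have dl := dW j; rewrite el in dl; by rewrite (hnu i _ l (NW j) dl) mul0r.
have [z [c' [G' [hG' pd']]]] := pd; have [NG' dG' _] := hG'.
have [NW dW _] := hstd i.
have [F' [dF' hF']] := std_lift hG' (fun j => H1 _ (NW j)) (fun j =>
  FL_comb dF (dW j)).
have [G2 [dG2 hG2]] := std_lift (hstd i) (fun j => H2 _ (NG' j)) (fun j =>
  FL_comb dG (dG' j)).
have dH j : FL a w (@bb i) (bb i j) (comb G (F j) - ebasis j - t j).
  by apply: FLB => //; apply: FLB; [exact: FL_comb dG (dF j)|exact: FL_ebasis].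
have [s [ds hs]] := std_lift (hstd i) H4 dH.
rewrite addnS -addSn; apply: (IH i.+1 z c' (Syz G') F' G2 (fun j =>
  comb s (W i j))) => //.
- by move=> j; exact: FL_comb ds (dW j).
- move=> x /hK Sx; rewrite /Syz -/(comb G' (comb F' x)) comb_comp -(eq_comb _ hF')
    -comb_comp.
  by rewrite (_ : comb (W i) x = 0) ?linear0.
- move=> y Sy; apply/hK; rewrite /Syz -/(comb (W i) _) comb_comp -(eq_comb _ hG2)
    -comb_comp.
  by rewrite (_ : comb G' y = 0) ?linear0.
- by move=> x /hK Sx; rewrite -comb_comp (_ : comb (W i) x = 0) ?linear0.
- move=> j; apply/hK; rewrite /Syz -/(comb (W i) _) !linearB /= comb_ebasis
    !comb_comp.
  rewrite -(eq_comb _ hG2) -comb_comp -hF' -(eq_comb _ hs) comb_sub2 comb_basis H3 //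
    subr0.
  by rewrite comb_comp subrr.
Qed.

(** * A resolution of length at most n *)

(** Without variables all coefficients are scalars, so among the nonzero entries
    one of largest degree would be a unit entry. *)
Lemma no_unit_entry_n0 r (b : 'I_r -> nat) N x :
  n = 0%N -> no_unit_entry b N -> N x -> x = 0.
Proof.
move=> n0 hu Nx; apply/rowP => i; rewrite mxE; apply/eqP; apply/negP => /negP nz.
have [j hj hm] : exists2 j, x 0 j != 0 & forall l, x 0 l != 0 -> (b l <= b j)%N.
  by case: (@arg_maxnP _ i (fun l => x 0 l != 0) b nz) => j hj hm; exists j.
move/eqP: hj; apply; apply: (hu x j Nx); apply/FLE => -[m l] /=.
have -> : m = 0%MM by apply/mnmP => k; have := ltn_ord k; lia.
rewrite /Defs.wdeg big1 ?add0n; last by move=> k; rewrite mnm0E muln0.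
move=> h; apply: hm; apply: contraNneq h; by move/row_neq0 => ->.
Qed.

Section MinimalGB.
Variables (r : nat) (lt : rel ('X_{1..n} * 'I_r)) (N : 'rV[A]_r -> Prop).

(** Generators whose leading monomial is divisible by another one can be
    dropped. *)
Lemma Groebner_irredundant z (G : 'I_z -> 'rV[A]_r) T : Groebner_family lt N G T ->
  exists z' (f : 'I_z' -> 'I_z), Groebner_family lt N (G \o f) (T \o f) /\
    forall k l, mdvd (T (f k)) (T (f l)) -> k = l.
Proof.
pose ok (J : {set 'I_z}) := [forall k, [exists l in J, mdvd (T l) (T k)]].
have dvd_refl t : @mdvd n r t t by rewrite /mdvd eqxx lepm_refl.
have dvd_trans t u v : mdvd t u -> mdvd u v -> @mdvd n r t v.
  by move=> /mdvdP [g ->] /mdvdP [h ->]; apply/mdvdP; exists (h + g)%MM;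
    rewrite mshiftA.
have ok0 : ok setT by apply/forallP => k; apply/existsP; exists k;
  rewrite inE dvd_refl.
case: (arg_minnP (fun J : {set 'I_z} => #|J|) ok0) => J okJ hm [gN gT gG].
exists #|J|, enum_val; split.
  split=> [k|k|x u Nx hu] /=; [exact: gN|exact: gT|].
  have [k hk] := gG x u Nx hu; have /existsP [l /andP [lJ hl]] := forallP okJ k.
  by exists (enum_rank_in lJ l); rewrite /= enum_rankK_in //; exact: dvd_trans hk.
move=> k l h; apply/eqP; apply/negP => /negP ne.
have : ok (J :\ enum_val l).
  apply/forallP => i; have /existsP [j /andP [jJ hj]] := forallP okJ i.
  apply/existsP; have [e|nj] := eqVneq j (enum_val l); last by exists j;
    rewrite !inE nj jJ hj.
  exists (enum_val k); rewrite !inE (inj_eq enum_val_inj) ne enum_valP /=.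
  by apply: dvd_trans h _; rewrite -e.
move/hm; rewrite [X in (X <= _)%N](cardsD1 (enum_val l)) enum_valP; lia.
Qed.

End MinimalGB.

(** * S-polynomials *)

Lemma is_LM_scalar k m : k != 0 -> is_LM a prec (k *: mon m) m.
Proof.
move=> k0; have [m0 hm] := (is_LM_mon _ _).1 (is_LM_1mon m); apply/is_LM_mon.
split=> [|p]; rewrite coefsZ mcoeffZ mulf_eq0 negb_or ?k0 //= ; exact: hm.
Qed.

Section SPolynomials.
Variables (r : nat) (lt : rel ('X_{1..n} * 'I_r)).
Hypothesis hlt : left_monomial_ordering a prec lt.
Variables (f g : 'rV[A]_r) (s t : 'X_{1..n} * 'I_r).
Hypotheses (hf : is_LML a lt f s) (hg : is_LML a lt g t).

Let mu := mlcm s.1 t.1.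

Lemma lcm_l : mshift (mu - s.1)%MM s = (mu, s.2).
Proof. by rewrite /mshift submK ?lem_mlcml. Qed.
Lemma lcm_r : mshift (mu - t.1)%MM t = (mu, t.2).
Proof. by rewrite /mshift submK ?lem_mlcmr. Qed.

Lemma is_LC_mon h m x k : is_LML a lt x h -> is_LC a lt (mon m *: x) k ->
  k = coefv (mon m *: x) (mshift m h) /\ k != 0.
Proof.
move=> hx [u hu /coefLE <-]; have hm := is_LML_scale hlt (is_LM_1mon m) hx.
by rewrite (lead_uniq hlt hu hm); split=> //; case/is_LMLE: hm.
Qed.

Lemma S_multipliersP u v : S_multipliers a lt f g u v ->
  [/\ s.2 = t.2, is_LM a prec u (mu - s.1)%MM, is_LM a prec v (mu - t.1)%MM,
      LM_bound lt (u *: f - v *: g) (mu, s.2) & coefv (u *: f - v *: g) (mu, s.2) =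
        0].
Proof.
case=> al [be [i [k [l [[h1 h2] hk hl eu ev']]]]].
have es := lead_uniq hlt hf h1; have et := lead_uniq hlt hg h2.
have e1 : s.1 = al by rewrite es. have e2 : t.1 = be by rewrite et.
have st : s.2 = t.2 by rewrite es et.
rewrite -e1 -e2 -/mu in hk hl eu ev'.
have [ek k0] := is_LC_mon hf hk; have [el l0] := is_LC_mon hg hl.
have hu : is_LM a prec u (mu - s.1)%MM by rewrite eu; apply: is_LM_scalar;
  rewrite invr_eq0.
have hv : is_LM a prec v (mu - t.1)%MM by rewrite ev'; apply: is_LM_scalar;
  rewrite invr_eq0.
split=> //.
  apply: LM_boundD; last apply: LM_boundN.
    by have := is_LML_scale hlt hu hf; rewrite lcm_l => /is_LMLE [].
  by have := is_LML_scale hlt hv hg; rewrite lcm_r -st => /is_LMLE [].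
rewrite coefvB eu ev' !coefvZ -lcm_l -ek mulVf // lcm_l st -lcm_r -el mulVf //.
by rewrite subrr.
Qed.

Lemma S_multipliers_ex : s.2 = t.2 -> exists u v, S_multipliers a lt f g u v.
Proof.
move=> st; have hu := is_LML_scale hlt (is_LM_1mon (mu - s.1)%MM) hf.
have hv := is_LML_scale hlt (is_LM_1mon (mu - t.1)%MM) hg.
pose k := coefv (mon (mu - s.1)%MM *: f) (mshift (mu - s.1)%MM s).
pose l := coefv (mon (mu - t.1)%MM *: g) (mshift (mu - t.1)%MM t).
exists (k^-1 *: mon (mu - s.1)%MM), (l^-1 *: mon (mu - t.1)%MM), s.1, t.1, s.2, k, l.
split=> //.
- by split; [rewrite -surjective_pairing|rewrite st -surjective_pairing].
- by exists (mshift (mu - s.1)%MM s) => //; apply/coefLE.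
- by exists (mshift (mu - t.1)%MM t) => //; apply/coefLE.
Qed.

End SPolynomials.

Lemma spair_syzygy r (lt : rel ('X_{1..n} * 'I_r)) N z (G : 'I_z -> 'rV[A]_r) T
    (tie : rel 'I_z) k l :
    left_monomial_ordering a prec lt -> is_submod N -> Groebner_family lt N G T ->
    strict_total_order tie -> tie l k -> (T l).2 = (T k).2 ->
  exists s, Syz G s /\
    is_LML a (schreyer_lt lt T tie) s ((mlcm (T k).1 (T l).1 - (T k).1)%MM, k).
Proof.
move=> hlt hN gb htie tlk ekl; have [gN gT _] := gb.
have [u [v huv]] := S_multipliers_ex hlt (gT k) (gT l) (esym ekl).
have [_ hu hv Sb S0] := S_multipliersP hlt (gT k) (gT l) huv.
have [|h [e hh]] := Groebner_rep (x := u *: G k - v *: G l) hlt hN gb.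
  by apply: submodB => //; apply: submodZ.
exists (u *: ebasis k - v *: ebasis l - h); split.
  by rewrite /Syz -/(comb G _) !combB !combZ !comb_ebasis -e subrr.
apply: (spair_lead hlt htie tlk _ hu) => //.
- by rewrite lcm_l -ekl -lcm_r.
- by case/is_LM_mon: hv.
- by rewrite lcm_l; exact: (supp_small hlt gT hh Sb S0).
Qed.

(** Hilbert's syzygy theorem after Schreyer: if the generator with the larger
    exponent of the variable [j] wins the ties, the leading monomial
    lcm / LM of the syzygy of an S-pair does not involve that variable.  When a
    single variable is left, two leading monomials in the same component divide
    one another, so an irredundant Groebner basis has no syzygies at all. *)
Lemma Groebner_res_length k : forall j r (b : 'I_r -> nat) lt N
    z (G : 'I_z -> 'rV[A]_r) T,
    (j + k.+1)%N = n -> graded_left_monomial_ordering a prec w b lt ->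
    is_submod N -> Groebner_family lt N G T ->
    (forall l (i : 'I_n), (i < j)%N -> (T l).1 i = 0%N) ->
  res_length_le k.+1 b N.
Proof.
elim: k => [|k IH] j r b lt N z G T ej hlt hN gb hT.
  have [z' [f [gb' irr]]] := Groebner_irredundant gb.
  exists z', (fun k => degL b (T (f k))), (G \o f); split.
    exact: (Groebner_std hN hlt gb').
  move=> h Sh; have [_ gT _] := gb'.
  pose tie : rel 'I_z' := fun l k => (l < k)%N.
  have htie : strict_total_order tie.
    split=> [l|l k m|l k]; rewrite /tie ?ltnn //; first exact: ltn_trans.
    by rewrite -val_eqE neq_ltn.
  apply/eqP; apply/negP => /negP /(lead_ex (schreyer_lt_lmo hlt.1 (T \o f) htie)) [t
    ht].
  have [|l [m [tl em]]] := schreyer_top hlt.1 gT htie ht.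
    by rewrite (_ : comb _ h = 0) ?coefv0.
  have ec := congr1 snd em; rewrite /= in ec.
  have ij : (j < n)%N by rewrite -ej addn1.
  have key p q : (T (f p)).2 = (T (f q)).2 ->
      ((T (f p)).1 (Ordinal ij) <= (T (f q)).1 (Ordinal ij))%N -> p = q.
    move=> e l2; apply: irr; rewrite /mdvd e eqxx /=; apply/mnm_lepP => i.
    have [li|li|/val_inj ei] := ltngtP i (Ordinal ij); first by rewrite hT.
      by have := ltn_ord i; rewrite /= in li; lia.
    by rewrite ei.
  have := leq_total ((T (f l)).1 (Ordinal ij)) ((T (f t.2)).1 (Ordinal ij)).
  have e : l <> t.2 by move=> e; rewrite e /tie ltnn in tl.
  by case/orP => [/(key _ _ ec) //|/(key _ _ (esym ec)) /esym].
have ij : (j < n)%N by rewrite -ej; lia.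
pose jn := Ordinal ij; pose ex l := (T l).1 jn.
pose tie : rel 'I_z := fun l k => (ex l < ex k)%N || (ex l == ex k) && (l < k)%N.
have htie : strict_total_order tie.
  split=> [l|l k' m|l k']; rewrite /tie; first by rewrite !ltnn andbF.
    by move=> h1 h2; lia.
  by rewrite -val_eqE /=; lia.
pose P := [pred p : 'I_z * 'I_z | tie p.2 p.1 && ((T p.2).2 == (T p.1).2)].
pose TZ p := ((mlcm (T p.1).1 (T p.2).1 - (T p.1).1)%MM, p.1) : 'X_{1..n} * 'I_z.
have [Z hZ] : exists Z : 'I_z * 'I_z -> 'rV[A]_z, forall p, P p ->
    Syz G (Z p) /\ is_LML a (schreyer_lt lt T tie) (Z p) (TZ p).
  apply: (fun_choice (fun p s => P p -> Syz G s /\ is_LML a (schreyer_lt lt T tie) s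
    (TZ p))) => p.
  case: (boolP (P p)) => [/andP [h1 /eqP h2]|_]; last by exists 0.
  by have [s hs] := spair_syzygy hlt.1 hN gb htie h1 h2; exists s.
have [_ gT _] := gb.
have gbZ : Groebner_family (schreyer_lt lt T tie) (Syz G) (fun i : 'I_#|P| =>
  Z (enum_val i)) (fun i => TZ (enum_val i)).
  apply: (schreyer_Groebner hlt.1 gT htie).
  - by move=> i; have [] := hZ _ (enum_valP i).
  - by move=> i; have [] := hZ _ (enum_valP i).
  move=> l m h1 h2; have hP : (l, m) \in P by rewrite inE /= h1 h2 eqxx.
  exists (enum_rank_in hP (l, m)); rewrite enum_rankK_in //.
  by rewrite /mdvd eqxx lepm_refl.
exists z, (fun k => degL b (T k)), G; split; first exact: (Groebner_std hN hlt gb).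
apply: (IH j.+1 _ _ (schreyer_lt lt T tie) _ _ _ _ _ _ (Syz_submod G) gbZ);
  first by lia.
  split; first exact: (schreyer_lt_lmo hlt.1 T htie).
  move=> s t st; have /(leL_schreyer_mon (lt := lt)) /(glmo_le hlt)
    : leL (schreyer_lt lt T tie) s t.
    by rewrite /leL st orbT.
  by rewrite /degL /schreyer_mon /= !wdegD; lia.
move=> p i li; have := enum_valP p; case: (enum_val p) => l m /andP [].
rewrite /tie /ex /= => tml _; rewrite mnmBE mnmE.
move: li; rewrite ltnS leq_eqVlt => /orP [/eqP ei|li]; last by rewrite !hT.
have -> : i = jn by apply: val_inj.
by lia.
Qed.

Lemma res_length_le_n r (b : 'I_r -> nat) lt N z (G : 'I_z -> 'rV[A]_r) T :
    graded_left_monomial_ordering a prec w b lt -> is_submod N ->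
    Groebner_family lt N G T -> no_unit_entry b N ->
  res_length_le n b N.
Proof.
move=> hlt hN gb hu; case: (posnP n) => [n0|n_gt0].
  suff : res_length_le 0 b N by rewrite -{1}n0.
  by move=> x; exact: (no_unit_entry_n0 n0 hu).
have h := @Groebner_res_length n.-1 0 r b lt N z G T;
  rewrite (prednK n_gt0) add0n in h.
by apply: h => // l i.
Qed.

(** * Buchberger's algorithm *)

Lemma famE (T : Type) (x0 : T) (s : seq T) (i : 'I_(size s)) : fam s i = nth x0 s i.
Proof. exact: (tnth_nth x0 (in_tuple s)). Qed.

Lemma fam_mem (T : eqType) (s : seq T) (i : 'I_(size s)) : fam s i \in s.
Proof. exact: mem_tnth. Qed.

Lemma mem_fam (T : eqType) (s : seq T) x : x \in s -> exists i, x = fam s i.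
Proof. by move=> /(tnthP (in_tuple s)) [i ->]; exists i. Qed.

Lemma span_min r (N : 'rV[A]_r -> Prop) (s : seq 'rV[A]_r) x : is_submod N ->
  (forall g, g \in s -> N g) -> span (fam s) x -> N x.
Proof.
move=> hN hs /span_comb [h ->]; apply: submod_comb => // k; exact/hs/fam_mem.
Qed.

Lemma mem_span r (s : seq 'rV[A]_r) g : g \in s -> span (fam s) g.
Proof. by move=> /mem_fam [i ->]; exact: span_gen. Qed.

Lemma span_sub r (s s' : seq 'rV[A]_r) x : {subset s <= s'} ->
  span (fam s) x -> span (fam s') x.
Proof.
move=> h; apply: span_min; first exact: span_submod.
by move=> g /h; exact: mem_span.
Qed.

Lemma halts_output (T : Type) (step : T -> T -> Prop) x : halts step x ->
  exists y, output step x y.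
Proof.
elim=> {}x _ IH; case: (classic (exists y, step x y)) => [[y sxy]|no].
  have [z [h1 h2]] := IH y sxy; exists z; split=> //.
  by apply: rt_trans h1; exact: rt_step.
by exists x; split=> [|z sxz]; [exact: rt_refl|apply: no; exists z].
Qed.

Lemma output_inv (T : Type) (step : T -> T -> Prop) (P : T -> Prop) x y :
  (forall u v, P u -> step u v -> P v) -> P x -> output step x y -> P y.
Proof.
move=> hP Px [/clos_rt_rt1n_iff c _]; elim: c Px => // u v z /hP h _ IH Pu.
exact/IH/h.
Qed.

Lemma Groebner_seq_family r (lt : rel ('X_{1..n} * 'I_r)) N G :
    left_monomial_ordering a prec lt -> left_Groebner_basis a lt N G ->
  exists T, Groebner_family lt N (fam G) T.
Proof.
move=> hlt [h1 h2].
have [T hT] := fun_choice (fun k t => is_LML a lt (fam G k) t)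
  (fun k => lead_ex hlt (introN eqP (h1 _ (fam_mem k)).2)).
exists T; split=> [k||x u Nx hu] //; first by have [] := h1 _ (fam_mem k).
have x0 : x <> 0 by move=> e; case/is_LMLE: hu; rewrite e coefv0 eqxx.
have [g [m [t [u' [/mem_fam [k ->] ht hu' hm]]]]] := h2 x Nx x0.
exists k; rewrite (lead_uniq hlt hu hu') (lead_uniq hlt (hT k) ht).
by apply/mdvdP; exists m; exact: ((is_LML_monE hlt _ _ _).1 hm).
Qed.


Section Buchberger.
Variables (r : nat) (lt : rel ('X_{1..n} * 'I_r)).
Hypothesis hlt : left_monomial_ordering a prec lt.

Lemma left_division_ex (G : seq 'rV[A]_r) x : (forall g, g \in G -> g != 0) ->
  exists h rho, left_division a lt G x h rho.
Proof.
move=> G0; have [T hT] := fun_choice (fun k t => is_LML a lt (fam G k) t)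
  (fun k => lead_ex hlt (G0 _ (fam_mem k))).
have [h [rho [e h1 h2 h3]]] := division hlt hT x.
pose h' k := odflt 0 (omap (h 0) (insub k)).
have e' (k : 'I_(size G)) : h' k *: G`_k = h 0 k *: fam G k.
  by rewrite /h' valK (famE 0).
exists h', rho; split=> //.
- by rewrite e; congr (_ + _); apply: eq_bigr => k _.
- by move=> k hk; rewrite (e' (Ordinal hk)).
move=> t /occursLE /h3 no g u m /mem_fam [k ->] hu /(is_LML_monE hlt) et.
by have /negP := no k; apply; apply/mdvdP; exists m;
  rewrite (lead_uniq hlt (hT k) hu).
Qed.

(** * Termination *)

Definition lmopt (x : 'rV[A]_r) : option ('X_{1..n} * 'I_r) :=
  match excluded_middle_informative (exists t, is_LML a lt x t) with
  | left h => Some (sval (constructive_indefinite_description _ h))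
  | right _ => None
  end.

Lemma lmoptP x t : is_LML a lt x t <-> lmopt x = Some t.
Proof.
rewrite /lmopt; case: excluded_middle_informative => h; last first.
  by split=> // ht; case: h; exists t.
split=> [ht|[<-]]; last exact: svalP.
by congr Some; apply: (lead_uniq hlt) ht; exact: svalP.
Qed.

Variable t : nat.

(** A rule either adds an element whose leading monomial is not divisible by
    the earlier ones, which can happen only finitely often, or shortens the list
    of pairs. *)
Lemma bstep_halts (st : @bstate K A r t) : halts (@bstep K A n a r lt t) st.
Proof.
pose lms (st : @bstate K A r t) := pmap lmopt (unzip1 (bb_basis st)).
have [s es] : exists s, lms st = s by exists (lms st).
elim: {s}(Acc_rcons_mdvd s) st es => s _ IH st es;
  have [k] := ubnP (size (bb_pairs st)).
elim: k st es => [st _|k IHk st es hk]; first by rewrite ltn0.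
constructor => st' hst.
case: hst es hk => [G B1 i j B2 Z _|G B1 i j B2 Z u v h _ _|G B1 i j B2 Z u v h rho _
  hd rho0] es /=;
  rewrite ?size_cat /= => hk.
- by apply: IHk => //=; rewrite size_cat; lia.
- by apply: IHk => //=; rewrite size_cat; lia.
have [tr htr] := lead_ex hlt (introN eqP rho0).
have e : lms (BState (rcons G (rho, cofactor G i j u v h))
    (B1 ++ B2 ++ [seq (k, size G) | k <- iota 0 (size G)]) Z) = rcons s tr.
  by rewrite -es /lms /= /unzip1 map_rcons -cats1 pmap_cat /= ((lmoptP _ _).1 htr)
    cats1.
apply: (IH (rcons s tr)) e; exists tr => //; apply/hasPn => p;
  rewrite -es mem_pmap => /mapP [g hg eg].
apply/negP => /mdvdP [m em]; case: hd => _ _ _ hd.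
apply: (hd tr _ g p m hg); last exact/(is_LML_monE hlt).
  by apply/occursLE; case/is_LMLE: htr.
by apply/lmoptP.
Qed.

(** * Correctness *)

Variable W : 'I_t -> 'rV[A]_r.
Local Notation spoly G i j u v := (u *: (G`_i).1 - v *: (G`_j).1).

(** The last condition is what makes the recorded syzygies sufficient: the
    syzygy of the S-pair becomes a combination of them once the cofactors are
    substituted. *)
Definition treated (G : seq ('rV[A]_r * 'rV[A]_t)) (Z : seq 'rV[A]_t) i j :=
  (forall u v, ~ S_multipliers a lt (G`_i).1 (G`_j).1 u v) \/
  exists u v (h : nat -> A), [/\ S_multipliers a lt (G`_i).1 (G`_j).1 u v,
    spoly G i j u v = \sum_(k < size G) h k *: (G`_k).1,
    forall k, (k < size G)%N -> LM_le a lt (h k *: (G`_k).1) (spoly G i j u v)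
    & span (fam Z) (cofactor G i j u v h)].

Record buchberger_inv (st : @bstate K A r t) : Prop := BuchbergerInv {
  bi_basis : forall p, p \in bb_basis st -> p.1 != 0 /\ p.1 = comb W p.2;
  bi_start : forall k, W k != 0 -> (W k, ebasis k) \in bb_basis st;
  bi_pairs : forall i j, (i < j)%N -> (j < size (bb_basis st))%N ->
    (i, j) \in bb_pairs st \/ treated (bb_basis st) (bb_syz st) i j;
  bi_syz : forall s, s \in bb_syz st -> Syz W s
}.

Lemma treated_syz G Z Z' i j : {subset Z <= Z'} -> treated G Z i j -> treated G Z' i
  j.
Proof.
move=> hZ [h|[u [v [h [h1 h2 h3 h4]]]]]; [by left|right; exists u, v, h].
by split=> //; exact: span_sub h4.
Qed.

Lemma treated_rcons G Z i j p : (i < size G)%N -> (j < size G)%N ->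
  treated G Z i j -> treated (rcons G p) Z i j.
Proof.
move=> li lj; have e k : (k < size G)%N -> (rcons G p)`_k = G`_k by move=> l;
  rewrite nth_rcons l.
case=> [h|[u [v [h [h1 h2 h3 h4]]]]]; [by left; rewrite !e|right].
exists u, v, (fun k => if (k < size G)%N then h k else 0).
rewrite /cofactor !e // size_rcons !big_ord_recr /= !ltnn !scale0r !addr0; split=> //.
- by rewrite h2; apply: eq_bigr => k _; rewrite ltn_ord e.
- move=> k; rewrite ltnS leq_eqVlt => /orP [/eqP ->|l]; last by rewrite l e //;
    exact: h3.
  by rewrite ltnn scale0r => s /is_LMLE []; rewrite coefv0 eqxx.
by congr (span _ (_ - _)): h4; apply: eq_bigr => k _; rewrite ltn_ord e.
Qed.

Lemma buchberger_inv_start : buchberger_inv (bstart W).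
Proof.
split=> //=.
- by move=> p /mapP [k]; rewrite mem_filter => /andP [nz _] ->;
    rewrite /= comb_ebasis.
- by move=> k nz; apply/mapP; exists k => //; rewrite mem_filter nz mem_enum.
move=> i j lij lj; left; apply/allpairsPdep; exists j, i; split=> //.
  by rewrite mem_iota.
by rewrite mem_iota.
Qed.

Lemma nth_comb st i : buchberger_inv st ->
  ((bb_basis st)`_i).1 = comb W ((bb_basis st)`_i).2.
Proof.
move=> hi; have [l|l] := ltnP i (size (bb_basis st)).
  by have [] := bi_basis hi (mem_nth 0 l).
by rewrite nth_default //= linear0.
Qed.

Lemma cofactor_ev st i j u v h : buchberger_inv st ->
  comb W (cofactor (bb_basis st) i j u v h) = spoly (bb_basis st) i j u v -
    \sum_(k < size (bb_basis st)) h k *: ((bb_basis st)`_k).1.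
Proof.
move=> hi; rewrite /cofactor !combB !combZ -!nth_comb // comb_sum.
by congr (_ - _); apply: eq_bigr => k _; rewrite -nth_comb.
Qed.

Lemma buchberger_inv_step st st' : buchberger_inv st -> bstep a lt st st' ->
  buchberger_inv st'.
Proof.
move=> hi hst; case: hst hi => [G B1 i j B2 Z no|G B1 i j B2 Z u v h hS hd|
    G B1 i j B2 Z u v h rho hS hd rho0] hi; have [h1 h2 h3 h4] := hi; split=> //=.
- move=> k l lkl ll; have [/= | ? ] := h3 k l lkl ll; last by right.
  rewrite mem_cat in_cons => /orP [kl|/orP [/eqP [-> ->]|kl]].
  + by left; rewrite mem_cat kl.
  + by right; left.
  + by left; rewrite mem_cat kl orbT.
- have [ed hle _ _] := hd; rewrite addr0 size_map in ed hle.
  have nE k : (k < size G)%N -> (unzip1 G)`_k = (G`_k).1 by move=> l;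
    rewrite (nth_map 0).
  move=> k l lkl ll; have [/= | tr] := h3 k l lkl ll; last first.
    by right; apply: treated_syz tr => s hs; rewrite mem_rcons in_cons hs orbT.
  rewrite mem_cat in_cons => /orP [kl|/orP [/eqP [-> ->]|kl]].
  + by left; rewrite mem_cat kl.
  + right; right; exists u, v, h; split=> //.
    * by rewrite ed; apply: eq_bigr => p _; rewrite nE.
    * by move=> p lp; rewrite -nE //; exact: hle.
    * by apply: mem_span; rewrite mem_rcons in_cons eqxx.
  + by left; rewrite mem_cat kl orbT.
- have [ed hle _ _] := hd; rewrite addr0 size_map in ed.
  move=> s; rewrite mem_rcons in_cons => /orP [/eqP ->|/h4 //].
  rewrite /Syz -/(comb W _) (cofactor_ev _ _ _ _ _ hi) /= ed.
  by apply/eqP; rewrite subr_eq0; apply/eqP; apply: eq_bigr => k _;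
    rewrite (nth_map 0).
- have [ed hle _ _] := hd; rewrite size_map in ed.
  move=> p; rewrite mem_rcons in_cons => /orP [/eqP -> /=|/h1 //]; split;
    first exact/eqP.
  rewrite (cofactor_ev _ _ _ _ _ hi) /= ed addrAC.
  rewrite (_ : \sum_(k < size G) _ = \sum_(k < size G) h k *: (G`_k).1).
    by rewrite subrr add0r.
  by apply: eq_bigr => k _; rewrite (nth_map 0).
- by move=> k nz; rewrite mem_rcons in_cons h2 ?orbT.
- have [ed hle hr _] := hd; rewrite size_map in ed hle.
  have nE k : (k < size G)%N -> (unzip1 G)`_k = (G`_k).1 by move=> l;
    rewrite (nth_map 0).
  set p := (rho, _); move=> k l lkl; rewrite size_rcons ltnS leq_eqVlt =>
    /orP [/eqP el|ll].
    left; rewrite !mem_cat; apply/orP; right; apply/orP; right; apply/mapP; exists k.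
      by rewrite mem_iota -el.
    by rewrite el.
  have lk := ltn_trans lkl ll.
  have [/= | tr] := h3 k l lkl ll; last by right; exact: treated_rcons.
  rewrite mem_cat in_cons => /orP [kl|/orP [/eqP [ek el]|kl]].
  + by left; rewrite mem_cat kl.
  + right; rewrite -ek -el in hS *; right.
    have e q : (q < size G)%N -> (rcons G p)`_q = G`_q by move=> lq;
      rewrite nth_rcons lq.
    exists u, v, (fun q => if (q < size G)%N then h q else 1).
    rewrite /cofactor !e // size_rcons !big_ord_recr /= !ltnn !nth_rcons !ltnn !eqxx.
    rewrite !scale1r /p /=; split=> //.
    * by rewrite ek el ed; congr (_ + _); apply: eq_bigr => q _;
        rewrite ltn_ord e // nE.
    * move=> q; rewrite ltnS leq_eqVlt => /orP [/eqP ->|lq].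
        by rewrite ltnn nth_rcons ltnn eqxx scale1r ek el.
      by rewrite lq e // -nE // ek el; exact: hle.
    * rewrite (_ : _ - _ = 0); first exact: (submod0 (span_submod _)).
      rewrite /cofactor opprD addrA ek el; apply/eqP; rewrite subr_eq0; apply/eqP.
      by congr (_ - _); apply: eq_bigr => q _; rewrite ltn_ord e.
  + by left; rewrite !mem_cat kl orbT.
Qed.

Lemma bstep_progress st : buchberger_inv st -> bb_pairs st <> [::] -> exists st',
  bstep a lt st st'.
Proof.
case: st => G [|[i j] B] Z // hi _.
case: (classic (exists u v, S_multipliers a lt (G`_i).1 (G`_j).1 u v)) =>
  [[u [v hS]]|no].
  have [|h [rho hd]] := @left_division_ex (unzip1 G) (spoly G i j u v).
    by move=> g /mapP [p pG ->]; case: (bi_basis hi pG).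
  have [e|ne] := eqVneq rho 0.
    rewrite e in hd; eexists; exact: (@BStepZero _ _ _ _ _ _ _ G [::] _ _ B Z _ _ _
      hS hd).
  eexists; exact: (@BStepAdd _ _ _ _ _ _ _ G [::] _ _ B Z _ _ _ _ hS hd (elimN eqP
    ne)).
eexists; apply: (@BStepSkip _ _ _ _ _ _ _ G [::] i j B Z) => u v hS.
by apply: no; exists u, v.
Qed.

(** Once no pair is left, the syzygies of the S-pairs satisfy the criterion for
    the final basis and generate its syzygies.  Since the initial family is part
    of the final basis, substituting the cofactors maps the syzygies of the
    latter onto those of [W]. *)
Lemma bb_correct st : output (@bstep K A n a r lt t) (bstart W) st ->
  left_Groebner_basis a lt (span W) (unzip1 (bb_basis st)) /\
  ((forall k, W k != 0) -> generates_Syz W (bb_syz st)).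
Proof.
move=> ho; have hi : buchberger_inv st by apply: output_inv ho;
  [exact: buchberger_inv_step|exact: buchberger_inv_start].
have [_ fin] := ho; have p0 : bb_pairs st = [::].
  by apply: NNPP => ne; have [st' /fin] := bstep_progress hi ne.
case: st hi p0 {ho fin} => G B Z /= hi e; rewrite {B}e in hi.
have [h1 h2 h3 h4] := hi; rewrite /= in h1 h2 h3 h4.
pose Gf (k : 'I_(size G)) := (G`_k).1; pose C (k : 'I_(size G)) := (G`_k).2.
have GC k : Gf k = comb W (C k) by exact: (nth_comb k hi).
have Gnz k : Gf k != 0 by have [] := h1 _ (mem_nth 0 (ltn_ord k)).
have [T hT] := fun_choice (fun k t => is_LML a lt (Gf k) t) (fun k =>
  lead_ex hlt (Gnz k)).
pose tie : rel 'I_(size G) := fun l k => (k < l)%N.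
have htie : strict_total_order tie.
  split=> [l|l k m|l k]; rewrite /tie ?ltnn //; first by move=> l1 l2;
    exact: ltn_trans l1.
  by rewrite -val_eqE neq_ltn orbC.
pose P := [pred p : 'I_(size G) * 'I_(size G) | tie p.2 p.1 && ((T p.2).2 == (T
  p.1).2)].
pose TZ p := ((mlcm (T p.1).1 (T p.2).1 - (T p.1).1)%MM, p.1)
  : 'X_{1..n} * 'I_(size G).
have [S hS] : exists S : 'I_(size G) * 'I_(size G) -> 'rV[A]_(size G), forall p, P p
  ->
    [/\ Syz Gf (S p), is_LML a (schreyer_lt lt T tie) (S p) (TZ p) & span (fam Z)
      (comb C (S p))].
  apply: (fun_choice (fun p s => P p -> [/\ Syz Gf s,
    is_LML a (schreyer_lt lt T tie) s (TZ p) & span (fam Z) (comb C s)])) => -[k l].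
  case: (boolP (P (k, l))) => [/andP /= [tkl /eqP ekl]|_]; last by exists 0.
  have [//|[no|[u [v [h [hS e hle hsp]]]]]] := h3 k l tkl (ltn_ord l).
    by have [u [v /no]] := S_multipliers_ex hlt (hT k) (hT l) (esym ekl).
  pose hr : 'rV[A]_(size G) := \row_q h q.
  have [_ hu hv Sb S0] := S_multipliersP hlt (hT k) (hT l) hS.
  have er p (F : 'I_(size G) -> 'rV[A]_p) : comb F hr = \sum_(q < size G) h q *: F q.
    by apply: eq_bigr => q _; rewrite mxE.
  exists (u *: ebasis k - v *: ebasis l - hr) => _; split.
  - rewrite /Syz -/(comb Gf _) !combB !combZ !comb_ebasis er -/(Gf k) -/(Gf l).
    by rewrite [X in X - _]e subrr.
  - apply: (spair_lead hlt htie tkl _ hu).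
    + by rewrite lcm_l -ekl -lcm_r.
    + by case/is_LM_mon: hv.
    + rewrite lcm_l; apply: (supp_small hlt hT _ Sb S0) => q; rewrite mxE; exact: hle.
  - rewrite !combB !combZ !comb_ebasis er; exact: hsp.
pose Zs (i : 'I_#|P|) := S (enum_val i).
have hZ1 i : is_LML a (schreyer_lt lt T tie) (Zs i) (TZ (enum_val i)) by have [] :=
  hS _ (enum_valP i).
have hZ2 i : Syz Gf (Zs i) by have [] := hS _ (enum_valP i).
have crit k l : tie l k -> (T l).2 = (T k).2 ->
    exists j, mdvd (TZ (enum_val (j : 'I_#|P|))) ((mlcm (T k).1 (T l).1 - (T
      k).1)%MM, k).
  move=> c1 c2; have hP : (k, l) \in P by rewrite inE /= c1 c2 eqxx.
  by exists (enum_rank_in hP (k, l)); rewrite enum_rankK_in // /mdvd eqxx lepm_refl.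
have idx k : W k != 0 -> exists i, Gf i = W k /\ C i = ebasis k.
  move=> /h2 hk; have li : (index (W k, ebasis k) G < size G)%N by rewrite index_mem.
  by exists (Ordinal li); rewrite /Gf /C /= nth_index.
split.
  have [gN gT gG] := buchberger_criterion hlt hT htie hZ1 hZ2 crit.
  split=> [g /mapP [p pG ->]|x /span_comb [h ->] /eqP].
    have [nz e] := h1 p pG; split; [|exact/eqP].
    by rewrite e; apply/span_comb; exists p.2.
  move=> /(lead_ex hlt) [u hu].
  have hs : span Gf (comb W h).
    apply: submod_comb; first exact: span_submod.
    move=> k; have [->|/idx [i [<- _]]] := eqVneq (W k) 0; last exact: span_gen.
    exact: submod0 (span_submod _).
  have [k /mdvdP [m em]] := gG _ _ hs hu.
  exists (Gf k), m, (T k), u; split=> //; last exact/(is_LML_monE hlt).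
  by apply/mapP; exists G`_k => //; apply: mem_nth.
move=> W0 h; split; first by apply: span_min h4; exact: Syz_submod.
move=> Sh; have [io hio] := fun_choice (fun k i =>
  Gf i = W k /\ C i = ebasis k) (fun k => idx k (W0 k)).
pose h' := comb (fun k => ebasis (io k)) h.
have Sh' : Syz Gf h'.
  rewrite /Syz -/(comb Gf h') comb_comp -[RHS]Sh; apply: eq_bigr => k _.
  by rewrite comb_ebasis (hio k).1.
have [q eq] := syz_gen hlt hT htie hZ1 hZ2 crit Sh'.
have -> : h = comb (fun j => comb C (Zs j)) q.
  rewrite -comb_comp -eq comb_comp -[LHS]comb_basis; apply: eq_bigr => k _.
  by rewrite comb_ebasis (hio k).2.
apply: submod_comb; first exact: span_submod.
by move=> i; have [] := hS _ (enum_valP i).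
Qed.

End Buchberger.

(** * Elimination *)

Section Elimination.
Variables (r : nat) (b : 'I_r -> nat) (N : 'rV[A]_r -> Prop).
Hypothesis hN : is_submod N.
Implicit Types (E : {set 'I_r}) (V : seq 'rV[A]_r) (x y u v : 'rV[A]_r).
Local Notation FL := (FL a w).

Definition supported E x := forall j, j \notin E -> x 0 j = 0.

(** Pairs instead of a family of coefficients indexed by [V], because every step
    deletes elements of [V]. *)
Definition bounded_rep q V x := exists s : seq (A * 'rV[A]_r),
  (forall p, p \in s -> p.2 \in V /\ FL b q (p.1 *: p.2)) /\
  x = \sum_(p <- s) p.1 *: p.2.

(** What elimination preserves: [EV.2] is a standard basis of the part of [N]
    supported in [EV.1], and modulo [N] every vector can be moved into that
    support without raising its degree. *)
Record elim_inv (EV : {set 'I_r} * seq 'rV[A]_r) : Prop := ElimInv {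
  ei_mem : forall v, v \in EV.2 -> [/\ v != 0, N v & supported EV.1 v];
  ei_rep : forall q x, N x -> supported EV.1 x -> FL b q x -> bounded_rep q EV.2 x;
  ei_red : forall q x, FL b q x ->
    exists y, [/\ FL b q y, supported EV.1 y & N (x - y)]
}.

Lemma elim_halts EV : halts (@elim_step K A n a w r b) EV.
Proof.
case: EV => E V; have [k] := ubnP #|E|; elim: k E V => [E V|k IH E V hk].
  by rewrite ltn0.
constructor => EV' hst; inversion hst; subst; apply: IH.
by move: hk; rewrite (cardsD1 i) H1; lia.
Qed.

Lemma elim_inv_start lt G : graded_left_monomial_ordering a prec w b lt ->
  left_Groebner_basis a lt N G -> elim_inv (setT, G).
Proof.
move=> hlt hG; have [T gb] := Groebner_seq_family hlt.1 hG; split=> /=.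
- move=> v /hG.1 [Nv /eqP v0]; split=> // j; by rewrite inE.
- move=> q x Nx _ hx; have [h [e hh]] := Groebner_rep hlt.1 hN gb Nx.
  exists [seq (h 0 k, fam G k) | k <- enum 'I_(size G)]; split.
    move=> p /mapP [k _ ->] /=; split; first exact: fam_mem.
    have [h0 h1] := (LM_leP hlt.1 _ _).1 (hh k);
      have [x0|/(lead_ex hlt.1) [u hu]] := eqVneq x 0.
      by rewrite h1 //; exact: FL0.
    by apply: (FL_LM_bound hlt (h0 _ hu)); exact: (FL_lead hu hx).
  by rewrite big_map big_enum.
- move=> q x hx; exists x; split=> //; first by move=> j; rewrite inE.
  by rewrite subrr; exact: submod0.
Qed.

(** Subtracting the multiple of [v] which clears the entry at [i] keeps the
    filtration degree, because that entry of [v] is a scalar sitting in the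
    degree of [v]. *)
Lemma FL_clear v i k q x : unit_coef_at a w b v i k -> FL b q x ->
  FL b q (x - (k^-1 *: x 0 i) *: v).
Proof.
case=> _ _ /dfilE [_ hv _] hx; apply: FLB => //.
rewrite -[x 0 i]mul1r scalerAl -scalerA; exact/FL_scalec/(FL_coef_scale hx).
Qed.

Lemma clear_at v i k x : unit_coef_at a w b v i k -> (x - (k^-1 *: x 0 i) *: v) 0 i =
  0.
Proof.
case=> vi k0 _; rewrite !mxE vi -scalerAr mulr1 scalerA divff // scale1r subrr //.
Qed.

(** Clearing the entries at [i] rewrites an expression over the old relations as
    one over the new relations plus a multiple of [v]; if the value has no entry
    at [i], that multiple is 0. *)
Lemma elim_inv_step EV EV' : elim_inv EV -> elim_step a w b EV EV' -> elim_inv EV'.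
Proof.
move=> hi hst; case: hst hi => E V1 v V2 i k iE hu least hi.
have [vi k0 hd] := hu; have [h1 h2 h3] := hi; rewrite /= in h1 h2 h3.
have vV : v \in V1 ++ v :: V2 by rewrite mem_cat mem_head orbT.
have [v0 Nv sv] := h1 v vV.
pose cl u := u - (k^-1 *: u 0 i) *: v.
have Ncl u : N u -> N (cl u) by move=> Nu; apply: submodB => //; exact: submodZ.
have scl u : supported E u -> supported (E :\ i) (cl u).
  move=> su j; rewrite !inE negb_and negbK => /orP [/eqP ->|jE];
    first exact: (clear_at _ hu).
  by rewrite !mxE (su j jE) (sv j jE) mulr0 subr0.
have clv : cl v = 0 by rewrite /cl vi scalerA mulVf // !scale1r subrr.
split=> /=.
- move=> u; rewrite mem_filter => /andP [u0 /mapP [u' hu' eu]]; rewrite eu in u0 *.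
  have [_ Nu su] : [/\ u' != 0, N u' & supported E u'].
    by apply: h1; move: hu'; rewrite !mem_cat in_cons => /orP [->|->]; rewrite ?orbT.
  by split=> //; [exact: Ncl|exact: scl].
- move=> q x Nx sx hx; have sx' : supported E x.
    by move=> j jE; apply: sx; rewrite !inE (negPf jE) andbF.
  have [s [hs ex]] := h2 q x Nx sx' hx.
  pose s' := [seq p <- [seq (p.1, cl p.2) | p <- s] | p.2 != 0].
  have es : \sum_(p <- s') p.1 *: p.2 = \sum_(p <- s) p.1 *: cl p.2.
    rewrite big_filter big_map big_mkcond; apply: eq_bigr => p _ /=.
    by case: eqVneq => // ->; rewrite scaler0.
  exists s'; split.
    move=> p; rewrite mem_filter => /andP [p0 /mapP [p' hp ep]];
      rewrite ep /= in p0 *.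
    have [pV pF] := hs p' hp; split.
      rewrite mem_filter p0; apply/mapP; exists p'.2 => //.
      move: pV; rewrite !mem_cat in_cons => /orP [->//|/orP [/eqP e|->]];
        rewrite ?orbT //.
      by rewrite e clv eqxx in p0.
    rewrite /cl scalerBr scalerA -scalerAr; have := FL_clear hu pF.
    by rewrite mxE.
  rewrite es; pose c := \sum_(p <- s) p.1 * (k^-1 *: p.2 0 i).
  have e1 : x = \sum_(p <- s) p.1 *: cl p.2 + c *: v.
    rewrite ex scaler_suml -big_split; apply: eq_bigr => p _ /=.
    by rewrite /cl scalerBr scalerA subrK.
  have : (c *: v) 0 i = 0.
    rewrite (_ : c *: v = x - \sum_(p <- s) p.1 *: cl p.2);
      last by rewrite {1}e1 [X in X - _]addrC addrK.
    rewrite mxE sx ?inE ?eqxx // mxE summxE big1 ?subrr // => p _.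
    by rewrite mxE (clear_at _ hu) mulr0.
  rewrite mxE vi -scalerAr mulr1 => /eqP; rewrite scaler_eq0 (negPf k0) /= => /eqP c0.
  by rewrite {1}e1 c0 scale0r addr0.
- move=> q x /h3 [y [hy sy Nxy]]; exists (cl y); split; [exact: FL_clear|exact: scl|].
  rewrite /cl opprB addrA addrAC; apply: submodD => //; exact: submodZ.
Qed.

Lemma least_ord (P : 'I_r -> Prop) : (exists i, P i) ->
  exists i, P i /\ forall j : 'I_r, (j < i)%N -> ~ P j.
Proof.
case=> i; have [k] := ubnP (i : nat); elim: k i => [i|k IH i hk Pi].
  by rewrite ltn0.
case: (classic (exists2 j : 'I_r, (j < i)%N & P j)) => [[j lj Pj]|no].
  by apply: (IH j) => //; lia.
by exists i; split=> // j lj Pj; apply: no; exists j.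
Qed.

(** When no step applies, a relation with a nonzero entry in the degree of its
    generator would have a term whose element of [V] has a scalar entry there,
    that is, a possible step. *)
Lemma elim_inv_stop E V x i : elim_inv (E, V) ->
    (forall z, ~ elim_step a w b (E, V) z) ->
  N x -> supported E x -> i \in E -> FL b (b i) x -> x 0 i = 0.
Proof.
move=> hi stop Nx sx iE hx; apply/eqP; apply/negP => /negP nz.
have [s [hs ex]] := ei_rep hi Nx sx hx.
have [p ps pi] : exists2 p, p \in s & p.1 * p.2 0 i != 0.
  apply/hasP; apply: contraNT nz => /hasPn h; rewrite ex summxE big_seq big1 // =>
    p /h.
  by rewrite mxE negbK => /eqP.
have [/= pV pF] := hs p ps; have [p0 _ _] := ei_mem hi pV.
have p1 : p.1 != 0 by apply: contraNneq pi => ->; rewrite mul0r.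
have p2 : p.2 0 i != 0 by apply: contraNneq pi => ->; rewrite mulr0.
have [d hd hdeg] := FL_divisor (std_order_graded b) p1 p0 pF.
have [_ Fd _] := (dfilE _ _ _).1 hd; have [lid _] := FL_coef Fd p2.
have [m hm] := is_LM_ex p1; have := hdeg m ((is_LM_mon _ _).1 hm).1 => ldi.
have ed : d = b i by apply/eqP; rewrite eqn_leq lid andbT; lia.
rewrite {}ed in hd Fd.
have ui : unit_coef_at a w b p.2 i (coefv p.2 (0%MM, i)).
  split=> //; first exact: (FL_unit Fd).
  by apply: contraNneq p2 => e; rewrite (FL_unit Fd) e scale0r.
have [|j [[jE [k uj]] hj]] := @least_ord (fun i =>
  i \in E /\ exists k, unit_coef_at a w b p.2 i k).
  by exists i; split=> //; eexists; exact: ui.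
have [V1 [V2 eV]] : exists V1 V2, V = V1 ++ p.2 :: V2.
  by case/splitPr: pV => V1 V2; exists V1, V2.
apply: (stop _); rewrite eV; apply: (ElimStep V1 V2 jE uj) => j' l j'E lj' u'.
by apply: (hj j' lj'); split=> //; exists l.
Qed.

(** * The smaller presentation *)

Lemma incl_enum E (x : 'rV[A]_#|E|) q : incl x 0 (enum_val q) = x 0 q.
Proof.
rewrite /incl summxE (bigD1 q) //= mxE ebasisE eqxx mulr1 big1 ?addr0 // => p ne.
by rewrite mxE ebasisE (inj_eq enum_val_inj) eq_sym (negPf ne) mulr0.
Qed.

Lemma incl_supported E (x : 'rV[A]_#|E|) : supported E (incl x).
Proof.
move=> j jE; rewrite /incl summxE big1 // => p _; rewrite mxE ebasisE.
case: eqVneq => [e|_]; last by rewrite mulr0.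
by rewrite e enum_valP in jE.
Qed.

Lemma incl_inj E : injective (@incl K A r E).
Proof. by move=> x y e; apply/rowP => q; rewrite -!incl_enum e. Qed.

Lemma restrK E x : supported E x -> incl (restr E x) = x.
Proof.
move=> sx; apply/rowP => j; case: (boolP (j \in E)) => jE.
  by rewrite -[j](enum_rankK_in jE) // incl_enum mxE.
by rewrite incl_supported // sx.
Qed.

Lemma incl_ebasis E (q : 'I_#|E|) :
  incl (ebasis q : 'rV[A]_#|E|) = ebasis (enum_val q).
Proof.
rewrite /incl (bigD1 q) //= ebasisE eqxx scale1r big1 ?addr0 // => p /negPf ne.
by rewrite ebasisE ne scale0r.
Qed.

Lemma FL_incl E q (x : 'rV[A]_#|E|) :
  FL b q (incl x) <-> FL (fun p : 'I_#|E| => b (enum_val p)) q x.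
Proof.
split=> /FLE h; apply/FLE => -[m j]; rewrite /coefv /=.
  by rewrite -incl_enum => hm; exact: (h (m, enum_val j)).
case: (boolP (j \in E)) => jE; last by rewrite incl_supported // raddf0 mcoeff0 eqxx.
rewrite -[j](enum_rankK_in jE) // incl_enum => hm.
exact: (h (m, enum_rank_in jE j)).
Qed.

Section Restricted.
Variables (E : {set 'I_r}) (V : seq 'rV[A]_r).
Hypothesis hi : elim_inv (E, V).
Hypothesis stop : forall z, ~ elim_step a w b (E, V) z.
Local Notation S0 := (restricted_stage b E V).

(** These are the expressions of bounded degree provided by the invariant, with
    the bound forgotten. *)
Lemma restricted_submod (x : 'rV[A]_#|E|) : submod S0 x <-> N (incl x).
Proof.
split.
  apply: (span_min (N := fun x : 'rV[A]_#|E| => N (incl x))).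
    split=> [|f y z Ny Nz]; first by rewrite linear0; exact: submod0.
    by rewrite linearP; apply: submodD => //; exact: submodZ.
  move=> g /mapP [v /(ei_mem hi) /= [_ Nv sv] ->]; by rewrite restrK.
move=> Nx; have [q hq] := FL_exh b (incl x).
have [s [hs ex]] := ei_rep hi Nx (incl_supported x) hq.
have -> : x = \sum_(p <- s) p.1 *: restr E p.2.
  apply: incl_inj; rewrite ex linear_sum big_seq [RHS]big_seq; apply: eq_bigr => p ps.
  have [/= pV _] := hs p ps; have [_ _ sp] := ei_mem hi pV.
  by rewrite linearZ /= restrK.
have hsp := span_submod (fam (gens S0)).
rewrite big_seq; apply: (submod_sum hsp) => p ps; have [/= pV _] := hs p ps.
by apply: submodZ => //; apply: mem_span; exact: map_f.
Qed.

Lemma restricted_no_unit_entry : no_unit_entry (bdeg S0) (submod S0).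
Proof.
move=> x i /restricted_submod Nx /FL_incl hx; rewrite -incl_enum.
exact: (elim_inv_stop hi stop Nx (incl_supported x) (enum_valP i) hx).
Qed.

Variables (M : lmodType A) (pi : {linear 'rV[A]_r -> M}).
Hypothesis hM : is_quotient N pi.
Local Notation FM := (quotient_filtration (FL b) pi).

Lemma restricted_quotient : is_quotient (submod S0) (phi0 pi E).
Proof.
split=> [y|x]; last by rewrite restricted_submod; exact: hM.2.
have [x ->] := hM.1 y; have [q hq] := FL_exh b x; have [z [_ sz Nxz]] := ei_red hi hq.
exists (restr E z); rewrite /phi0 /= restrK //.
by apply/eqP; rewrite -subr_eq0 -linearB; apply/eqP/(hM.2 _).2.
Qed.

Lemma restricted_filtration q (y : M) :
  FM q y <-> quotient_filtration (FL (bdeg S0)) (phi0 pi E) q y.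
Proof.
split=> [[x hx ->]|[x /FL_incl hx ->]]; last by exists (incl x).
have [z [hz sz Nxz]] := ei_red hi hx; exists (restr E z).
  by apply/FL_incl; rewrite restrK.
rewrite /phi0 /= restrK //.
by apply/eqP; rewrite -subr_eq0 -linearB; apply/eqP/(hM.2 _).2.
Qed.

End Restricted.
End Elimination.

(** An equation between the image of [ebasis i] and that of a vector of the same
    degree without entry at [i] is a relation with a unit entry.  The degrees
    [nu] of a hypothetical smaller F-basis are not known in advance; the same
    remark shows that they are at least those of the basis vectors. *)
Lemma no_unit_entry_minimal_F_basis r (b : 'I_r -> nat) (N : 'rV[A]_r -> Prop)
    (M : lmodType A) (phi : {linear 'rV[A]_r -> M}) (FM : nat -> M -> Prop) :
    no_unit_entry b N -> is_quotient N phi ->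
    (forall q y, FM q y <-> quotient_filtration (FL a w b) phi q y) ->
  minimal_F_basis a w FM (fun i => phi (ebasis i)).
Proof.
move=> hu [_ hk] hF.
have hJ (J : {set 'I_r}) (h : 'rV[A]_r) : \sum_(i in J) h 0 i *: phi (ebasis i) = phi
  (mask J h).
  rewrite [mask J h]row_ebasis linear_sum big_mkcond; apply: eq_bigr => i _.
  by rewrite linearZ /= mxE; case: ifP => // _; rewrite scale0r.
have ne0 i x : FL a w b (b i) x -> x 0 i = 0 -> phi (ebasis i) <> phi x.
  move=> hx xi /eqP; rewrite -subr_eq0 -linearB => /eqP /hk Nx.
  have := hu _ i Nx (FLB (FL_ebasis b i) hx).
  by rewrite !mxE xi subr0 !eqxx => /eqP; rewrite oner_eq0.
have nz i : phi (ebasis i) <> 0.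
  by rewrite -(linear0 phi); apply: ne0; [exact: FL0|rewrite mxE].
split.
  apply/F_basis_onE; split=> //; exists b => q y; rewrite hF;
    split=> [[x hx ->]|[x [hx ->]]].
    by exists x; rewrite hJ mask_setT.
  by exists x => //; rewrite hJ mask_setT.
move=> J /properP [_ [i _ iJ]] /F_basis_onE [_ [nu hnu]].
have lnu j : j \in J -> (b j <= nu j)%N.
  move=> jJ; rewrite leqNgt; apply/negP => lt.
  have : FM (nu j) (phi (ebasis j)).
    apply/hnu; exists (ebasis j); split; first exact: FL_ebasis.
    rewrite hJ; congr (phi _); apply/rowP => l; rewrite [RHS]mxE ebasisE.
    by case: eqVneq => [->|_]; rewrite ?jJ //; case: ifP.
  move=> /hF [x hx e]; apply: (ne0 j x) e; last exact: FL_low hx lt.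
  by apply: FL_mono hx; exact: ltnW.
have /hnu [h [/FLE hh e]] : FM (b i) (phi (ebasis i)).
  by apply/hF; exists (ebasis i) => //; exact: FL_ebasis.
rewrite hJ in e; apply: (ne0 i (mask J h)) e; last by rewrite mxE (negPf iJ).
apply/FLE => -[m j]; rewrite /coefv mxE /=; case: ifP => [jJ|_].
  by move=> /(hh (m, j)) /=; have := lnu j jJ; lia.
by rewrite raddf0 mcoeff0 eqxx.
Qed.

Lemma quotient_iso (L M M' : lmodType A) (N : L -> Prop) (F : nat -> L -> Prop)
    (FM : nat -> M -> Prop) (p : {linear L -> M}) (p' : {linear L -> M'}) :
    is_quotient N p -> is_quotient N p' ->
    (forall q y, FM q y <-> quotient_filtration F p q y) ->
  exists2 psi : {linear M' -> M},
    strict_filtered_iso (quotient_filtration F p') FM psi &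
    forall x, psi (p' x) = p x.
Proof.
move=> [sp kp] [sp' kp'] hF.
have [f hf] := fun_choice (fun y x => y = p' x) sp';
  have [g hg] := fun_choice (fun y x => y = p x) sp.
have e1 x x' : p' x = p' x' <-> p x = p x'.
  have sub (Q : lmodType A) (h : {linear L -> Q}) : h x = h x' <-> kernel h (x - x').
    by rewrite /kernel linearB; split=> [->|/eqP]; rewrite ?subrr // subr_eq0 => /eqP.
  by rewrite !sub kp kp'.
have psiE x : p (f (p' x)) = p x by apply/e1; rewrite -hf.
have lin : linear (fun y => p (f y)).
  move=> c y z; rewrite {1}(hf y) {1}(hf z) -linearP psiE linearP.
  by rewrite -{1}(psiE (f y)) -{1}(psiE (f z)) -!hf.
pose psi : {linear M' -> M} := HB.pack (fun y =>
  p (f y)) (GRing.isLinear.Build A M' M _ _ lin).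
exists psi => //; split.
  exists (fun y => p' (g y)) => y; first by rewrite [RHS]hf; apply/e1; rewrite -hg.
  by rewrite /= psiE -hg.
move=> q y; rewrite hF; split=> [[_ [x hx ->] ->]|[x hx ->]];
  first by exists x => //=; rewrite psiE.
by exists (p' x); [exists x|rewrite /= psiE].
Qed.

(** * The procedures *)

Lemma buchberger_groebner r (b : 'I_r -> nat) t (U : 'I_t -> 'rV[A]_r) :
  Buchberger_computes_Groebner a prec w b U.
Proof.
split; first by exists (std_order b); exact: std_order_graded.
move=> lt hlt; split; first exact: (bstep_halts hlt.1).
by move=> st /(bb_correct hlt.1) [].
Qed.

Lemma buchberger_syz r (b : 'I_r -> nat) t (W : 'I_t -> 'rV[A]_r) :
  (forall k, W k != 0) -> Buchberger_computes_Syz a prec w b W.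
Proof.
move=> W0 lt hlt; split; first exact: (bstep_halts hlt.1).
by move=> st /(bb_correct hlt.1) [_]; apply.
Qed.

Lemma groebner_exists r (b : 'I_r -> nat) t (U : 'I_t -> 'rV[A]_r) :
  exists G, left_Groebner_basis a (std_order b) (span U) G.
Proof.
have [_ h] := buchberger_groebner b U; have [hh hG] := h _ (std_order_graded b).
have [st ho] := halts_output hh; by exists (unzip1 (bb_basis st)); exact: hG.
Qed.

Lemma dfil_uniq r (b : 'I_r -> nat) (x : 'rV[A]_r) p q :
  dfil (FL a w b) x p -> dfil (FL a w b) x q -> p = q.
Proof.
by move=> /dfilE [_ p1 p2] /dfilE [_ q1 q2]; apply/eqP; rewrite eqn_leq p2 // q2.
Qed.

Lemma F_basis_groebner r (b : 'I_r -> nat) (N : 'rV[A]_r -> Prop) lt G :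
    graded_left_monomial_ordering a prec w b lt -> is_submod N ->
    left_Groebner_basis a lt N G ->
  standard_basis a w (FL a w b) N (fam G).
Proof.
move=> hlt hN /(Groebner_seq_family hlt.1) [T gb]; have hs := Groebner_std hN hlt gb.
have [gN gT _] := gb; split=> //; have [_ hd _] := hs.
apply: (gen_on_F_basis hN gN) hd (std_gen_on hs) => i _ e.
by case/is_LMLE: (gT i); rewrite e coefv0 eqxx.
Qed.

(** A generating set of symbols with the fewest elements is irredundant. *)
Lemma select_exists (S : stage A) lt G :
    graded_left_monomial_ordering a prec w (bdeg S) lt ->
    left_Groebner_basis a lt (submod S) G ->
  exists t (W : 'I_t -> 'rV[A]_(rk S)), select_minimal a w G W.
Proof.
move=> hlt /(Groebner_seq_family hlt.1) [T gb];
  have hN : is_submod (submod S) := span_submod _.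
have [gN gT _] := gb; pose c k := degL (bdeg S) (T k); pose v := fam G.
have hs : std_family (bdeg S) (submod S) c v := Groebner_std hN hlt gb.
have hd k : dfil (FL a w (bdeg S)) (v k) (c k) := dfil_lead hlt (gT k).
pose gen J := gen_on (bdeg S) (submod S) c v J.
pose bgen J := if excluded_middle_informative (gen J) then true else false.
have bgenP J : bgen J <-> gen J by rewrite /bgen; case: excluded_middle_informative.
have gT' : bgen setT by apply/bgenP; exact: std_gen_on.
case: (arg_minnP (fun J : {set _} => #|J|) gT') => J /bgenP gJ hmin.
pose f (k : 'I_#|J|) := enum_val k; pose W k := v (f k).
have NW k : submod S (W k) by exact: gN.
exists #|J|, W; split; first by exists f => //; exact: enum_val_inj.
have dW k : dfil (FL a w (bdeg S)) (W k) (c (f k)) by exact: hd.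
exists (fun k => c (f k)); split.
- by move=> k; apply/dfil_induced.
- apply: (gen_on_gr hN dW) => q x Nx hx; have [h [/FLE hh ->]] := gJ q x Nx hx.
  exists (restr J h); split.
    by apply/FLE => -[m k]; rewrite /coefv mxE => hm; exact: (hh (m, enum_val k)).
  rewrite mask_setT comb_mask big_enum_val; apply: eq_bigr => k _; by rewrite mxE.
- move=> J' pJ' /(gr_gen_on hN dW) gJ'.
  have /hmin : bgen (f @: J').
    apply/bgenP => q x Nx hx; have [h [hh ->]] := gJ' q x Nx hx.
    exists (incl h); split; first exact/FL_incl.
    rewrite !comb_mask big_imset /=; last by move=> k l _ _; exact: enum_val_inj.
    by apply: eq_bigr => k _; rewrite incl_enum.
  rewrite card_imset; last exact: enum_val_inj.
  by have := proper_card pJ'; rewrite cardsT card_ord; lia.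
Qed.

Lemma selection_mem (S : stage A) t (W : 'I_t -> 'rV[A]_(rk S)) :
  minimal_selection a prec w W -> (forall i, submod S (W i)) /\
    minimal_symbol_generators a w (induced (FL a w (bdeg S)) (submod S)) W.
Proof.
case=> lt [G [_ [hG _] [[f _ eW] hm]]]; split=> // i.
by rewrite eW; have [] := hG _ (fam_mem (f i)).
Qed.

(** One step of the construction yields a strict presentation whose relations
    have no unit entry, which is what the next step and the bound on the length
    rely on. *)
Lemma resolution_stepP (S T : stage A)
    (phi : {linear 'rV[A]_(rk T) -> 'rV[A]_(rk S)}) :
    resolution_step a prec w phi ->
  let W k := phi (ebasis k) in
  [/\ std_family (bdeg S) (submod S) (bdeg T) W, forall x, submod T x <-> Syz W x,
      no_unit_entry (bdeg T) (submod T), forall k, W k != 0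
    & minimal_standard_basis a w (FL a w (bdeg S)) (submod S) W].
Proof.
move=> [/selection_mem [NW hW] hT hd] W; have hN := span_submod (fam (gens S)).
have [q [hq hs hm]] := minimal_symbols_std hN hW NW.
have eq : q = bdeg T by apply: functional_extensionality => k;
  exact: dfil_uniq (hq k) (hd k).
rewrite {}eq in hq hs hm; split=> //.
- by move=> x i /hT; exact: (minimal_no_unit_entry hs hm).
- by move=> k; case/dfilE: (hd k).
- exact: (minimal_symbols_basis hN hW NW).
Qed.

Lemma resolution_step_maps (S T : stage A)
    (phi : {linear 'rV[A]_(rk T) -> 'rV[A]_(rk S)}) :
    resolution_step a prec w phi ->
  [/\ filtered (FL a w (bdeg T)) (FL a w (bdeg S)) phi,
      strict_filtered (FL a w (bdeg T)) (FL a w (bdeg S)) phi,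
      forall x, submod S x <-> exists y, x = phi y
    & forall y, submod T y <-> kernel phi y].
Proof.
move=> /resolution_stepP [[NW dW hs] hT _ _ _]; have hN := span_submod (fam (gens S)).
have hfil : filtered (FL a w (bdeg T)) (FL a w (bdeg S)) phi.
  by move=> q x hx; rewrite linear_comb; exact: FL_comb dW hx.
have im x : submod S x <-> exists y, x = phi y.
  split=> [Nx|[y ->]]; last by rewrite linear_comb; exact: submod_comb.
  have [q hq] := FL_exh (bdeg S) x; have [h [_ ->]] := hs q x Nx hq.
  by exists h; rewrite linear_comb.
split=> // [q y|y]; last by rewrite hT /Syz /kernel linear_comb.
split=> [[x hx ->]|[/im Ny hy]]; first by split; [exists x|exact: hfil].
by have [h [hh ->]] := hs q y Ny hy; exists h => //; rewrite linear_comb.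
Qed.

Lemma stage_correct (S : stage A) : step_correct a prec w S.
Proof.
split.
- exact: buchberger_groebner.
- by move=> lt G; exact: select_exists.
- move=> t W /selection_mem [NW hW]; have hN := span_submod (fam (gens S)).
  split; first exact: (minimal_symbols_basis hN hW NW).
  have [q [hq _ _]] := minimal_symbols_std hN hW NW.
  by apply: buchberger_syz => k; case/dfilE: (hq k).
- by move=> T phi; exact: resolution_step_maps.
Qed.

Lemma resolution_step_exists (S : stage A) :
  exists (T : stage A) (phi : {linear 'rV[A]_(rk T) -> 'rV[A]_(rk S)}),
    resolution_step a prec w phi.
Proof.
have [G hG] := groebner_exists (bdeg S) (fam (gens S)).
have hlt := std_order_graded (bdeg S).
have [t [W hW]] := select_exists hlt hG.
have hsel : minimal_selection a prec w W by exists (std_order (bdeg S)), G.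
have [NW hm] := selection_mem hsel.
have [q [hq _ _]] := minimal_symbols_std (span_submod (fam (gens S))) hm NW.
have W0 k : W k != 0 by case/dfilE: (hq k).
have [hh hZ] := buchberger_syz W0 hlt; have [st ho] := halts_output hh.
pose T := Stage q (bb_syz st); exists T, (comb W : {linear 'rV[A]_(rk T) -> _}).
have eW : (fun k : 'I_(rk T) => comb W (ebasis k)) = W.
  by apply: functional_extensionality => k; rewrite comb_ebasis.
rewrite /resolution_step /= eW; split=> // [|k]; first exact: (hZ _ ho).
by rewrite comb_ebasis.
Qed.

Section Main.
Variables (m : nat) (b : 'I_m -> nat) (N : 'rV[A]_m -> Prop).
Hypothesis hN : is_submod N.
Variables (M : lmodType A) (pi : {linear 'rV[A]_m -> M}).
Hypothesis hM : is_quotient N pi.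
Local Notation FM := (quotient_filtration (FL a w b) pi).

Lemma output_elim_inv lt G E V : graded_left_monomial_ordering a prec w b lt ->
    left_Groebner_basis a lt N G ->
    output (elim_step a w b) (setT, G) (E, V) ->
  elim_inv b N (E, V) /\ forall z, ~ elim_step a w b (E, V) z.
Proof.
move=> hlt hG ho; split; last by case: ho.
apply: (output_inv _ (elim_inv_start hN hlt hG) ho) => u v; exact: (elim_inv_step hN).
Qed.

(** The minimal resolution is compared with Schreyer's resolution of the same
    module, starting from the identity of the first free module. *)
Lemma constructed_resolves E V T (phi : chain_maps (restricted_stage b E V) T) :
  constructed a prec w N phi ->
  resolves a w FM (S0 := restricted_stage b E V) (phi0 pi E) phi.
Proof.
case=> [[lt [G [hlt hG ho]]] hstep].
have [hi stop] := output_elim_inv hlt hG ho.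
set S0 := restricted_stage b E V in phi hstep *.
have nu0 : no_unit_entry (bdeg S0) (submod S0) := restricted_no_unit_entry hN hi stop.
have hq : is_quotient (submod S0) (phi0 pi E) := restricted_quotient hN hi hM.
have hF q y : FM q y <-> quotient_filtration (FL a w (bdeg S0)) (phi0 pi E) q y.
  exact: (restricted_filtration hi hM q y).
have nu i : no_unit_entry (bdeg (stages S0 T i)) (submod (stages S0 T i)).
  by case: i => [//|i]; have [] := resolution_stepP (hstep i).
have ker i : @ker_at K A M (fun i => rk (stages S0 T i)) (phi0 pi E) phi i = submod
  (stages S0 T i).
  apply: functional_extensionality => x; apply: propositional_extensionality.
  case: i x => [|i] x; first exact: hq.2.
  by have [_ _ _ ->] := resolution_step_maps (hstep i).
split.
  split=> //.
  - exact: (no_unit_entry_minimal_F_basis nu0 hq hF).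
  - by move=> i x; rewrite ker; have [_ _ ->] := resolution_step_maps (hstep i).
  - by move=> i; have [] := resolution_step_maps (hstep i).
  - by move=> i; have [] := resolution_step_maps (hstep i).
  - by move=> i; rewrite ker; have [] := resolution_stepP (hstep i).
exists n => //.
have hpd : res_length_le n (bdeg S0) (submod S0).
  have [G' hG'] := groebner_exists (bdeg S0) (fam (gens S0)).
  have hlt' := std_order_graded (bdeg S0); have [T' gb] :=
    Groebner_seq_family hlt'.1 hG'.
  by apply: (res_length_le_n hlt' _ gb nu0); exact: span_submod.
have r0 : rk (stages S0 T n.+1) = 0%N.
  pose W i (k : 'I_(rk (stages S0 T i.+1))) : 'rV[A]_(rk (stages S0 T i)) :=
    phi i (ebasis k).
  apply: (@minimal_length (fun i => rk (stages S0 T i)) (fun i =>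
    bdeg (stages S0 T i))
    (fun i => submod (stages S0 T i)) W _ _ _ nu n 0 (rk S0) (bdeg S0) (submod S0)
    (fun k => ebasis k) (fun k => ebasis k) (fun=> 0)) => //.
  - by move=> i; exact: span_submod.
  - by move=> i; have [] := resolution_stepP (hstep i).
  - by move=> i; have [] := resolution_stepP (hstep i).
  - by move=> j; exact: FL_ebasis.
  - by move=> j; exact: FL_ebasis.
  - by move=> j; exact: FL0.
  - by move=> x; rewrite comb_basis.
  - by move=> x; rewrite comb_basis.
  - by move=> x _; apply: big1 => k _; rewrite scaler0.
  - by move=> j; rewrite comb_basis subrr subr0; exact: submod0 (span_submod _).
move=> i; elim: i => [//|i IH]; rewrite ltnS leq_eqVlt => /orP [/eqP <- //|/IH {}IH].
have [_ _ _ W0 _] := resolution_stepP (hstep i).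
case e : (rk (stages S0 T i.+1)) => [//|p]; exfalso.
have j : 'I_(rk (stages S0 T i.+1)) by rewrite e; exact: ord0.
case/eqP: (W0 j); apply/rowP => l; have := leq_trans (ltn_ord l) (eq_leq IH).
by rewrite ltn0.
Qed.

Lemma construction_exists lt G : graded_left_monomial_ordering a prec w b lt ->
    left_Groebner_basis a lt N G ->
  exists E V T (phi : chain_maps (restricted_stage b E V) T),
    constructed a prec w N phi.
Proof.
move=> hlt hG; have [[E V] ho] := halts_output (elim_halts b (setT, G)).
pose cT S := constructive_indefinite_description _ (resolution_step_exists S).
pose cphi S := constructive_indefinite_description _ (svalP (cT S)).
pose S0 := restricted_stage b E V.
pose T := fix T i := if i is j.+1 then sval (cT (T j)) else sval (cT S0).
pose phi : chain_maps S0 T := fun i => match i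
  return {linear 'rV[A]_(rk (stages S0 T i.+1)) -> 'rV[A]_(rk (stages S0 T i))}
  with 0%N => sval (cphi S0) | j.+1 => sval (cphi (T j)) end.
exists E, V, T, phi; split; first by exists lt, G.
by case=> [|i]; exact: svalP (cphi _).
Qed.

Lemma elimination_is_correct lt G E V :
    graded_left_monomial_ordering a prec w b lt -> left_Groebner_basis a lt N G ->
    output (elim_step a w b) (setT, G) (E, V) ->
  elimination_correct a w b N FM pi E V.
Proof.
move=> hlt hG ho; have [hi stop] := output_elim_inv hlt hG ho.
have hq := restricted_quotient hN hi hM.
have hF := restricted_filtration hi hM.
split.
- move=> v /(ei_mem hi) /= [_ Nv sv]; split=> //; exists (restr E v);
    by rewrite restrK.
- move=> M' pi' hq'; exact: (quotient_iso hq hq' hF).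
have -> : (fun q : 'I_#|E| => pi (ebasis (enum_val q))) = (fun q =>
  phi0 pi E (ebasis q)).
  by apply: functional_extensionality => q; rewrite /phi0 /= incl_ebasis.
exact: (no_unit_entry_minimal_F_basis (restricted_no_unit_entry hN hi stop) hq hF).
Qed.

End Main.

End Theory.

Theorem theorem7p4 (K : fieldType) (A : algType K) (n : nat) (a : 'I_n -> A)
  (prec : rel 'X_{1..n}) (w : 'I_n -> nat)
  (hA : solvable_polynomial_algebra a prec)
  (hw : forall i, (0 < w i)%N)
  (hgr : graded_ordering prec w)
  (m : nat) (b : 'I_m -> nat) (s : nat) (xi : 'I_s -> 'rV[A]_m)
  (M : lmodType A) (pi : {linear 'rV[A]_m -> M})
  (hM : is_quotient (span xi) pi) :
  let N := span xi in
  let FM := quotient_filtration (FL a w b) pi in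
  (* M has a minimal filtered free resolution of length at most n which is
     obtained by the procedures ... *)
  (exists E V T (phi : chain_maps (restricted_stage b E V) T),
     constructed a prec w N phi /\ resolves a w FM (S0 := restricted_stage b E V) (phi0 pi E) phi) /\
  (* ... and whatever the procedures construct is such a resolution. *)
  (forall E V T (phi : chain_maps (restricted_stage b E V) T),
     constructed a prec w N phi -> resolves a w FM (S0 := restricted_stage b E V) (phi0 pi E) phi) /\
  Buchberger_computes_Groebner a prec w b xi /\
  forall lt G, graded_left_monomial_ordering a prec w b lt ->
    left_Groebner_basis a lt N G ->
    [/\ standard_basis a w (FL a w b) N (fam G),
        halts (elim_step a w b) ([set: 'I_m], G)
      & forall E V, output (elim_step a w b) ([set: 'I_m], G) (E, V) ->
          elimination_correct a w b N FM pi E V /\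
          forall S, reachable a prec w (restricted_stage b E V) S ->
            step_correct a prec w S].
Proof.
move=> N FM; have hN : is_submod N by exact: span_submod.
have [G0 hG0] := groebner_exists hA hgr b xi.
have hlt0 := std_order_graded hA hgr b.
split; [|split; [|split]].
- have [E [V [T [phi hc]]]] := construction_exists hA hgr hlt0 hG0.
  by exists E, V, T, phi; split=> //; exact: (constructed_resolves hA hw hgr hN hM).
- by move=> E V T phi; exact: (constructed_resolves hA hw hgr hN hM).
- exact: (buchberger_groebner hA hgr).
move=> lt G hlt hG; split.
- exact: (F_basis_groebner hA hgr hlt hN hG).
- exact: elim_halts.
move=> E V ho; split; first exact: (elimination_is_correct hA hw hgr hN hM hlt hG ho).
by move=> S _; exact: (stage_correct hA hw hgr).
Qed.
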